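(* Let $d\geq 2$. There exists an open and dense subset $M(d)\subset A(d)$ such that if $\mathcal G\in M(d)$, then the only algebraic curves invariant by $\mathcal G$ are its three invariant lines in general position. Here $A(d)=Il_3(d,2)\cap\mathcal H(d,2)$ is the set of degree-$d$ foliations on $\mathbb P^2$ that have three invariant lines in general position and all of whose singularities are hyperbolic.
   Context: All objects are over $\mathbb C$. $\mathbb{F}\mathrm{ol}(d,2)$ is the space of singular holomorphic foliations of degree $d$ on $\mathbb P^2$: such a foliation is given, up to a nonzero constant factor, by a homogeneous $1$-form $\Omega=\sum_{j=0}^2 A_j\,dz_j$ on $\mathbb C^3$ with $A_j$ homogeneous polynomials of the same degree $d+1$, $\sum_j z_jA_j\equiv 0$, and $\operatorname{codim}\{A_0=A_1=A_2=0\}\ge 2$. Thus $\mathbb{F}\mathrm{ol}(d,2)$ is a Zariski open subset of a projective space, and its subsets carry the induced topology. $Il_3(d,2)$ is the set of $\mathcal G\in\mathbb{F}\mathrm{ol}(d,2)$ having $3$ invariant lines in general position; equivalently, the set of foliations obtained by letting the linear automorphisms of $\mathbb P^2$ act on the degree-$d$ foliations that leave the lines $X=0$, $Y=0$, $Z=0$ invariant. A singularity $q$ of $\mathcal G$ is nondegenerate if there is a holomorphic vector field $X$ tangent to $\mathcal G$ near $q$, with isolated singularity at $q$, such that $DX(q)$ is nonsingular; its characteristic numbers are the two quotients $\lambda,\lambda^{-1}$ of the eigenvalues of $DX(q)$. It is hyperbolic if its characteristic numbers are non-real. $\mathcal H(d,2)$ is the set of $\mathcal G\in\mathbb{F}\mathrm{ol}(d,2)$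 all of whose singularities are nondegenerate and hyperbolic. *)

(* Defs.v *)
From HB Require Import structures.
From mathcomp Require Import all_boot all_order all_algebra.
From mathcomp Require Import complex.
From mathcomp Require mpoly.
From mathcomp Require Import all_classical all_reals all_analysis.
(* The notations of mpoly clash with those of mathcomp-analysis. *)
Import -(notations) mpoly.
Import Order.TTheory GRing.Theory Num.Theory numFieldNormedType.Exports.

Set Implicit Arguments.
Unset Strict Implicit.
Unset Printing Implicit Defensive.

Local Open Scope classical_set_scope.
Local Open Scope ring_scope.
Local Open Scope quotient_scope.

(* Typed as a numClosedFieldType, so that the generic topology on numeric
   fields applies to it. *)
Definition Cplx (R : realType) : numClosedFieldType := R[i].

Section Zariski.
Context {K : fieldType} {n : nat}.

Definition zero_locus (S : set (mpoly n K)) : set ('I_n -> K) :=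
  [set z | forall p, S p -> meval z p = 0].

Definition zariski_closed (Z : set ('I_n -> K)) : Prop :=
  exists S, Z = zero_locus S.

Definition irreducible_closed (Z : set ('I_n -> K)) : Prop :=
  [/\ zariski_closed Z, Z !=set0 &
      forall Z1 Z2, zariski_closed Z1 -> zariski_closed Z2 ->
        Z `<=` Z1 `|` Z2 -> Z `<=` Z1 \/ Z `<=` Z2].

(* codim Z >= k in affine n-space: every irreducible closed subset of Z is the
   bottom of a strict chain of k + 1 irreducible closed sets. *)
Definition codim_ge (k : nat) (Z : set ('I_n -> K)) : Prop :=
  forall Y, irreducible_closed Y -> Y `<=` Z ->
    exists c : nat -> set ('I_n -> K),
      [/\ c 0%N = Y,
          forall i, (i <= k)%N -> irreducible_closed (c i) &
          forall i, (i < k)%N -> c i `<` c i.+1].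

End Zariski.

Section Foliations.
Variables (R : realType) (d : nat).
Local Notation C := (Cplx R).

(* A triple A stands for the 1-form \sum_j A j dz_j on C^3. *)
Definition is_projective_form (A : {ffun 'I_3 -> mpoly 3 C}) : bool :=
  [&& A != 0,
      [forall j, A j \is @ishomog1 3 C d.+1 mdeg] &
      \sum_j mpolyX C (mnm1 j) * A j == 0].

Definition projective_form : Type :=
  {A : {ffun 'I_3 -> mpoly 3 C} | is_projective_form A}.
HB.instance Definition _ := Choice.on projective_form.

Definition form_coefs (W : projective_form) :
    {ptws 'I_3 * multinom 3 -> C} :=
  fun jm => mcoeff jm.2 (val W jm.1).

(* All but finitely many coefficients vanish identically, so this is the
   topology of a finite-dimensional complex vector space (minus 0). *)
HB.instance Definition _ :=
  Topological.copy projective_form (initial_topology form_coefs).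

Definition proportional : rel projective_form := fun W W' =>
  `[< exists2 c : C, c != 0 & val W' = c *: val W >].

Lemma proportional_equiv : equiv_class_of proportional.
Proof.
split.
- by move=> W; apply/asboolP; exists 1; rewrite ?oner_eq0 ?scale1r.
- suff h W W' : proportional W W' -> proportional W' W.
    by move=> W W'; apply/idP/idP => /h.
  move=> /asboolP[c c0 e]; apply/asboolP; exists c^-1; first by rewrite invr_eq0.
  by rewrite e scalerA mulVf // scale1r.
- move=> W2 W1 W3 /asboolP[c c0 e] /asboolP[c' c'0 e']; apply/asboolP.
  by exists (c' * c); [rewrite mulf_neq0 | rewrite e' e scalerA].
Qed.

Canonical proportional_equiv_rel := EquivRelPack proportional_equiv.

(* The projective space of which Fol(d, 2) is an open subset. *)
Definition form_space : topologicalType :=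
  quotient_topology {eq_quot proportional}.

Definition form_of (G : form_space) : 'I_3 -> mpoly 3 C :=
  val (repr (G : {eq_quot proportional})).

Definition Fol : set form_space :=
  [set G | codim_ge 2 [set z | forall j, meval z (form_of G j) = 0]].

(* Affine chart z_k = 1 of the projective plane. *)
Definition chart (k : 'I_3) (u : 'rV[C]_2) : 'I_3 -> C :=
  fun j => if unlift k j is Some i then u 0 i else 1.

(* The restriction of the 1-form to the chart z_k = 1, at u, applied to v. *)
Definition chart_form (G : form_space) (k : 'I_3) (u v : 'rV[C]_2) : C :=
  \sum_(i < 2) meval (chart k u) (form_of G (lift k i)) * v 0 i.

Definition singular_point (G : form_space) (k : 'I_3) (u : 'rV[C]_2) : Prop :=
  forall j, meval (chart k u) (form_of G j) = 0.

(* X is a holomorphic vector field near q, tangent to G, with an isolated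
   singularity at q, and DX(q) is nonsingular.  Differentiability is over the
   field C, i.e. it is complex differentiability. *)
Definition nondegenerate_field (G : form_space) (k : 'I_3) (q : 'rV[C]_2)
    (X : 'rV[C]_2 -> 'rV[C]_2) : Prop :=
  [/\ \forall p \near q, differentiable X p,
      \forall p \near q, chart_form G k p (X p) = 0,
      X q = 0 /\ (\forall p \near q, p != q -> X p != 0) &
      jacobian X q \in unitmx].

Definition nondegenerate (G : form_space) (k : 'I_3) (q : 'rV[C]_2) : Prop :=
  exists X, nondegenerate_field G k q X.

Definition characteristic_number (G : form_space) (k : 'I_3) (q : 'rV[C]_2)
    (lambda : C) : Prop :=
  exists X, nondegenerate_field G k q X /\
  exists l1 l2 : C,
    char_poly (jacobian X q) = ('X - l1%:P) * ('X - l2%:P) /\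
    lambda = l1 / l2.

Definition hyperbolic (G : form_space) (k : 'I_3) (q : 'rV[C]_2) : Prop :=
  nondegenerate G k q /\
  forall lambda, characteristic_number G k q lambda ->
    lambda \isn't Num.real.

(* H(d, 2) *)
Definition Hyp : set form_space :=
  [set G | Fol G /\
    forall k q, singular_point G k q -> hyperbolic G k q].

(* F defines an irreducible algebraic curve of the projective plane. *)
Definition irreducible_curve (F : mpoly 3 C) : Prop :=
  [/\ exists2 m : nat, (0 < m)%N & F \is @ishomog1 3 C m mdeg,
      F != 0 &
      forall P Q, F = P * Q -> P \is a GRing.unit \/ Q \is a GRing.unit].

Definition is_line (F : mpoly 3 C) : Prop :=
  F != 0 /\ F \is @ishomog1 3 C 1 mdeg.

Definition curve_points (F : mpoly 3 C) : set ('I_3 -> C) :=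
  [set z | (exists j, z j != 0) /\ meval z F = 0].

Definition differential (F : mpoly 3 C) (z v : 'I_3 -> C) : C :=
  \sum_j meval z (mderiv j F) * v j.

(* At each smooth point z of the curve F = 0, every vector v tangent to the
   curve is tangent to G; F is meant to be reduced. *)
Definition invariant_curve (F : mpoly 3 C) (G : form_space) : Prop :=
  forall z, curve_points F z -> (exists j, meval z (mderiv j F) != 0) ->
  forall v, differential F z v = 0 ->
    \sum_j meval z (form_of G j) * v j = 0.

(* In general position: no point lies on all three. *)
Definition general_position (l : 'I_3 -> mpoly 3 C) : Prop :=
  ~ exists z, forall i, curve_points (l i) z.

Definition three_invariant_lines (G : form_space) (l : 'I_3 -> mpoly 3 C) :
    Prop :=
  [/\ forall i, is_line (l i), general_position l &
      forall i, invariant_curve (l i) G].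

(* Il_3(d, 2) *)
Definition Il3 : set form_space :=
  [set G | Fol G /\ exists l, three_invariant_lines G l].

Definition Ad : set form_space := Il3 `&` Hyp.

End Foliations.

Definition open_in (T : topologicalType) (A M : set T) : Prop :=
  exists2 U : set T, open U & M = A `&` U.

Definition dense_in (T : topologicalType) (A M : set T) : Prop :=
  M `<=` A /\ A `<=` closure M.

(* Main.v *)
(* Let G be hyperbolic with an invariant triangle.  An irreducible invariant curve
   F of degree m other than the sides avoids the vertices, because no resonance
   holds there, and meets each side in m distinct singular points, because its
   local branches are smooth separatrices.  Carnot's theorem gives a
   multiplicative relation between these singular points.  Moving the singular
   points of one side by a factor 1 + t, while fixing the other two sides,
   destroys all such relations: this gives density.  For openness, the existence
   of lines and singular points in such a relation is rewritten as closed
   algebraic conditions on compact parameters, whose projection is closed.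

   Hyperbolicity in the sense of holomorphic vector fields is shown to be a
   condition on the 1-jets of the form: common factors of the coefficients and
   vanishing 1-jets are excluded because a tangent field X with DX invertible
   would be singular, or the singular points would accumulate. *)
Require Import Defs.
From mathcomp Require Import all_boot all_order all_algebra.
From mathcomp Require Import zify ring complex.
From mathcomp Require Import all_classical all_reals all_analysis.
From mathcomp Require mpoly.
Import -(notations) mathcomp.multinomials.mpoly.
Import Order.TTheory GRing.Theory Num.Theory numFieldNormedType.Exports.

Set Implicit Arguments.
Unset Strict Implicit.
Unset Printing Implicit Defensive.

Local Open Scope ring_scope.

(** * Polynomials in two variables *)

Section Bivariate.
Variable C : numClosedFieldType.
Implicit Types (f g h k : {poly {poly C}}) (p q r : {poly C}) (x y c : C).

(** Carnot's relation is written in a frame adapted to the triangle, and neither the frame nor an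
    ordering of the singular points varies canonically with the form. The openness argument
    therefore quantifies over all lines and points instead of following them, at the price of
    degenerate limits: sides could merge and singular points could collide. Hyperbolicity rules out
    both, since a collision gives a zero determinant, merged sides give a double eigenvalue, and
    both cases belong to the closed condition [nonhyp]. Only finitely many relations can occur,
    because a side carries at most [d - 1] singular points besides its vertices; the factor [1 + t]
    enters a relation with [m] points on each side as its [m]-th power, so no relation holds for all
    [t]. Separatrices are never constructed as convergent series: formal solutions truncated at
    arbitrary order suffice. A tangent field is known only as a differentiable map, so it is
    compared with the polynomial form through limits along lines and through a blow-up. *)

Lemma poly_nonroot p : p != 0 -> exists x, p.[x] != 0.
Proof.
move=> p0; apply: contrapT => /forallNP h.
have rt : all (root p) [seq i%:R | i <- iota 0 (size p)].
  by apply/allP => _ /mapP[i _ ->]; apply/negPn/negP => /h.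
have un : uniq [seq (i%:R : C) | i <- iota 0 (size p)].
  by rewrite map_inj_uniq ?iota_uniq //; apply: mulrIn; rewrite oner_eq0.
by have := max_poly_roots p0 rt un; rewrite size_map size_iota ltnn.
Qed.

Lemma horner_eq0 p : (forall x, p.[x] = 0) -> p = 0.
Proof. by move=> h; apply/eqP/negPn/negP => /poly_nonroot[x]; rewrite h eqxx. Qed.

(** The outer variable is [y] and the inner one [x], so this is the restriction of [f] to a vertical
    line. *)
Definition slice x f : {poly C} := map_poly (horner_eval x) f.

Lemma sliceM x f g : slice x (f * g) = slice x f * slice x g.
Proof. by rewrite /slice rmorphM. Qed.

Lemma sliceC x p : slice x p%:P = p.[x]%:P.
Proof. by rewrite /slice map_polyC. Qed.

Lemma horner_slice x y f : (slice x f).[y] = f.[y%:P].[x].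
Proof. by rewrite -[f.[_].[x]]/(horner_eval x _) -horner_map /= /horner_eval hornerC. Qed.

Lemma slice_eq0 c f : slice c f = 0 -> exists h, f = ('X - c%:P)%:P * h.
Proof.
move=> s0; exists (map_poly (fun p => p %/ ('X - c%:P)) f); apply/polyP => i.
rewrite coefCM coef_map_id0 ?div0p // mulrC divpK //.
rewrite dvdp_XsubCl; have /(congr1 (fun p : {poly C} => p`_i)) := s0.
by rewrite coef_map coef0 => /eqP.
Qed.

Lemma horner2_eq0 f : (forall x y, f.[y%:P].[x] = 0) -> f = 0.
Proof.
move=> h; apply/polyP => i; rewrite coef0; apply: horner_eq0 => x.
have : slice x f = 0 by apply: horner_eq0 => y; rewrite horner_slice.
by move/(congr1 (fun p : {poly C} => p`_i)); rewrite coef_map coef0.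
Qed.

Definition const2 f := exists c : C, f = c%:P%:P.

(** Only constants count as trivial factors: this is irreducibility in C[x, y], and not over the
    field C(x). *)
Definition irreducible2 f :=
  [/\ f != 0, ~ const2 f & forall g h, f = g * h -> const2 g \/ const2 h].

Lemma const2P f : (size f <= 1)%N -> (size (f`_0)%R <= 1)%N -> const2 f.
Proof. by move=> /size1_polyC f1 /size1_polyC f2; exists f`_0`_0; rewrite -f2 -f1. Qed.

Lemma const2_size f : const2 f -> (size f <= 1)%N.
Proof. by move=> [c ->]; exact: size_polyC_leq1. Qed.

Lemma XsubC_Nconst2 c : ~ const2 ('X - c%:P)%:P.
Proof.
move=> [b /polyC_inj /(congr1 (fun p : {poly C} => size p))].
by rewrite size_XsubC size_polyC; case: (b == 0).
Qed.

Lemma closed_rootP p : (1 < size p)%N -> exists c q, p = ('X - c%:P) * q.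
Proof.
move=> s1; have /closed_rootP[c /factor_theorem[q pq]] : size p != 1%N.
  by rewrite neq_ltn s1 orbT.
by exists c, q; rewrite mulrC.
Qed.

Lemma slice_irr f c : irreducible2 f -> (1 < size f)%N -> slice c f != 0.
Proof.
move=> [f0 _ irr] s1; apply/eqP => /slice_eq0[h fh].
have [/XsubC_Nconst2 //|/const2_size s] := irr _ _ fh.
move: s1; rewrite fh; rewrite mul_polyC ltnNge => /negP; apply.
exact: leq_trans (size_scale_leq _ _) s.
Qed.

(* The primes of C[x] are the X - c, so Gauss' lemma is a matter of
   specializing x to c. *)
Lemma gauss_cancel f g k p : p != 0 -> (forall c, slice c f != 0) ->
  p *: g = f * k -> exists k', g = f * k'.
Proof.
move=> p0 fc; have [n] := ubnP (size p); elim: n p k p0 => // n IH p k p0 sp e.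
have [s1|s1] := leqP (size p) 1.
  have pC := size1_polyC s1; have c0 : p`_0 != 0 by rewrite -polyC_eq0 -pC.
  exists ((p`_0)^-1%:P *: k); rewrite -scalerAr -e {2}pC scalerA -polyCM.
  by rewrite mulVf // scale1r.
have [c [q pq]] := closed_rootP s1.
have /eqP : slice c (f * k) = 0.
  by rewrite -e -mul_polyC sliceM sliceC pq !hornerE subrr mul0r mul0r.
rewrite sliceM mulf_eq0 (negPf (fc c)) => /eqP/slice_eq0[k1 ek].
have q0 : q != 0 by apply: contraNneq p0 => q0; rewrite pq q0 mulr0.
apply: (IH q k1) => //.
  by move: sp; rewrite pq size_monicM ?monicXsubC // size_XsubC.
have X0 : ('X - c%:P)%:P != 0 :> {poly {poly C}} by rewrite polyC_eq0 polyXsubC_eq0.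
by apply: (mulfI X0); rewrite mulrCA -ek -e pq mul_polyC scalerA.
Qed.

(** Linear factors of the denominator [p] are cancelled one at a time, each of them dividing [h] or
    [q]; [b] and [c] record that [h'] differs from [h] by factors free of [y]. *)
Lemma gauss_split f h (q : {poly {poly C}}) p : p != 0 -> p *: f = h * q ->
  exists h' q' : {poly {poly C}}, exists b c : {poly C},
    [/\ b != 0, c != 0, f = h' * q' & b *: h' = c *: h].
Proof.
have [n] := ubnP (size p); elim: n p h q => // n IH p h q sp p0 e.
have [s1|s1] := leqP (size p) 1.
  have pC := size1_polyC s1; have c0 : p`_0 != 0 by rewrite -polyC_eq0 -pC.
  exists h, ((p`_0)^-1%:P *: q), 1, 1; rewrite oner_eq0; split => //.
  by rewrite -scalerAr -e {2}pC scalerA -polyCM mulVf // scale1r.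
have [c [r pr]] := closed_rootP s1.
have r0 : r != 0 by apply: contraNneq p0 => r0; rewrite pr r0 mulr0.
have sr : (size r < n)%N.
  by move: sp; rewrite pr size_monicM ?monicXsubC // size_XsubC.
have X0 : ('X - c%:P)%:P != 0 :> {poly {poly C}} by rewrite polyC_eq0 polyXsubC_eq0.
have /eqP : slice c (h * q) = 0.
  by rewrite -e -mul_polyC sliceM sliceC pr !hornerE subrr mul0r mul0r.
rewrite sliceM mulf_eq0 => /orP[/eqP/slice_eq0[h1 eh]|/eqP/slice_eq0[q1 eq]].
- have e1 : r *: f = h1 * q.
    by apply: (mulfI X0); rewrite mulrA -eh -e pr mul_polyC scalerA.
  have [h' [q' [b [d [b0 d0 ff hh]]]]] := IH _ _ _ sr r0 e1.
  exists h', q', (('X - c%:P) * b), d; split=> //.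
    by rewrite mulf_neq0 // polyXsubC_eq0.
  by rewrite -scalerA hh eh mul_polyC scalerA mulrC -scalerA.
- apply: (IH _ _ q1 sr r0); apply: (mulfI X0).
  by rewrite mulrCA -eq -e pr mul_polyC scalerA.
Qed.

(** The gcd over C(x) decides: if it involves [y], irreducibility makes it equal to [f] up to
    factors in [x]; otherwise its Bezout relation with denominators cleared is the second
    alternative. *)
Lemma irr2_dvd_or_bezout f g : irreducible2 f -> (1 < size f)%N ->
  (exists k, g = f * k) \/
  (exists u w r, r != 0 /\ u * f + w * g = r%:P).
Proof.
move=> irr s1; have [f0 _ irrf] := irr.
set h := gcdp f g; have h0 : h != 0 by rewrite gcdp_eq0 negb_and f0.
have [sh|sh] := leqP (size h) 1; last first.
  left; have /Pdiv.Idomain.dvdpP[[a q]/= a0 ef] := dvdp_gcdl f g.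
  rewrite mulrC in ef.
  have [h' [q' [b [c [b0 c0 ff hh]]]]] := gauss_split a0 ef.
  have sh' : (1 < size h')%N by rewrite -(size_scale h' b0) hh size_scale.
  have [/const2_size|[e qe]] := irrf _ _ ff; first by rewrite leqNgt sh'.
  have /Pdiv.Idomain.dvdpP[[a' q'']/= a'0 eg] := dvdp_gcdr f g.
  have e0 : e != 0 by apply: contraNneq f0 => e0; rewrite ff qe e0 mulr0.
  apply: (@gauss_cancel f g (b%:P * q'') (e%:P * c * a')) => [||].
  - by rewrite !mulf_neq0 ?polyC_eq0.
  - by move=> ?; apply: slice_irr.
  have hh' : b%:P * h' = c%:P * h by rewrite !mul_polyC.
  rewrite -scalerA eg -/h -mul_polyC polyCM ff qe.
  transitivity (c%:P * h * q'' * e%:P%:P); first by ring.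
  by rewrite -hh'; ring.
right; have /size_poly1P[r r0 er] : size h == 1%N.
  by rewrite eqn_leq sh lt0n size_poly_eq0.
have [[u w]/= /eqpP[[a b] /andP[/= a0 b0] e]] := Bezoutp f g.
exists (a *: u), (a *: w), (b * r); split; first by rewrite mulf_neq0.
by rewrite -!scalerAl -scalerDr e -/h er -mul_polyC polyCM.
Qed.

Lemma irr2_size1 f : irreducible2 f -> (size f <= 1)%N ->
  exists b c, b != 0 /\ f = b%:P%:P * ('X - c%:P)%:P.
Proof.
move=> [f0 nc irr] s1; have [s2|s2] := leqP (size (f`_0)%R) 1.
  by case: nc; apply: const2P.
have [c [q pq]] := closed_rootP s2.
have ef : f = ('X - c%:P)%:P * q%:P by rewrite (size1_polyC s1) pq polyCM.
have [/XsubC_Nconst2 //|[b eb]] := irr _ _ ef.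
exists b, c; rewrite mulrC -eb; split=> //.
by apply: contraNneq f0 => b0; rewrite ef eb b0 mulr0.
Qed.

Lemma irr2_dvd_XsubC f g b c : b != 0 -> f = b%:P%:P * ('X - c%:P)%:P ->
  slice c g = 0 -> exists k, g = f * k.
Proof.
move=> b0 -> /slice_eq0[k ->]; exists (b^-1%:P%:P * k).
by rewrite mulrACA -!polyCM mulfV // mul1r.
Qed.

(** A Bezout relation would give a nonzero [r] in [x] alone vanishing below every zero of [f]; but
    any abscissa off the zeros of [r] and of the leading coefficient of [f] still carries a zero of
    [f]. *)
Lemma irr2_nullstellensatz f g : irreducible2 f ->
  (forall x y, f.[y%:P].[x] = 0 -> g.[y%:P].[x] = 0) -> exists k, g = f * k.
Proof.
move=> irr h; have [s1|s1] := leqP (size f) 1.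
  have [b [c [b0 ef]]] := irr2_size1 irr s1.
  apply: (irr2_dvd_XsubC b0 ef); apply: horner_eq0 => y; rewrite horner_slice h //.
  by rewrite ef !hornerE subrr mulr0.
have [//|[u [w [r [r0 e]]]]] := irr2_dvd_or_bezout g irr s1.
have [f0 _ _] := irr.
have [x] : exists x, (r * lead_coef f).[x] != 0.
  by apply: poly_nonroot; rewrite mulf_neq0 ?lead_coef_eq0.
rewrite hornerM mulf_eq0 negb_or => /andP[rx lx].
have : (1 < size (slice x f))%N by rewrite /slice size_map_poly_id0.
move=> /closed_rootP[y [q eq]].
have fy : f.[y%:P].[x] = 0 by rewrite -horner_slice eq !hornerE subrr mul0r.
have := congr1 (fun k => k.[y%:P].[x]) e.
by rewrite !hornerE fy (h _ _ fy) !mulr0 addr0 => /esym/eqP; rewrite (negPf rx).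
Qed.

(** Two Bezout relations multiply to one for [f] and [g * h], so [f] would divide a nonzero
    polynomial in [x] alone, against its degree in [y]. *)
Lemma irr2_prime f g h k : irreducible2 f -> g * h = f * k ->
  (exists k', g = f * k') \/ (exists k', h = f * k').
Proof.
move=> irr e; have [s1|s1] := leqP (size f) 1.
  have [b [c [b0 ef]]] := irr2_size1 irr s1.
  have /eqP : slice c (g * h) = 0.
    by rewrite e ef !sliceM !sliceC !hornerE subrr mulr0 mul0r.
  rewrite sliceM mulf_eq0 => /orP[]/eqP s0; [left|right];
    exact: irr2_dvd_XsubC b0 ef s0.
have [|[u [w [r [r0 e1]]]]] := irr2_dvd_or_bezout g irr s1; first by left.
have [|[u' [w' [r' [r'0 e2]]]]] := irr2_dvd_or_bezout h irr s1; first by right.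
have : (r * r')%:P = f * (u * u' * f + u * w' * h + w * g * u' + w * w' * k).
  by rewrite polyCM -e1 -e2; ring: e.
move=> /(congr1 (fun q : {poly {poly C}} => size q)); rewrite size_polyC mulf_neq0 //=.
set K := (X in f * X); have [-> |K0] := eqVneq K 0; first by rewrite mulr0 size_poly0.
have [f0 _ _] := irr; rewrite size_mul // => s2.
have K1 : (0 < size K)%N by rewrite lt0n size_poly_eq0.
by move: s1 s2 K1; case: (size f) => [|[|a]] //; case: (size K) => // b; rewrite addnS /= addSn.
Qed.

End Bivariate.

(** * Polynomials as functions, restriction to lines, divisibility by a linear form *)

Section Mpoly.
Variables (n : nat) (C : numClosedFieldType).
Implicit Types (p q : mpoly n C).

Lemma mpoly_alg_ind (P : mpoly n C -> Prop) :
  (forall c, P (mpolyC n c)) -> (forall i, P (mpolyX C (mnm1 i))) ->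
  (forall p q, P p -> P q -> P (p + q)) ->
  (forall p q, P p -> P q -> P (p * q)) -> forall p, P p.
Proof.
move=> PC PX PD PM.
have PX' (m : multinom n) : P (mpolyX C m).
  rewrite mpolyXE_id; elim/big_rec: _ => [|i q _ Pq]; first by rewrite -mpolyC1; exact: PC.
  apply: (PM) => //; elim: (m i) => [|k IH]; first by rewrite expr0 -mpolyC1; exact: PC.
  by rewrite exprS; exact: PM.
apply: mpolyrect => [|c m p _ _ Pp]; first by rewrite -(mpolyC0 n C); exact: PC.
by apply: PD => //; rewrite -mul_mpolyC; exact: PM.
Qed.

Lemma rmorph_mmap (S T : comNzRingType) (g : {rmorphism S -> T})
    (f : {rmorphism C -> S}) h p : g (mmap f h p) = mmap (g \o f) (g \o h) p.
Proof.
rewrite /mmap raddf_sum; apply: eq_bigr => m _; rewrite /= rmorphM /=; congr (_ * _).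
by rewrite /mmap1 rmorph_prod; apply: eq_bigr => i _; rewrite rmorphXn.
Qed.

Lemma eq_mmap (S : comNzRingType) (f f' : C -> S) h h' p :
  f =1 f' -> h =1 h' -> mmap f h p = mmap f' h' p.
Proof.
move=> ff hh; rewrite /mmap; apply: eq_bigr => m _; rewrite ff; congr (_ * _).
by apply: eq_bigr => i _; rewrite hh.
Qed.

(** The chain rule for a derivation trivial on constants; it serves for derivatives along a line and
    for both partial derivatives in an affine frame. *)
Lemma derivation_mmap (S : comNzRingType) (f : {rmorphism C -> S}) (h : 'I_n -> S)
    (D : {additive S -> S}) p :
  (forall a b, D (a * b) = D a * b + a * D b) -> (forall c, D (f c) = 0) ->
  D (mmap f h p) = \sum_k mmap f h (mderiv k p) * D (h k).
Proof.
move=> DM Df; elim/mpoly_alg_ind: p => [c|i|p q Hp Hq|p q Hp Hq].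
- rewrite mmapC Df big1 // => k _; by rewrite mderivC raddf0 mul0r.
- rewrite mmapX mmap1U (bigD1 i) //= big1 ?addr0 => [|k ki].
    have -> : mderiv i (mpolyX C (mnm1 i)) = 1 :> mpoly n C.
      rewrite mderivX mnm1E eqxx scale1r -mpolyX0; congr mpolyX.
      by apply/mnmP => j; rewrite mnmBE mnm0E subnn.
    by rewrite rmorph1 mul1r.
  by rewrite mderivX mnm1E eq_sym (negPf ki) scale0r raddf0 mul0r.
- rewrite raddfD /= raddfD /= Hp Hq -big_split; apply: eq_bigr => k _.
  by rewrite /= mderivD raddfD mulrDl.
- rewrite rmorphM DM Hp Hq mulr_suml mulr_sumr -big_split; apply: eq_bigr => k _.
  by rewrite /= mderivM raddfD /= !rmorphM /=; ring.
Qed.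

Definition lpoly (z u : 'I_n -> C) p : {poly C} :=
  mmap polyC (fun j => (z j)%:P + (u j)%:P * 'X) p.

Lemma lpolyE z u p s : (lpoly z u p).[s] = meval (fun j => z j + s * u j) p.
Proof.
rewrite -[LHS]/(horner_eval s _) rmorph_mmap; apply: eq_mmap => x /=.
  by rewrite /horner_eval hornerC.
by rewrite /horner_eval !hornerE mulrC.
Qed.

Lemma lpoly_deriv z u p s :
  ((lpoly z u p)^`()).[s] = \sum_k meval (fun j => z j + s * u j) (mderiv k p) * u k.
Proof.
rewrite /lpoly derivation_mmap; last by move=> c; exact: derivC.
  rewrite horner_sum; apply: eq_bigr => k _; rewrite -lpolyE.
  rewrite hornerM; congr (_ * _).
  by rewrite /= derivD derivC derivM derivC derivX mul0r mulr1 !add0r hornerC.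
by move=> a b; exact: derivM.
Qed.

(** Induction on the degree: the partial derivatives also vanish as functions, being derivatives
    along coordinate lines, so in characteristic zero only the constant term is left. *)
Lemma meval_inf p : (forall z, meval z p = 0) -> p = 0.
Proof.
have [k] := ubnP (msize p); elim: k p => // k IH p sp p0.
have d0 i : mderiv i p = 0.
  have [-> |pn0] := eqVneq p 0; first by rewrite mderiv0.
  apply: IH => [|z].
    rewrite (leq_trans _ (sp : (_ <= k)%N)) // (mpolySpred _ pn0) ltnS msizeE.
    apply/bigmax_leqP_seq => m; rewrite mcoeff_msupp mcoeff_mderiv => h _.
    have : mnm_add m (mnm1 i) \in msupp p.
      by rewrite mcoeff_msupp; apply: contraNneq h => ->; rewrite mul0rn.
    by move=> /msize_mdeg_lt; rewrite mdegD mdeg1 addn1 (mpolySpred _ pn0) ltnS.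
  have : lpoly z (fun j => (j == i)%:R) p = 0.
    by apply: horner_eq0 => s; rewrite lpolyE p0.
  move/(congr1 (fun q : {poly C} => q^`().[0])).
  rewrite lpoly_deriv derivC horner0 (bigD1 i) //= big1 ?addr0 => [|j /negPf ->].
    by rewrite eqxx mulr1 => <-; apply: meval_eq => j; rewrite mul0r addr0.
  by rewrite mulr0.
suff pC : p = mpolyC n (mcoeff mnm0 p).
  by have := p0 (fun=> 0); rewrite pC mevalC => ->; rewrite mpolyC0.
apply/mpolyP => m.
have [->|m0] := eqVneq m mnm0; first by rewrite mcoeffC eqxx mulr1.
rewrite mcoeffC (negPf m0) mulr0.
have [i mi] : exists i, m i != 0%N.
  apply: contrapT => /forallNP h; move/eqP: m0; apply; apply/mnmP => i.
  by rewrite mnm0E; apply/eqP/negPn/negP => /h.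
have := mcoeff_mderiv i p (mnm_sub m (mnm1 i)); rewrite d0 mcoeff0 submK ?lep1mP //.
by move=> /esym/eqP; rewrite mulrn_eq0 /= => /eqP.
Qed.

Lemma meval_inj p q : (forall z, meval z p = meval z q) -> p = q.
Proof.
move=> h; apply/eqP; rewrite -subr_eq0; apply/eqP; apply: meval_inf => z.
by rewrite mevalB h subrr.
Qed.

Lemma meval_homog m p (c : C) z : p \is @ishomog1 n C m mdeg ->
  meval (fun j => c * z j) p = c ^+ m * meval z p.
Proof.
move=> /dhomogP h; rewrite !mevalE mulr_sumr big_seq [RHS]big_seq.
apply: eq_bigr => k /h kd; rewrite mulrCA; congr (_ * _).
rewrite -kd /= mdegE -prodrXr -big_split; apply: eq_bigr => i _.
by rewrite /= exprMn.
Qed.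

Definition lform (l : 'I_n -> C) : mpoly n C := \sum_j l j *: mpolyX C (mnm1 j).

Lemma meval_lform l z : meval z (lform l) = \sum_j l j * z j.
Proof. by rewrite raddf_sum; apply: eq_bigr => j _; rewrite /= mevalZ mevalXU. Qed.

(** [S] substitutes the projection onto the hyperplane along [v]. It is the identity modulo the
    linear form, and [S p] is zero because [p] vanishes on the hyperplane. *)
Lemma lform_dvd l v p : \sum_j l j * v j = 1 ->
  (forall z, \sum_j l j * z j = 0 -> meval z p = 0) -> exists q, p = lform l * q.
Proof.
move=> lv pz; set L := lform l.
pose S := mmap (@mpolyC n C) (fun j => mpolyX C (mnm1 j) - v j *: L).
have [q eq] : exists q, p - S p = L * q.
  rewrite /S; elim/mpoly_alg_ind: p {pz} => [c|i|p1 p2 [q1 e1] [q2 e2]|p1 p2 [q1 e1] [q2 e2]].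
  - by exists 0; rewrite mmapC subrr mulr0.
  - exists (mpolyC n (v i)); rewrite mmapX mmap1U opprB addrC subrK.
    by rewrite -mul_mpolyC mulrC.
  - by exists (q1 + q2); rewrite raddfD /= mulrDr -e1 -e2; ring.
  - exists (q1 * p2 + S p1 * q2); rewrite rmorphM /=.
    transitivity ((L * q1) * p2 + S p1 * (L * q2)); last by ring.
    by rewrite -e1 -e2 /S; ring.
exists q; rewrite -eq (_ : S p = 0) ?subr0 //; apply: meval_inf => z.
rewrite (rmorph_mmap (meval z)) -[RHS](pz (fun j => z j - v j * meval z L)); last first.
  under eq_bigr do rewrite mulrBr mulrA.
  by rewrite sumrB -mulr_suml lv mul1r /L meval_lform subrr.
rewrite [RHS]/meval; apply: eq_mmap => x; first exact: mevalC.
by rewrite /= mevalB mevalXU mevalZ.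
Qed.

Lemma mpoly_unitP p : reflect (exists2 c, c != 0 & p = mpolyC n c) (p \is a GRing.unit).
Proof.
apply: (iffP andP) => [[/eqP e]|[c c0 ->]].
  by rewrite unitfE => c0; exists (mcoeff mnm0 p).
by rewrite mcoeffC eqxx mulr1 unitfE.
Qed.

End Mpoly.

(** * Curves in affine frames *)

Section Frames.
Variable C : numClosedFieldType.
Local Notation vec := ('I_3 -> C).
Implicit Types (z u v o U V : vec) (F : mpoly 3 C) (f g : {poly {poly C}}).

Definition dot u v : C := \sum_j u j * v j.

Lemma dotDr u v v' : dot u (fun j => v j + v' j) = dot u v + dot u v'.
Proof. by rewrite /dot -big_split; apply: eq_bigr => j _; rewrite /= mulrDr. Qed.

Lemma dotZr u v c : dot u (fun j => c * v j) = c * dot u v.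
Proof. by rewrite /dot mulr_sumr; apply: eq_bigr => j _; rewrite mulrCA. Qed.

Lemma dotC u v : dot u v = dot v u.
Proof. by apply: eq_bigr => j _; rewrite mulrC. Qed.

Lemma eq_dot u u' v v' : u =1 u' -> v =1 v' -> dot u v = dot u' v'.
Proof. by move=> h h'; apply: eq_bigr => j _; rewrite h h'. Qed.

Lemma sum3 (V : nmodType) (a : 'I_3 -> V) i : \sum_j a j = a i + a (i + 1) + a (i + 2).
Proof.
rewrite (reindex_inj (addrI i)) /= !big_ord_recr big_ord0 /= add0r.
congr (a _ + a _ + a _).
- by rewrite -[RHS]addr0; congr (_ + _); exact: val_inj.
- by congr (_ + _); exact: val_inj.
- by congr (_ + _); exact: val_inj.
Qed.

Lemma ord3_neq (i : 'I_3) :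
  ((i + 1 == i) = false) * ((i == i + 1) = false) * ((i + 2 == i) = false) *
  ((i == i + 2) = false) * ((i + 2 == i + 1) = false) * ((i + 1 == i + 2) = false).
Proof. by case: i => [[|[|[]]] ?]; do !split. Qed.

Lemma ord3_add (i : 'I_3) :
  (i + 1 + 1 = i + 2) * (i + 1 + 2 = i) * (i + 2 + 1 = i) * (i + 2 + 2 = i + 1).
Proof. by do !split; apply: val_inj; case: i => [[|[|[]]] ?]. Qed.

(** Vertices [p] and side equations [l] of a triangle, as dual bases of C^3. With cyclic indices,
    the side [l i] joins [p (i + 1)] and [p (i + 2)]. *)
Definition frame (p l : 'I_3 -> vec) :=
  (forall i k, dot (l i) (p k) = (i == k)%:R) /\
  (forall z j, z j = \sum_i dot (l i) z * p i j).

(* In {poly {poly C}} the outer variable is y and the inner one is x. *)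
Definition dX f : {poly {poly C}} := swapXY (deriv (swapXY f)).

Let dXadd : {additive {poly {poly C}} -> {poly {poly C}}} :=
  (@swapXY C \o (@deriv {poly C} \o @swapXY C)).

Lemma dXD f g : dX (f + g) = dX f + dX g.
Proof. exact: (raddfD dXadd). Qed.

Lemma dX0 : dX 0 = 0.
Proof. exact: (raddf0 dXadd). Qed.

Lemma dXM f g : dX (f * g) = dX f * g + f * dX g.
Proof. by rewrite /dX rmorphM derivM rmorphD !rmorphM /= !swapXYK. Qed.

Lemma dXC (q : {poly C}) : dX q%:P = (q^`())%:P.
Proof. by rewrite /dX swapXY_polyC deriv_map swapXY_map_polyC. Qed.

Lemma dX_X : dX 'X = 0.
Proof. by rewrite /dX swapXY_X derivC raddf0. Qed.

Lemma deriv_horner f (S : {poly C}) :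
  (f.[S])^`() = (dX f).[S] + (f^`()).[S] * S^`().
Proof.
elim/poly_ind: f => [|f c IH]; first by rewrite dX0 !horner0 deriv0 deriv0 horner0 mul0r addr0.
rewrite hornerMXaddC derivD derivM IH dXD dXM dX_X mulr0 addr0 dXC.
rewrite derivD derivM derivC derivX mulr1 addr0 !hornerE; ring.
Qed.

Lemma deriv_dX f : (dX f)^`() = dX f^`().
Proof.
elim/poly_ind: f => [|f c IH]; first by rewrite dX0 deriv0 dX0.
rewrite derivD derivM derivC derivX mulr1 addr0 !dXD !dXM dX_X mulr0 addr0 dXC.
by rewrite !derivD !derivM !derivC !derivX IH !mulr1 ?mulr0 !addr0.
Qed.

Definition pt o U V x y : vec := fun j => o j + x * U j + y * V j.

Definition fpoly o U V F : {poly {poly C}} :=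
  mmap (polyC \o polyC)
    (fun j => (o j)%:P%:P + (U j)%:P%:P * 'X%:P + (V j)%:P%:P * 'X) F.

Lemma fpolyE o U V F x y : (fpoly o U V F).[y%:P].[x] = meval (pt o U V x y) F.
Proof.
rewrite -[LHS]/((horner_eval x \o horner_eval y%:P) _) rmorph_mmap.
apply: eq_mmap => c /=; rewrite /horner_eval; first by rewrite !hornerE.
by rewrite !hornerE /pt /= [x * _]mulrC [y * _]mulrC.
Qed.

Lemma fpolyM o U V F G : fpoly o U V (F * G) = fpoly o U V F * fpoly o U V G.
Proof. exact: rmorphM. Qed.

Lemma fpoly_dy o U V F :
  (fpoly o U V F)^`() = \sum_k fpoly o U V (mderiv k F) * (V k)%:P%:P.
Proof.
rewrite /fpoly derivation_mmap; last by move=> c; exact: derivC.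
  apply: eq_bigr => k _; congr (_ * _); rewrite /= !derivD -!polyCM !derivC derivM.
  by rewrite derivC derivX mul0r mulr1 !add0r.
by move=> a b; exact: derivM.
Qed.

Lemma fpoly_dx o U V F :
  dX (fpoly o U V F) = \sum_k fpoly o U V (mderiv k F) * (U k)%:P%:P.
Proof.
rewrite -[LHS]/(dXadd _) /fpoly derivation_mmap; first last.
- by move=> c; have := dXC c%:P; rewrite derivC polyC0.
- exact: dXM.
apply: eq_bigr => k _; congr (_ * _); rewrite -[LHS]/(dX _) /= !dXD !dXM !dX_X !dXC !derivC.
by rewrite derivX !mul0r !mulr0 !add0r !addr0 mulr1.
Qed.

Section Homogenize.
Variables (p l : 'I_3 -> vec).
Hypothesis pl : frame p l.
Variable i : 'I_3.
Local Notation X := (dot (l i)).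
Local Notation Y := (dot (l (i + 1))).
Local Notation Z := (dot (l (i + 2))).
Local Notation LX := (lform (l i)).
Local Notation LY := (lform (l (i + 1))).
Local Notation LZ := (lform (l (i + 2))).

Let ev z k : meval z (lform (l k)) = dot (l k) z. Proof. exact: meval_lform. Qed.

Let homog g N (G : mpoly 3 C) := forall z, Z z != 0 ->
  meval z G = Z z ^+ N * g.[(Y z / Z z)%:P].[X z / Z z].

Let homog_ex g : exists N G, homog g N G.
Proof.
have hD g1 g2 N1 G1 N2 G2 : homog g1 N1 G1 -> homog g2 N2 G2 ->
    homog (g1 + g2) (N1 + N2) (LZ ^+ N2 * G1 + LZ ^+ N1 * G2).
  move=> h1 h2 z z0; rewrite mevalD !mevalM !rmorphXn /= ev h1 // h2 // hornerD hornerD exprD.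
  by rewrite mulrDr !mulrA [Z z ^+ N2 * _]mulrC.
have hM g1 g2 N1 G1 N2 G2 : homog g1 N1 G1 -> homog g2 N2 G2 ->
    homog (g1 * g2) (N1 + N2) (G1 * G2).
  move=> h1 h2 z z0; by rewrite mevalM h1 // h2 // hornerM hornerM exprD mulrACA.
elim/poly_ind: g => [|g c [N [G h]]].
  by exists 0%N, 0 => z z0; rewrite raddf0 !horner0 mulr0.
have [M [H hc]] : exists M H, homog c%:P M H.
  elim/poly_ind: c => [|q c [M [H hq]]].
    by exists 0%N, 0 => z z0; rewrite raddf0 hornerC horner0 mulr0.
  exists (M + 1 + 0)%N; eexists; rewrite polyCD polyCM.
  apply: (hD); first apply: (hM _ _ _ _ _ LX hq).
    by move=> z z0; rewrite ev hornerC hornerX expr1 mulrCA mulfV ?mulr1.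
  instantiate (1 := mpolyC 3 c).
  by move=> z z0; rewrite mevalC !hornerC expr0 mul1r.
exists (N + 1 + M)%N; eexists.
apply: hD hc; apply: (hM _ _ _ _ _ LY h).
by move=> z z0; rewrite ev hornerX hornerC expr1 mulrCA mulfV ?mulr1.
Qed.

Let LZ_dvd F : (forall z, Z z = 0 -> meval z F = 0) -> exists G, F = LZ * G.
Proof. by apply: (lform_dvd (v := p (i + 2))); have := pl.1 (i + 2) (i + 2); rewrite eqxx. Qed.

Let LZ0 : LZ != 0.
Proof.
apply/eqP => /(congr1 (meval (p (i + 2)))); rewrite ev pl.1 eqxx meval0.
by move/eqP; rewrite oner_eq0.
Qed.

(** On the plane Z = 0 polynomials become bivariate, and these form an integral domain. *)
Let LZ_prime F G H : F * G = LZ * H ->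
  (exists F', F = LZ * F') \/ (exists G', G = LZ * G').
Proof.
move=> e; pose q z := pt (fun=> 0) (p i) (p (i + 1)) (X z) (Y z).
have qE z : Z z = 0 -> q z =1 z.
  by move=> z0 j; rewrite /q /pt [RHS](pl.2 z j) (sum3 _ i) z0 mul0r addr0 add0r.
have qZ x y : Z (pt (fun=> 0) (p i) (p (i + 1)) x y) = 0.
  have -> : Z (pt (fun=> 0) (p i) (p (i + 1)) x y) = x * Z (p i) + y * Z (p (i + 1)).
    rewrite -!dotZr -dotDr; apply: eq_dot => // j; by rewrite /pt add0r.
  by rewrite !pl.1 !ord3_neq !mulr0 addr0.
have : fpoly (fun=> 0) (p i) (p (i + 1)) F * fpoly (fun=> 0) (p i) (p (i + 1)) G = 0.
  apply: horner2_eq0 => x y; rewrite -fpolyM e fpolyE mevalM ev qZ mul0r //.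
move=> /eqP; rewrite mulf_eq0 => /orP[]/eqP h0; [left|right]; apply: LZ_dvd => z z0;
  rewrite -(meval_eq _ (qE _ z0)) -fpolyE h0 !horner0 //.
Qed.

Let peel a F G H : LZ ^+ a * F = G * H -> exists e1 e2 G' H',
  [/\ G = LZ ^+ e1 * G', H = LZ ^+ e2 * H' & F = G' * H'].
Proof.
elim: a G H => [|a IH] G H e.
  by exists 0%N, 0%N, G, H; rewrite !expr0 !mul1r; split=> //; rewrite -e mul1r.
rewrite exprS -mulrA in e; have [[G1 e1]|[H1 e1]] := LZ_prime (esym e).
- have [|b1 [b2 [G' [H' [g1 h1 ->]]]]] := IH G1 H.
    by apply: (mulfI LZ0); rewrite e e1 mulrA.
  by exists b1.+1, b2, G', H'; rewrite e1 {1}g1 exprS mulrA.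
- have [|b1 [b2 [G' [H' [g1 h1 ->]]]]] := IH G H1.
    by apply: (mulfI LZ0); rewrite e e1 mulrCA.
  by exists b1, b2.+1, G', H'; rewrite e1 {1}h1 exprS mulrA.
Qed.

(** A factorization of the affine equation is homogenized; the surplus powers of Z can be stripped
    from the two factors because Z is prime, and the rest factors [F]. Nonvanishing of [F] somewhere
    on Z = 0 keeps the affine equation from being constant. *)
Lemma dehomog_irreducible F m : F \is @ishomog1 3 C m mdeg -> F != 0 ->
  (forall P Q, F = P * Q -> P \is a GRing.unit \/ Q \is a GRing.unit) ->
  (exists z, Z z = 0 /\ meval z F != 0) -> (0 < m)%N ->
  irreducible2 (fpoly (p (i + 2)) (p i) (p (i + 1)) F).
Proof.
move=> Fm F0 Firr [z0 [Zz0 Fz0]] m0; set f := fpoly _ _ _ F.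
have Zpt x y : Z (pt (p (i + 2)) (p i) (p (i + 1)) x y) = 1.
  have -> : Z (pt (p (i + 2)) (p i) (p (i + 1)) x y) =
      Z (p (i + 2)) + x * Z (p i) + y * Z (p (i + 1)).
    by rewrite -!dotZr -!dotDr.
  by rewrite !pl.1 !ord3_neq eqxx !mulr0 !addr0.
have ptE z : Z z != 0 -> z =1 fun j => Z z * pt (p (i + 2)) (p i) (p (i + 1)) (X z / Z z) (Y z / Z z) j.
  move=> zz j; rewrite [LHS](pl.2 z j) (sum3 _ i) /pt.
  by field.
have fE z : Z z != 0 -> meval z F = Z z ^+ m * f.[(Y z / Z z)%:P].[X z / Z z].
  by move=> zz; rewrite fpolyE -(meval_homog _ _ Fm); apply: meval_eq; exact: ptE.
have nc : ~ const2 f.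
  move=> [c fc]; have e : F * LZ = mpolyC 3 c * LZ ^+ m * LZ.
    apply: meval_inj => z; rewrite !mevalM rmorphXn /= ev mevalC.
    have [->|zz] := eqVneq (Z z) 0; first by rewrite !mulr0.
    by rewrite fE // fc !hornerC [c * _]mulrC.
  move: Fz0; rewrite (mulIf LZ0 e) mevalM rmorphXn /= ev Zz0.
  by rewrite expr0n -(prednK m0) /= mulr0 eqxx.
split=> [|//|g h fgh].
  by apply/eqP => f0; apply: nc; exists 0; rewrite f0 !polyC0.
have [N [G hG]] := homog_ex g; have [M [H hH]] := homog_ex h.
have : LZ ^+ (N + M).+1 * F = (LZ ^+ m.+1 * G) * H.
  apply: meval_inj => z; rewrite !mevalM !rmorphXn /= ev.
  have [->|zz] := eqVneq (Z z) 0; first by rewrite !expr0n !mul0r.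
  rewrite fE // hG // hH // fgh hornerM hornerM !exprS exprD.
  move: (Z z) (Z z ^+ N) (Z z ^+ M) (Z z ^+ m) (g.[_].[_]) (h.[_].[_]) => *; ring.
move=> /peel[e1 [e2 [G' [H' [eG eH eF]]]]].
have ptX x y : X (pt (p (i + 2)) (p i) (p (i + 1)) x y) = x.
  by rewrite !dotDr !dotZr !pl.1 !ord3_neq eqxx mulr0 mulr1 add0r addr0.
have ptY x y : Y (pt (p (i + 2)) (p i) (p (i + 1)) x y) = y.
  by rewrite !dotDr !dotZr !pl.1 !ord3_neq eqxx mulr0 mulr1 !add0r.
have cst k e K K' : homog k e K -> (exists a b, LZ ^+ a * K = LZ ^+ b * K') ->
    K' \is a GRing.unit -> const2 k.
  move=> hk [a [b ab]] /mpoly_unitP[c c0 K'c]; exists c.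
  apply/eqP; rewrite -subr_eq0; apply/eqP; apply: horner2_eq0 => x y.
  have := congr1 (meval (pt (p (i + 2)) (p i) (p (i + 1)) x y)) ab.
  rewrite !mevalM !rmorphXn /= ev Zpt !expr1n !mul1r hk ?Zpt ?oner_neq0 //.
  rewrite expr1n mul1r ptX ptY !divr1 K'c mevalC => kc.
  by rewrite hornerD hornerD kc hornerN hornerN !hornerC subrr.
have [u|u] := Firr _ _ eF; [left|right].
  by apply: cst hG _ u; exists m.+1, e1.
by apply: cst hH _ u; exists 0%N, e2; rewrite expr0 mul1r.
Qed.

End Homogenize.
End Frames.

(** * Formal separatrices and orders of vanishing along them *)

Section Separatrix.
Variable C : numClosedFieldType.
Implicit Types (f g h k : {poly {poly C}}) (p q A K E S phi psi : {poly C}) (x y r c : C).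

Lemma order_factor r p : p != 0 ->
  exists m psi, psi.[r] != 0 /\ p = ('X - r%:P) ^+ m * psi.
Proof.
move=> p0; have [m [q qr e]] := multiplicity_XsubC p r.
by exists m, q; rewrite mulrC; split=> //; rewrite p0 in qr.
Qed.

Lemma vanish_factor r p : p.[r] = 0 -> exists q, p = ('X - r%:P) * q.
Proof.
by move=> /eqP; rewrite -rootE => /factor_theorem[q ->]; exists q; rewrite mulrC.
Qed.

Lemma order_residue r A K phi psi E m :
  A.[r] = 0 -> psi.[r] != 0 -> phi = ('X - r%:P) ^+ m * psi ->
  A * phi^`() = K * phi + ('X - r%:P) ^+ m.+1 * E ->
  K.[r] = m%:R * (A^`()).[r].
Proof.
move=> /vanish_factor[B ->] psir -> e; set X := 'X - r%:P in e *.
have X0 : X != 0 by rewrite polyXsubC_eq0.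
have dXm : X * (X ^+ m)^`() = m%:R * X ^+ m.
  rewrite deriv_exp derivXsubC mul1r; case: m {e} => [|m] /=; first by rewrite mulr0n mulr0 mul0r.
  by rewrite mulrnAr -exprS mulr_natl.
have e2 : X ^+ m * (m%:R * (B * psi) + X * (B * psi^`())) =
          X ^+ m * (K * psi + X * E).
  transitivity (X * B * (X ^+ m * psi)^`()); last by rewrite e exprS; ring.
  rewrite derivM.
  transitivity ((X * (X ^+ m)^`()) * (B * psi) + X ^+ m * (X * (B * psi^`()))); last by ring.
  by rewrite dXm; ring.
have X_r : X.[r] = 0 by rewrite /X !hornerE subrr.
have := congr1 (fun p => p.[r]) (mulfI (expf_neq0 m X0) e2).
rewrite !hornerD !hornerM X_r !mul0r !addr0 => e3.
apply: (mulIf psir); rewrite -e3 derivM derivXsubC mul1r hornerD hornerM X_r mul0r addr0.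
by rewrite -polyC_natr hornerC; ring.
Qed.

(** If [phi] vanished at [r], the left side would have strictly smaller order there than the right
    side. *)
Lemma regular_order r A K phi : A.[r] != 0 -> phi != 0 ->
  A * phi^`() = K * phi -> phi.[r] != 0.
Proof.
move=> Ar p0 e; have [[|m] [psi [psir ep]]] := order_factor r p0.
  by rewrite ep expr0 mul1r.
set X := 'X - r%:P in ep; have X0 : X != 0 by rewrite polyXsubC_eq0.
have X_r : X.[r] = 0 by rewrite /X !hornerE subrr.
have e2 : X ^+ m * (A * (m.+1%:R * psi + X * psi^`())) = X ^+ m * (X * (K * psi)).
  transitivity (A * phi^`()); last by rewrite e ep exprS; ring.
  rewrite ep derivM deriv_exp derivXsubC mul1r /= -mulr_natl exprS; ring.
move: X X0 X_r e2 {ep} => Y Y0 X_r e2.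
have := congr1 (fun p => p.[r]) (mulfI (expf_neq0 m Y0) e2).
rewrite !(hornerM, hornerD) X_r !mul0r addr0 -polyC_natr hornerC => /eqP.
by rewrite !mulf_eq0 (negPf Ar) (negPf psir) pnatr_eq0.
Qed.

(** An approximate solution of order less than [N] would have its order as a resonance, by
    [order_residue]. *)
Lemma nonresonant_dvd A K phi N : A.[0] = 0 ->
  (forall i : nat, i%:R * (A^`()).[0] != K.[0]) ->
  'X ^+ N %| A * phi^`() - K * phi -> 'X ^+ N %| phi.
Proof.
move=> A0 nr /dvdpP[E e]; have [->|p0] := eqVneq phi 0; first exact: dvdp0.
have [m [psi [psi0 ep]]] := order_factor 0 p0.
have [Nm|mN] := leqP N m.
  by rewrite ep subr0 dvdp_mulr // dvdp_exp2l.
have eK : K.[0] = m%:R * (A^`()).[0].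
  apply: (@order_residue 0 A K phi psi ('X ^+ (N - m.+1) * E) m A0 psi0 ep).
  by rewrite subr0 mulrA -exprD subnKC // ['X^N * E]mulrC -e addrC subrK.
by have := nr m; rewrite eK eqxx.
Qed.

Lemma slice_horner f S x : f.[S].[x] = (slice x f).[S.[x]].
Proof. by rewrite -[LHS]/(horner_eval x _) -horner_map. Qed.

Lemma taylor1 (R : comNzRingType) (g : {poly R}) (a h : R) :
  exists k : R, g.[a + h] = g.[a] + h * k.
Proof.
elim/poly_ind: g => [|g c [k e]]; first by exists 0; rewrite !horner0 mulr0 addr0.
by exists (g.[a] + k * (a + h)); rewrite !hornerMXaddC e; ring.
Qed.

Lemma taylor2 (R : comNzRingType) (g : {poly R}) (a h : R) :
  exists k : R, g.[a + h] = g.[a] + h * (g^`()).[a] + h ^+ 2 * k.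
Proof.
elim/poly_ind: g => [|g c [k e]].
  by exists 0; rewrite deriv0 !horner0 !mulr0 !addr0.
exists ((g^`()).[a] + k * (a + h)); rewrite derivD derivM derivC derivX.
rewrite !hornerMXaddC e !hornerE; ring.
Qed.

(* A formal invariant branch y = S(x) of x b dy + alpha dx through (0, r),
   truncated at order N. *)
Lemma separatrix_jet alpha (b : {poly {poly C}}) r N :
  alpha.[r%:P].[0] = 0 ->
  (forall n : nat, (0 < n)%N ->
     n%:R * b.[r%:P].[0] + (alpha^`()).[r%:P].[0] != 0) ->
  exists S, S.[0] = r /\ 'X ^+ N.+1 %| 'X * b.[S] * S^`() + alpha.[S].
Proof.
move=> a0 nr; elim: N => [|N [S [S0 /dvdpP[E1 e]]]].
  exists r%:P; rewrite hornerC; split=> //.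
  by rewrite derivC mulr0 add0r expr1 -['X]subr0 dvdp_XsubCl rootE a0.
set M := N.+1 in e; pose lam := M%:R * b.[r%:P].[0] + (alpha^`()).[r%:P].[0].
(* [c] solves the linear equation for the coefficient of degree [M]; its multiplier [lam] is nonzero
   by nonresonance. *)
pose c := - E1.[0] / lam; have lam0 : lam != 0 by exact: nr.
exists (S + c%:P * 'X^M); split.
  by rewrite !hornerE S0 expr0n mulr0 addr0.
have [k1 ek1] := taylor1 b S (c%:P * 'X^M).
have [k2 ek2] := taylor2 alpha S (c%:P * 'X^M).
rewrite ek1 ek2; set bS := b.[S] in ek1 *; set aS := alpha^`().[S] in ek2 *.
set dS := S^`() in e *.
have -> : (S + c%:P * 'X^M)^`() = dS + c%:P * (M%:R * 'X^N).
  by rewrite derivD derivM derivC mul0r add0r derivXn mulr_natl.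
have XM : 'X^M = 'X * 'X^N :> {poly C} by rewrite -exprS.
have -> : 'X * (bS + c%:P * 'X^M * k1) * (dS + c%:P * (M%:R * 'X^N)) +
    (alpha.[S] + c%:P * 'X^M * aS + (c%:P * 'X^M) ^+ 2 * k2) =
  'X^M * ((E1 + c%:P * (M%:R * bS + aS)) +
    'X * (c%:P * k1 * dS + c%:P ^+ 2 * (k1 * M%:R * 'X^N + 'X^N * k2))).
  transitivity (('X * bS * dS + alpha.[S]) + 'X^M * (c%:P * (M%:R * bS + aS) +
    'X * (c%:P * k1 * dS + c%:P ^+ 2 * (k1 * M%:R * 'X^N + 'X^N * k2)))).
    by rewrite XM; ring.
  by rewrite e; ring.
rewrite [X in X %| _]exprS [X in X %| _]mulrC dvdp_mul2l ?expf_neq0 ?polyX_eq0 //.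
rewrite dvdp_add ?dvdp_mulIl // -['X]subr0 dvdp_XsubCl rootE.
rewrite hornerD hornerM hornerC hornerD hornerM -polyC_natr hornerC.
by rewrite /bS /aS !slice_horner S0 !horner_slice -/lam /c divfK // subrr.
Qed.

(* At a multiple root both f and its y-derivative vanish to every order along
   the formal invariant branch, unless there is a resonance. *)
Lemma edge_root_simple f alpha (b K u w : {poly {poly C}}) D r :
  ('X%:P * b) * dX f - alpha * f^`() = K * f ->
  u * f + w * f^`() = D%:P -> D != 0 ->
  slice 0 f != 0 -> f.[r%:P].[0] = 0 -> alpha.[r%:P].[0] = 0 ->
  (forall i j : nat, (i + j)%N != 0%N ->
     i%:R * b.[r%:P].[0] + j%:R * (alpha^`()).[r%:P].[0] != 0) ->
  ((slice 0 f)^`()).[r] != 0.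
Proof.
move=> ef eD D0 f00 fr ar nr; apply/negP => /eqP dfr.
set al1 := (alpha^`()).[r%:P].[0] in nr; set lam := b.[r%:P].[0] in nr.
have dsl g : (slice 0 g)^`() = slice 0 g^`() by rewrite /slice deriv_map.
have Kr : exists m, (1 < m)%N /\ K.[r%:P].[0] = m%:R * - al1.
  have [m [psi [psir e]]] := order_factor r f00.
  exists m; split.
    move: fr dfr; rewrite -horner_slice e; case: m e => [|[|//]] e.
      by rewrite expr0 mul1r => z; rewrite z eqxx in psir.
    rewrite expr1 derivM derivXsubC mul1r !hornerE subrr ?mul0r ?addr0 => _ z.
    by rewrite z eqxx in psir.
  have ha : (- slice 0 alpha).[r] = 0 by rewrite hornerN horner_slice ar oppr0.
  have := @order_residue r (- slice 0 alpha) (slice 0 K) _ psi 0 m ha psir e.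
  rewrite horner_slice derivN (dsl alpha) hornerN horner_slice -/al1 => -> //.
  rewrite mulr0 addr0 -sliceM -ef dsl.
  by rewrite /slice rmorphB !rmorphM /= map_polyC /= /horner_eval hornerX polyC0 !mul0r sub0r mulNr.
have [m [m1 eK]] := Kr.
(* [D] lies in the ideal of [f] and its [y]-derivative and involves only [x]; divisibility by all
   powers of [x] then contradicts [D != 0]. *)
have key N : ('X^(N.+1) %| D)%R.
  have [|n n0|S [S0 hE]] := @separatrix_jet alpha b r N => //.
    by have := nr n 1%N; rewrite mul1r addn1 => ->.
  set E := _ + _ in hE; set A := 'X * b.[S].
  have A0 : A.[0] = 0 by rewrite hornerM hornerX mul0r.
  have dA0 : A^`().[0] = lam.
    by rewrite /A derivM derivX mul1r hornerD hornerM hornerX mul0r addr0 slice_horner S0 horner_slice.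
  have at0 g : g.[S].[0] = g.[r%:P].[0] by rewrite slice_horner S0 horner_slice.
  have EA : A * S^`() = E - alpha.[S] by rewrite /E /A addrK.
  have efS : A * (dX f).[S] - alpha.[S] * f^`().[S] = K.[S] * f.[S].
    by have := congr1 (fun g => g.[S]) ef; rewrite !(hornerM, hornerD, hornerN) hornerC.
  (* Along [S] the cofactor relation becomes an approximate linear equation for [f], whose
     resonances would read [i * lam + m * al1 = 0]. *)
  have dv1 : ('X^(N.+1) %| f.[S])%R.
    apply: (@nonresonant_dvd A K.[S]) => // [i|].
      rewrite dA0 at0 eK mulrN -subr_eq0 opprK.
      by apply: nr; rewrite addn_eq0 -!leqn0 [(m <= 0)%N]leqNgt (ltn_trans _ m1) // andbF.
    rewrite deriv_horner mulrDr -efS [_ * S^`()]mulrC mulrA EA.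
    have -> : A * (dX f).[S] + (E - alpha.[S]) * f^`().[S] -
      (A * (dX f).[S] - alpha.[S] * f^`().[S]) = E * f^`().[S] by ring.
    exact: dvdp_mulr.
  have dfS : (f.[S])^`() = (dX f).[S] + f^`().[S] * S^`() by exact: deriv_horner.
  have dv1' : ('X^(N.+1) %| 'X * (f.[S])^`())%R.
    move/dvdpP: dv1 => [q ->]; rewrite derivM derivXn /= mulrDr dvdp_add //.
      by rewrite mulrA dvdp_mull.
    by rewrite mulrCA mulrnAr -exprS dvdp_mull // -mulr_natr dvdp_mulr.
  (* Differentiating the cofactor relation in [y] replaces [m] by [m - 1], which is still positive,
     so nonresonance applies again. *)
  have dv2 : ('X^(N.+1) %| f^`().[S])%R.
    apply: (@nonresonant_dvd A (K.[S] + alpha^`().[S] + 'X * b^`().[S] * S^`())) => // [i|].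
      rewrite dA0 !hornerD !hornerM hornerX !mul0r addr0 !at0 eK -/al1.
      have -> : m%:R * - al1 + al1 = - (m.-1%:R * al1).
        by rewrite -{1}(prednK (ltnW m1)) -natr1; ring.
      rewrite -subr_eq0 opprK; apply: nr.
      by case: m m1 {Kr eK} => [|[|m]] // _; rewrite addnS.
    have ef2 : A * (dX f^`()).[S] + 'X * b^`().[S] * (dX f).[S] - alpha^`().[S] * f^`().[S]
        - alpha.[S] * f^`()^`().[S] = K^`().[S] * f.[S] + K.[S] * f^`().[S].
      have := congr1 (fun g => (g^`()).[S]) ef.
      rewrite derivB !derivM derivC mul0r add0r deriv_dX.
      rewrite !(hornerM, hornerD, hornerN, hornerC) => <-; rewrite /A; ring.
    have -> : A * (f^`().[S])^`() -
      (K.[S] + alpha^`().[S] + 'X * b^`().[S] * S^`()) * f^`().[S] =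
      K^`().[S] * f.[S] + E * f^`()^`().[S] - b^`().[S] * ('X * (f.[S])^`()).
      rewrite deriv_horner dfS.
      have -> : A * ((dX f^`()).[S] + f^`()^`().[S] * S^`()) =
        A * (dX f^`()).[S] + A * S^`() * f^`()^`().[S] by ring.
      rewrite EA.
      have -> : K^`().[S] * f.[S] =
        A * (dX f^`()).[S] + 'X * b^`().[S] * (dX f).[S] - alpha^`().[S] * f^`().[S]
        - alpha.[S] * f^`()^`().[S] - K.[S] * f^`().[S] by rewrite ef2; ring.
      ring.
    rewrite dvdp_sub ?dvdp_add //; [exact: dvdp_mull|exact: dvdp_mulr|exact: dvdp_mull].
  have -> : D = u.[S] * f.[S] + w.[S] * f^`().[S].
    by have := congr1 (fun g => g.[S]) eD; rewrite hornerD !hornerM hornerC.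
  by rewrite dvdp_add // dvdp_mull.
have := dvdp_leq D0 (key (size D)).
by rewrite size_polyXn ltnNge leqnSn.
Qed.

End Separatrix.

(** * Hyperbolic singular points *)

Section Hyperbolicity.
Variable C : numClosedFieldType.
Implicit Types (x y l m s T D : C).

(* For an invertible 2x2 matrix with trace T and determinant D, the quotient of
   the eigenvalues is real iff T ^ 2 / D is real and outside ]0, 4[; the
   condition below is closed in (T, D), and it holds when D = 0. *)
Definition nonhyp T D : bool :=
  (T ^+ 2 * D^* <= 0) || (4 * `|D| ^+ 2 <= T ^+ 2 * D^*).

Lemma nonhyp_scale s T D : nonhyp T D -> nonhyp (s * T) (s ^+ 2 * D).
Proof.
rewrite /nonhyp; have -> : (s * T) ^+ 2 * (s ^+ 2 * D)^* = (`|s| ^+ 4) * (T ^+ 2 * D^*).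
  rewrite (exprM `|s| 2 2) normCK !rmorphM /=.
  ring.
have -> : 4 * `|s ^+ 2 * D| ^+ 2 = `|s| ^+ 4 * (4 * `|D| ^+ 2).
  by rewrite normrM normrX; ring.
have s0 : 0 <= `|s| ^+ 4 by rewrite exprn_ge0.
case/orP => h; apply/orP; [left|right]; last exact: ler_wpM2l.
by rewrite -oppr_ge0 -mulrN mulr_ge0 // oppr_ge0.
Qed.

Lemma nonhyp_det0 T : nonhyp T 0.
Proof. by rewrite /nonhyp conjC0 mulr0 lexx. Qed.

(** Up to a nonnegative factor [T ^+ 2 * D^*] is [r (r + 1)^2], which is nonpositive for [r <= 0]
    and at least [4 r^2] for [r > 0]. *)
Lemma real_ratio_nonhyp l m (r : C) : r \is Num.real -> l = r * m ->
  nonhyp (l + m) (l * m).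
Proof.
move=> rr ->; rewrite /nonhyp.
have -> : (r * m + m) ^+ 2 * (r * m * m)^* = `|m| ^+ 4 * ((r + 1) ^+ 2 * r).
  rewrite (exprM `|m| 2 2) normCK !rmorphM /= (CrealP rr).
  ring.
have m0 : 0 <= `|m| ^+ 4 by rewrite exprn_ge0.
have r1 : 0 <= (r + 1) ^+ 2 by rewrite real_exprn_even_ge0 // rpredD ?rpred1.
have [r0|r0] := real_leP rr (@real0 C); apply/orP; [left|right].
  by rewrite mulr_ge0_le0 // mulr_ge0_le0.
have -> : 4 * `|r * m * m| ^+ 2 = `|m| ^+ 4 * (4 * r * r).
  by rewrite !normrM (gtr0_norm r0); ring.
rewrite ler_wpM2l // ler_wpM2r ?(ltW r0) // -subr_ge0.
have -> : (r + 1) ^+ 2 - 4 * r = (r - 1) ^+ 2 by ring.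
by rewrite real_exprn_even_ge0 // rpredB ?rpred1.
Qed.

(** With [s = T^2 / D], the ratio [r] solves [r^2 - (s - 2) r + 1 = 0]. Under the hypothesis [s] is
    real and the discriminant [s (s - 4)] is nonnegative. *)
Lemma nonhyp_real_ratio l m : m != 0 -> l != 0 -> nonhyp (l + m) (l * m) ->
  l / m \is Num.real.
Proof.
move=> m0 l0 h; have [r lE] : exists r, l = r * m by exists (l / m); rewrite divfK.
have r0 : r != 0 by apply: contraNneq l0 => r0; rewrite lE r0 mul0r.
pose s := (r + 1) ^+ 2 / r.
have D2 : 0 < `|r * m * m| ^+ 2 by rewrite exprn_gt0 // normr_gt0 !mulf_neq0.
have wE : (l + m) ^+ 2 * (l * m)^* = `|l * m| ^+ 2 * s.
  rewrite normCK lE /s; move: (_^*) => c; field; exact: r0.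
move: h; rewrite /nonhyp wE lE => h.
have {h} hs : (s <= 0) || (4 <= s).
  case/orP: h => h; apply/orP; [left|right].
    by rewrite -(pmulr_rle0 _ D2).
  by rewrite -(ler_pM2l D2) mulrC.
have sr : s \is Num.real.
  by case/orP: hs => h; [exact: ler0_real|apply: ger0_real; apply: le_trans h].
have dge : 0 <= s * (s - 4).
  case/orP: hs => h; last by rewrite mulr_ge0 ?subr_ge0 // (le_trans _ h).
  by rewrite mulr_le0 // subr_le0 (le_trans h).
have e : (2 * r - (s - 2)) ^+ 2 = s * (s - 4).
  rewrite /s; field; exact: r0.
have : 2 * r - (s - 2) \is Num.real.
  rewrite -[s * _]sqrtCK in e; move/eqP: e; rewrite eqf_sqr => /orP[]/eqP ->.
    by rewrite ger0_real // sqrtC_ge0.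
  by rewrite realN ger0_real // sqrtC_ge0.
move=> h; have -> : r * m / m = ((2 * r - (s - 2)) + (s - 2)) / 2 by field; exact: m0.
apply: rpredM; last by rewrite rpredV realn.
by apply: rpredD => //; apply: rpredB => //; exact: realn.
Qed.

(** The eigenvalues are [l] and [- m]; a resonance makes their quotient rational or the determinant
    zero. *)
Lemma hyp_nonresonant l m : ~~ nonhyp (l - m) (- (l * m)) ->
  forall i j : nat, (i + j)%N != 0%N -> i%:R * m + j%:R * l != 0.
Proof.
move=> h i j ij; apply: contra h => /eqP e.
have [i0|i0] := eqVneq i 0%N.
  move: e ij; rewrite i0 mul0r !add0r => /eqP; rewrite mulf_eq0 pnatr_eq0.
  move=> /orP[/eqP -> //|/eqP -> _].
  by rewrite mul0r oppr0 nonhyp_det0.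
have -> : - (l * m) = (- m) * l by ring.
rewrite addrC; apply: (@real_ratio_nonhyp _ _ (j%:R / i%:R)).
  by apply: rpredM; rewrite ?rpredV realn.
have iC : i%:R != 0 :> C by rewrite pnatr_eq0.
apply: (mulfI iC); rewrite mulrN.
have -> : i%:R * m = - (j%:R * l) by apply/eqP; rewrite -addr_eq0 e.
by field.
Qed.

Local Notation vec := ('I_3 -> C).
Implicit Types (A : 'I_3 -> mpoly 3 C) (z u v w : vec).

Definition wf A z v : C := dot (fun j => meval z (A j)) v.

(** The first vector is the argument of the 1-form, the second one the direction of
    differentiation. *)
Definition jac A z u v : C :=
  \sum_j \sum_k meval z (mderiv k (A j)) * u j * v k.

(* Trace and determinant of the linear part at z of the dual vector field, up
   to a factor depending on the choice of u, v transverse to z. *)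
Definition jacT A z u v := jac A z u v - jac A z v u.
Definition jacD A z u v := jac A z u u * jac A z v v - jac A z u v * jac A z v u.

Definition hyp_at A z := exists u v, ~~ nonhyp (jacT A z u v) (jacD A z u v).

(** Hyperbolicity as a condition on 1-jets at vectors of C^3, free of charts and vector fields; this
    is the version that openness arguments can handle. *)
Definition hypform A := forall z, (exists j, z j != 0) ->
  (forall j, meval z (A j) = 0) -> hyp_at A z.

Definition is_form d A :=
  (forall j, A j \is @ishomog1 3 C d.+1 mdeg) /\ \sum_j mpolyX C (mnm1 j) * A j = 0.

Lemma wf_eq0 A z : (forall v, wf A z v = 0) -> forall j, meval z (A j) = 0.
Proof.
move=> h j; rewrite -(h (fun k => (k == j)%:R)) /wf /dot (bigD1 j) //= eqxx mulr1.
by rewrite big1 ?addr0 // => k /negPf ->; rewrite mulr0.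
Qed.

Lemma jac_lin A z u v w (x : vec) (a b c : C) :
  jac A z (fun j => a * u j + b * v j + c * w j) x =
  a * jac A z u x + b * jac A z v x + c * jac A z w x.
Proof.
rewrite /jac !mulr_sumr -!big_split; apply: eq_bigr => j _ /=.
rewrite !mulr_sumr -!big_split; apply: eq_bigr => k _ /=; ring.
Qed.

Lemma jac_linr A z u v w (x : vec) (a b c : C) :
  jac A z x (fun j => a * u j + b * v j + c * w j) =
  a * jac A z x u + b * jac A z x v + c * jac A z x w.
Proof.
rewrite /jac !mulr_sumr -!big_split; apply: eq_bigr => j _ /=.
rewrite !mulr_sumr -!big_split; apply: eq_bigr => k _ /=; ring.
Qed.

Lemma eq_jac A z u u' v v' : u =1 u' -> v =1 v' -> jac A z u v = jac A z u' v'.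
Proof.
by move=> hu hv; apply: eq_bigr => j _; apply: eq_bigr => k _; rewrite hu hv.
Qed.

Lemma euler (F : mpoly 3 C) (m : nat) z : F \is @ishomog1 3 C m mdeg ->
  \sum_k meval z (mderiv k F) * z k = m%:R * meval z F.
Proof.
move=> Fm; have e : lpoly z z F = (1 + 'X) ^+ m * (meval z F)%:P.
  apply/eqP; rewrite -subr_eq0; apply/eqP; apply: horner_eq0 => s.
  rewrite hornerD hornerN lpolyE hornerM hornerC horner_exp hornerD hornerX hornerC.
  rewrite -(meval_homog _ _ Fm); apply/eqP; rewrite subr_eq0; apply/eqP.
  by apply: meval_eq => j; rewrite mulrDl mul1r.
have := congr1 (fun q : {poly C} => q^`().[0]) e.
rewrite lpoly_deriv derivM derivC mulr0 addr0 deriv_exp derivD derivC derivX add0r mul1r.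
rewrite hornerM hornerC hornerMn horner_exp hornerD hornerX hornerC addr0 expr1n => <-.
by apply: eq_bigr => k _; congr (_ * _); apply: meval_eq => j; rewrite mul0r addr0.
Qed.

Section Form.
Variables (d : nat) (A : 'I_3 -> mpoly 3 C).
Hypothesis Af : is_form d A.

Lemma wf_euler z : wf A z z = 0.
Proof.
have := congr1 (meval z) Af.2; rewrite meval0 raddf_sum /= => e; rewrite -[RHS]e.
by apply: eq_bigr => j _; rewrite mevalM mevalXU mulrC.
Qed.

Lemma jac_eulerr z u : jac A z u z = d.+1%:R * wf A z u.
Proof.
rewrite /jac /wf /dot mulr_sumr; apply: eq_bigr => j _.
under eq_bigr do rewrite mulrAC.
by rewrite -mulr_suml (euler z (Af.1 j)) mulrA.
Qed.

(** Obtained by differentiating the identity saying that the form kills the radial vector. *)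
Lemma jac_eulerl z v : jac A z z v = - wf A z v.
Proof.
apply/eqP; rewrite -addr_eq0; apply/eqP.
rewrite /jac exchange_big /= /wf /dot -big_split big1 // => k _ /=.
have := congr1 (mderiv k) Af.2; rewrite mderiv0 raddf_sum /=.
move=> /(congr1 (meval z)); rewrite meval0 raddf_sum /=.
move=> /(congr1 ( *%R^~ (v k))); rewrite mul0r => e; rewrite -[RHS]e.
under [in RHS]eq_bigr do rewrite mderivM mevalD !mevalM mevalXU.
rewrite big_split /= mulrDl addrC; congr (_ + _); last first.
  by rewrite mulr_suml; apply: eq_bigr => j _; congr (_ * _); rewrite mulrC.
congr (_ * _); rewrite (bigD1 k) //= big1 ?addr0 => [|j jk].
  have -> : mderiv k (mpolyX C (mnm1 k)) = 1 :> mpoly 3 C.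
    rewrite mderivX mnm1E eqxx scale1r -mpolyX0; congr mpolyX.
    by apply/mnmP => j; rewrite mnmBE mnm0E subnn.
  by rewrite rmorph1 mul1r.
by rewrite mderivX mnm1E (negPf jk) scale0r meval0 mul0r.
Qed.

(** At a singular point both Euler relations put [z] in the left and right kernels of the 1-jet,
    which thus lives on the quotient plane. A change of basis multiplies [jacT] by its determinant
    and [jacD] by the square of it. *)
Lemma hyp_at_basis z u v : (forall j, meval z (A j) = 0) -> hyp_at A z ->
  (forall x : vec, exists a b c : C, forall j, x j = a * u j + b * v j + c * z j) ->
  ~~ nonhyp (jacT A z u v) (jacD A z u v).
Proof.
move=> sz [u1 [v1 h]] span; apply: contra h.
have wz (x : vec) : wf A z x = 0 by rewrite /wf /dot big1 // => j _; rewrite sz mul0r.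
have zr (x : vec) : jac A z x z = 0 by rewrite jac_eulerr wz mulr0.
have zl (x : vec) : jac A z z x = 0 by rewrite jac_eulerl wz oppr0.
have [a [b [c eu]]] := span u1; have [a' [b' [c' ev]]] := span v1.
move=> /(@nonhyp_scale (a * b' - b * a')).
suff [-> ->] : jacT A z u1 v1 = (a * b' - b * a') * jacT A z u v /\
    jacD A z u1 v1 = (a * b' - b * a') ^+ 2 * jacD A z u v by [].
rewrite /jacT /jacD !(eq_jac _ _ eu eu) !(eq_jac _ _ ev ev) !(eq_jac _ _ eu ev) !(eq_jac _ _ ev eu).
by rewrite !jac_lin !jac_linr !zr !zl; split; ring.
Qed.

End Form.
End Hyperbolicity.

(** * Invariant curves and Carnot's relation *)

Section InvariantCurves.
Variable C : numClosedFieldType.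
Local Notation vec := ('I_3 -> C).
Implicit Types (z u v o U V : vec) (F : mpoly 3 C) (A : 'I_3 -> mpoly 3 C).

Definition inv_line A (l : vec) :=
  forall z v, dot l z = 0 -> dot l v = 0 -> wf A z v = 0.

Definition inv_curve A F := forall z, (exists j, z j != 0) -> meval z F = 0 ->
  (exists j, meval z (mderiv j F) != 0) ->
  forall v, \sum_j meval z (mderiv j F) * v j = 0 -> wf A z v = 0.

Definition wpoly A o U V v : {poly {poly C}} :=
  \sum_j fpoly o U V (A j) * (v j)%:P%:P.

Lemma wpolyE A o U V v x y : (wpoly A o U V v).[y%:P].[x] = wf A (pt o U V x y) v.
Proof.
rewrite /wpoly !horner_sum; apply: eq_bigr => j _.
by rewrite !hornerM fpolyE !hornerC.
Qed.

Lemma wpoly_dy A o U V v x y :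
  (wpoly A o U V v)^`().[y%:P].[x] = jac A (pt o U V x y) v V.
Proof.
rewrite /wpoly raddf_sum /= !horner_sum; apply: eq_bigr => j _.
rewrite derivM derivC mulr0 addr0 !hornerM !hornerC fpoly_dy !horner_sum mulr_suml.
by apply: eq_bigr => k _; rewrite !hornerM fpolyE !hornerC mulrAC.
Qed.

Lemma dX_sum (I : finType) (g : I -> {poly {poly C}}) :
  dX (\sum_i g i) = \sum_i dX (g i).
Proof. by elim/big_rec2: _ => [|i a b _ <-]; rewrite ?dX0 ?dXD. Qed.

Lemma wpoly_dx A o U V v x y :
  (dX (wpoly A o U V v)).[y%:P].[x] = jac A (pt o U V x y) v U.
Proof.
rewrite /wpoly dX_sum !horner_sum; apply: eq_bigr => j _.
rewrite dXM dXC derivC polyC0 mulr0 addr0 !hornerM !hornerC fpoly_dx !horner_sum mulr_suml.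
by apply: eq_bigr => k _; rewrite !hornerM fpolyE !hornerC mulrAC.
Qed.

Lemma poly_ext (q1 q2 : {poly C}) : (forall x, q1.[x] = q2.[x]) -> q1 = q2.
Proof.
move=> h; apply/eqP; rewrite -subr_eq0; apply/eqP; apply: horner_eq0 => x.
by rewrite hornerD hornerN h subrr.
Qed.

Lemma slice_fpoly o U V F : slice 0 (fpoly o U V F) = lpoly o V F.
Proof.
apply: poly_ext => y; rewrite horner_slice fpolyE lpolyE; apply: meval_eq => j.
by rewrite /pt mul0r addr0.
Qed.

Lemma horner_fpoly o U V F : (fpoly o U V F).[0] = lpoly o U F.
Proof.
apply: poly_ext => x; rewrite -polyC0 fpolyE lpolyE; apply: meval_eq => j.
by rewrite /pt mul0r addr0.
Qed.

Let lead_at (a : nat) (q : {poly C}) x := (size q <= a.+1)%N /\ (q`_a)%R = x.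

Let lead_atM a b q r x y : lead_at a q x -> lead_at b r y -> lead_at (a + b) (q * r) (x * y).
Proof.
move=> [sq <-] [sr <-]; split.
  by have := size_polyMleq q r; move: sq sr; lia.
rewrite coefM (bigD1 (inord a)) //= inordK ?ltnS ?leq_addr // addKn big1 ?addr0 // => i ia.
have [lt|ge] := ltnP i a.
  by rewrite (nth_default 0 (s := r)) ?mulr0 //; apply: leq_trans sr _; move: lt; clear; case: i => i /=; lia.
rewrite (nth_default 0 (s := q)) ?mul0r // (leq_trans sq) // ltn_neqAle ge andbT.
by apply: contra ia => /eqP e; apply/eqP/val_inj; rewrite /= inordK ?ltnS ?leq_addr.
Qed.

Lemma lpoly_lead (F : mpoly 3 C) m z u : F \is @ishomog1 3 C m mdeg ->
  (size (lpoly z u F) <= m.+1)%N /\ ((lpoly z u F)`_m)%R = meval u F.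
Proof.
move=> /dhomogP Fm; rewrite mevalE /lpoly /mmap big_seq [in X in _ /\ _ = X]big_seq.
elim/big_rec2: _ => [|k x q kF [sq qx]]; first by rewrite size_poly0 coef0.
suff [s1 s2] : lead_at m (mmap1 (fun j => (z j)%:P + (u j)%:P * 'X) k)
   (\prod_i u i ^+ k i).
  split; first by rewrite (leq_trans (size_polyD _ _)) // geq_max sq
    mul_polyC (leq_trans (size_scale_leq _ _)).
  by rewrite coefD mul_polyC coefZ s2 qx.
have /= <- := Fm _ kF; rewrite mdegE /mmap1.
elim/big_rec3: _ => [|i x1 q1 n _ h]; first by split; rewrite ?size_poly1 ?coef1.
apply: lead_atM => //; elim: (k i) => [|e IH]; first by split; rewrite ?size_poly1 ?coef1.
rewrite !exprS -add1n; apply: lead_atM => //; split.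
  rewrite addrC mulrC; case: (eqVneq (u i) 0) => [->|u0].
    by rewrite mulr0 add0r (leq_trans (size_polyC_leq1 _)).
  by rewrite mulrC mul_polyC size_polyDl size_scale ?size_polyX // ltnS size_polyC_leq1.
by rewrite coefD coefC /= add0r coefCM coefX mulr1.
Qed.

Lemma prod_XsubC_uniq (rs : seq C) :
  (forall r, r \in rs -> (\prod_(s <- rs) ('X - s%:P))^`().[r] != 0) -> uniq rs.
Proof.
elim: rs => // r rs IH h /=; apply/andP; split.
  apply/negP => rin; have := h r (mem_head _ _); rewrite big_cons derivM derivXsubC.
  have /rootP e : root (\prod_(s <- rs) ('X - s%:P)) r by rewrite root_prod_XsubC.
  by rewrite mul1r hornerD hornerM hornerXsubC subrr mul0r addr0 e eqxx.
apply: IH => t tin; have := h t; rewrite inE tin orbT => /(_ isT).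
rewrite big_cons derivM derivXsubC mul1r hornerD hornerM.
have /rootP -> : root (\prod_(s <- rs) ('X - s%:P)) t by rewrite root_prod_XsubC.
by rewrite add0r mulf_eq0 negb_or => /andP[].
Qed.

Section Curve.
Variables (d : nat) (A : 'I_3 -> mpoly 3 C) (p l : 'I_3 -> vec).
Hypotheses (Af : is_form d A) (Ah : hypform A) (pl : frame p l).
Hypothesis Al : forall i, inv_line A (l i).

Lemma span_chart i x y (w : vec) : exists a b c, forall j,
  w j = a * p i j + b * p (i + 1) j + c * pt (p (i + 2)) (p i) (p (i + 1)) x y j.
Proof.
exists (dot (l i) w - x * dot (l (i + 2)) w), (dot (l (i + 1)) w - y * dot (l (i + 2)) w),
  (dot (l (i + 2)) w) => j.
by rewrite /pt [LHS](pl.2 w j) (sum3 _ i); ring.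
Qed.

Section Chart.
Variable i : 'I_3.
Local Notation o := (p (i + 2)).
Local Notation U := (p i).
Local Notation V := (p (i + 1)).
Local Notation alpha := (wpoly A o U V U).
Local Notation beta := (wpoly A o U V V).

(** In this chart the side [l i] is [x = 0], the side [l (i + 1)] is [y = 0] and the origin is the
    vertex [p (i + 2)]; [U] is tangent to the side [y = 0]. *)
Lemma alpha_y0 x : alpha.[0].[x] = 0.
Proof.
rewrite -[0]polyC0 wpolyE; apply: (Al (i := i + 1)).
  by rewrite !dotDr !dotZr !pl.1 !ord3_neq mul0r mulr0 !addr0.
by rewrite pl.1 ord3_neq.
Qed.

Lemma beta_x0 : slice 0 beta = 0.
Proof.
apply: horner_eq0 => y; rewrite horner_slice wpolyE; apply: (Al (i := i)).
  by rewrite !dotDr !dotZr !pl.1 !ord3_neq mul0r mulr0 !addr0.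
by rewrite pl.1 ord3_neq.
Qed.

Lemma betaE : exists b, beta = 'X%:P * b.
Proof. by have [b ->] := slice_eq0 beta_x0; exists b; rewrite polyC0 subr0. Qed.

Lemma chart_sing y : alpha.[y%:P].[0] = 0 -> forall j, meval (pt o U V 0 y) (A j) = 0.
Proof.
rewrite wpolyE => aU; apply: wf_eq0 => w; have [a [b [c e]]] := span_chart i 0 y w.
have bV : wf A (pt o U V 0 y) V = 0.
  by have := congr1 (fun q : {poly C} => q.[y]) beta_x0; rewrite horner_slice horner0 wpolyE.
transitivity (a * wf A (pt o U V 0 y) U + b * wf A (pt o U V 0 y) V +
   c * wf A (pt o U V 0 y) (pt o U V 0 y)).
  by rewrite /wf -!dotZr -!dotDr; apply: eq_dot.
by rewrite aU bV (wf_euler Af) !mulr0 !addr0.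
Qed.

Lemma pt_neq0 x y : exists j, pt o U V x y j != 0.
Proof.
apply: contrapT => /forallNP h.
have : dot (l (i + 2)) (pt o U V x y) = 1.
  by rewrite !dotDr !dotZr !pl.1 !ord3_neq eqxx !mulr0 !addr0.
rewrite /dot big1 => [/esym/eqP|j _]; first by rewrite oner_eq0.
by have /negP/negPn/eqP -> := h j; rewrite mulr0.
Qed.

(* At a singular point of the line x = 0 the linear part of the dual field
   has eigenvalues b and - alpha_y. *)
Lemma chart_nonres b y : beta = 'X%:P * b -> alpha.[y%:P].[0] = 0 ->
  forall n k : nat, (n + k)%N != 0%N ->
    n%:R * b.[y%:P].[0] + k%:R * (alpha^`()).[y%:P].[0] != 0.
Proof.
move=> bE a0; apply: hyp_nonresonant.
have sing := chart_sing a0.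
have := hyp_at_basis Af sing (Ah (pt_neq0 0 y) sing) (span_chart i 0 y).
have e1 : jac A (pt o U V 0 y) V V = 0.
  rewrite -wpoly_dy bE derivM derivC mul0r add0r hornerM hornerC hornerM hornerX.
  by rewrite mul0r.
have e2 : jac A (pt o U V 0 y) V U = b.[y%:P].[0].
  rewrite -wpoly_dx bE dXM dXC derivX hornerD hornerM hornerC mul1r hornerD.
  by rewrite hornerM hornerC hornerM hornerX mul0r addr0.
by rewrite /jacT /jacD e1 mulr0 sub0r e2 wpoly_dy.
Qed.

End Chart.

Variables (F : mpoly 3 C) (m : nat).
Hypotheses (Fm : F \is @ishomog1 3 C m mdeg) (m0 : (0 < m)%N) (F0 : F != 0).
Hypothesis Firr : forall P Q, F = P * Q -> P \is a GRing.unit \/ Q \is a GRing.unit.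
Hypothesis Finv : inv_curve A F.
Hypothesis Fl : forall i, exists z, dot (l i) z = 0 /\ meval z F != 0.

Section Chart2.
Variable i : 'I_3.
Local Notation o := (p (i + 2)).
Local Notation U := (p i).
Local Notation V := (p (i + 1)).
Local Notation alpha := (wpoly A o U V U).
Local Notation beta := (wpoly A o U V V).
Local Notation f := (fpoly o U V F).

Let firr : irreducible2 f.
Proof. exact: (dehomog_irreducible pl Fm F0 Firr (Fl (i + 2)) m0). Qed.

(** The derivative of [f] along the dual field vanishes at smooth points of the curve, so its
    product with either partial derivative of [f] vanishes on the whole curve. As [f] is prime and
    cannot divide both partial derivatives, it divides the first factor. *)
Lemma curve_cofactor : exists K, beta * dX f - alpha * f^`() = f * K.
Proof.
set g := beta * _ - _.
have tang x y : f.[y%:P].[x] = 0 ->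
    (exists j, meval (pt o U V x y) (mderiv j F) != 0) -> g.[y%:P].[x] = 0.
  rewrite fpolyE => fz sm; rewrite /g !(hornerD, hornerN, hornerM) !wpolyE.
  set fx := (dX f).[_].[_]; set fy := f^`().[_].[_].
  have := Finv (pt_neq0 i x y) fz sm (v := fun j => fy * U j + (- fx) * V j).
  have -> : wf A (pt o U V x y) (fun j => fy * U j + (- fx) * V j) =
      fy * wf A (pt o U V x y) U - fx * wf A (pt o U V x y) V.
    by rewrite /wf dotDr !dotZr mulNr.
  move=> h; rewrite mulrC [X in _ - X]mulrC -opprB h ?oppr0 //.
  have -> : \sum_j meval (pt o U V x y) (mderiv j F) * (fy * U j + - fx * V j) =
      fy * fx - fx * fy.
    rewrite /fx /fy; set E := \sum_j _; rewrite [in LHS]/E.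
    transitivity (fy * (\sum_j meval (pt o U V x y) (mderiv j F) * U j)
      - fx * (\sum_j meval (pt o U V x y) (mderiv j F) * V j)).
      rewrite !mulr_sumr -sumrB; apply: eq_bigr => j _.
      by rewrite mulrDr mulNr mulrN [_ * (fy * _)]mulrCA [_ * (fx * _)]mulrCA.
    congr (_ * _ - _ * _); rewrite ?fpoly_dx ?fpoly_dy !horner_sum;
      by apply: eq_bigr => j _; rewrite !hornerM fpolyE !hornerC.
  by rewrite mulrC subrr.
have crit h : h = dX f \/ h = f^`() -> exists k, g * h = f * k.
  move=> hf; apply: irr2_nullstellensatz firr _ => x y fz; rewrite !hornerM.
  have [->|hn] := eqVneq h.[y%:P].[x] 0; first by rewrite mulr0.
  rewrite (tang x y fz) ?mul0r //; apply: contrapT => /forallNP s; move/eqP: hn; apply.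
  case: hf => ->; rewrite ?fpoly_dx ?fpoly_dy !horner_sum big1 // => j _;
    by rewrite !hornerM fpolyE; have /negP/negPn/eqP -> := s j; rewrite mul0r.
have [k1 e1] := crit _ (or_introl erefl); have [k2 e2] := crit _ (or_intror erefl).
have [//|[k fx]] := irr2_prime firr e1; have [//|[k' fy]] := irr2_prime firr e2.
have [f0 _ _] := firr.
have sf : (size f <= 1)%N.
  have sd : (size f^`() < size f)%N by apply: lt_size_deriv.
  have fy0 : f^`() = 0.
    move: sd; rewrite fy; have [-> |k0] := eqVneq k' 0; first by rewrite mulr0.
    rewrite size_mul // => lt; exfalso; move: k0; rewrite -size_poly_gt0.
    by move: lt; case: (size k') => // s; rewrite addnS /= ltnNge leq_addr.
  apply/leq_sizeP => j j1; have := congr1 (fun q : {poly {poly C}} => q`_j.-1) fy0.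
  rewrite coef_deriv coef0 prednK // => /eqP.
  have -> : f`_j *+ j = (j%:R)%:P * (f`_j : {poly C}) by rewrite polyC_natr mulr_natl.
  by rewrite mulf_eq0 polyC_eq0 pnatr_eq0 => /orP[/eqP j0|/eqP //]; rewrite j0 in j1.
have [b [c [b0 ef]]] := irr2_size1 firr sf.
have dxf : dX f = b%:P%:P.
  by rewrite ef -polyCM dXC derivM derivC mul0r add0r derivXsubC mulr1.
have := congr1 (slice c) fx; rewrite dxf ef sliceM [slice c (_ * _)]sliceM !sliceC.
rewrite hornerXsubC subrr polyC0 mulr0 mul0r hornerC => /eqP.
by rewrite polyC_eq0 (negPf b0).
Qed.

(** By homogeneity the affine line determines [F] on the plane spanned by [z] and [w], except where
    the coefficient of [z] is zero; there a polynomial identity in that coefficient fills the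
    gap. *)
Lemma plane_restrict (k : 'I_3) (z w : vec) :
  (forall v, dot (l k) v = 0 -> exists a b, forall j, v j = a * z j + b * w j) ->
  lpoly z w F != 0.
Proof.
move=> h; apply/eqP => e; have [v [lv Fv]] := Fl k; have [a [b vE]] := h v lv.
move: Fv; have -> : meval v F = meval (fun j => a * z j + b * w j) F by exact: meval_eq.
have pz c : c != 0 -> meval (fun j => c * z j + b * w j) F = 0.
  move=> c0; have -> : meval (fun j => c * z j + b * w j) F =
      meval (fun j => c * (z j + b / c * w j)) F.
    by apply: meval_eq => j; field.
  by rewrite (meval_homog _ _ Fm) -lpolyE e horner0 mulr0.
pose q := 'X * lpoly (fun j => b * w j) z F.
have q0 : q = 0.
  apply: horner_eq0 => c; rewrite hornerM hornerX lpolyE.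
  have [->|c0] := eqVneq c 0; first by rewrite mul0r.
  by rewrite (meval_eq _ (v2 := fun j => c * z j + b * w j)) ?pz ?mulr0 // => j; rewrite addrC.
move/eqP: q0; rewrite mulf_eq0 polyX_eq0 /= => /eqP q0.
have := congr1 (fun q : {poly C} => q.[a]) q0; rewrite lpolyE horner0 => e'.
rewrite (meval_eq _ (v2 := fun j => b * w j + a * z j)) ?e' ?eqxx // => j; exact: addrC.
Qed.

Lemma edge_poly_neq0 : lpoly o V F != 0.
Proof.
apply: (plane_restrict (k := i)) => v lv.
exists (dot (l (i + 2)) v), (dot (l (i + 1)) v) => j.
by rewrite [LHS](pl.2 v j) (sum3 _ i) lv mul0r add0r addrC.
Qed.

Lemma edge_poly_neq0' : lpoly o U F != 0.
Proof.
apply: (plane_restrict (k := i + 1)) => v lv.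
exists (dot (l (i + 2)) v), (dot (l i) v) => j.
by rewrite [LHS](pl.2 v j) (sum3 _ i) lv mul0r addr0 addrC.
Qed.

Lemma alpha_00 : alpha.[0%:P].[0] = 0.
Proof. by rewrite polyC0 alpha_y0. Qed.

Lemma alpha_slice_deriv y : ((slice 0 alpha)^`()).[y] = (alpha^`()).[y%:P].[0].
Proof. by rewrite -horner_slice /slice deriv_map. Qed.

Lemma edge_cofactor K : beta * dX f - alpha * f^`() = f * K ->
  (- slice 0 alpha) * (lpoly o V F)^`() = slice 0 K * lpoly o V F.
Proof.
move=> e; have := congr1 (slice 0) e.
rewrite -mulNr /slice rmorphD !rmorphM /= rmorphN /= -!/(slice 0 _) beta_x0 mul0r add0r.
by rewrite /slice -deriv_map -!/(slice 0 _) slice_fpoly [RHS]mulrC.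
Qed.

(** The orders [j] and [n] of [F] along the two sides at the vertex both compute the cofactor there.
    Equating the results is a resonance unless [n = j = 0]. *)
Lemma corner_neq0 : meval o F != 0.
Proof.
have [K eK] := curve_cofactor; have [b bE] := betaE i.
have nr := chart_nonres bE alpha_00.
have [j [psi [psi0 ej]]] := order_factor 0 edge_poly_neq0.
have a0 : (- slice 0 alpha).[0] = 0 by rewrite hornerN horner_slice alpha_00 oppr0.
have := @order_residue C 0 _ (slice 0 K) _ psi 0 j a0 psi0 ej.
rewrite mulr0 addr0 => /(_ (edge_cofactor eK)).
rewrite horner_slice derivN hornerN alpha_slice_deriv => K1.
have [n [phi [phi0 en]]] := order_factor 0 edge_poly_neq0'.
have b0 : ('X * b.[0]).[0] = 0 by rewrite hornerM hornerX mul0r.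
have := @order_residue C 0 ('X * b.[0]) K.[0] (lpoly o U F) phi 0 n b0 phi0 en.
have -> : ('X * b.[0]) * (lpoly o U F)^`() = K.[0] * lpoly o U F + ('X - 0%:P) ^+ n.+1 * 0.
  have := congr1 (fun q : {poly {poly C}} => q.[0]) eK.
  rewrite bE hornerD hornerN !hornerM hornerC -(horner_fpoly o U V F) => e.
  rewrite deriv_horner deriv0 mulr0 addr0 [K.[0] * _]mulrC -e.
  suff -> : alpha.[0] = 0 by rewrite mul0r !(subr0, mulr0, addr0).
  by apply: horner_eq0 => x; rewrite alpha_y0.
move=> /(_ erefl); rewrite derivM derivX mul1r hornerD hornerM hornerX mul0r addr0.
rewrite -polyC0 K1 => K2.
have n0 : (n + j)%N = 0%N.
  apply/eqP/negPn/negP => /nr/negP; apply; rewrite -K2 mulrN addrC subrr //.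
move: n0 en phi0 => /eqP; rewrite addn_eq0 => /andP[/eqP -> _].
rewrite expr0 mul1r => <-; rewrite lpolyE; congr (_ != 0); apply: meval_eq => k.
by rewrite mul0r addr0.
Qed.

End Chart2.

Lemma vertex_neq0 i : meval (p i) F != 0.
Proof. by have := corner_neq0 (i + 1); rewrite ord3_add. Qed.

(** The restriction to the side has degree exactly [m], since its leading coefficient is the value
    of [F] at a vertex. Its roots are singular points by [regular_order], and simple by
    [edge_root_simple]. *)
Lemma edge_roots i : exists rs : seq C, [/\ uniq rs, size rs = m,
  forall r, r \in rs -> wf A (pt (p (i + 2)) (p i) (p (i + 1)) 0 r) (p i) = 0 &
  meval (p (i + 2)) F = meval (p (i + 1)) F * \prod_(r <- rs) - r].
Proof.
set q := lpoly (p (i + 2)) (p (i + 1)) F.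
have [sq qm] := lpoly_lead (p (i + 2)) (p (i + 1)) Fm.
have sq' : size q = m.+1.
  by apply/eqP; rewrite eqn_leq sq ltnNge; apply/negP => /leq_sizeP/(_ m (leqnn m)) /eqP;
    rewrite qm (negPf (vertex_neq0 _)).
have lq : lead_coef q = meval (p (i + 1)) F by rewrite /lead_coef sq' -qm.
have [rs qE] := closed_field_poly_normal q; rewrite lq in qE.
have q0 : q != 0 by rewrite -size_poly_gt0 sq'.
have [K eK] := curve_cofactor i; have [b bE] := betaE i.
set f := fpoly (p (i + 2)) (p i) (p (i + 1)) F in eK.
have qr r : r \in rs -> q.[r] = 0.
  by move=> rrs; apply/rootP; rewrite qE rootZ ?vertex_neq0 // root_prod_XsubC.
have ar r : r \in rs -> (wpoly A (p (i + 2)) (p i) (p (i + 1)) (p i)).[r%:P].[0] = 0.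
  move=> /qr qr0; apply/eqP/negPn/negP => a0.
  have := regular_order (r := r) _ q0 (edge_cofactor eK).
  by rewrite hornerN horner_slice oppr_eq0 => /(_ a0); rewrite qr0 eqxx.
have sf : (1 < size f)%N.
  apply: leq_trans (_ : size (slice 0 f) <= _)%N; last exact: size_poly.
  by rewrite slice_fpoly -/q sq' ltnS.
(* [f] cannot divide its [y]-derivative, which has smaller degree in [y] and is nonzero because [q]
   has positive degree. *)
have [g [h [D [D0 eD]]]] : exists g h D, D != 0 /\ g * f + h * f^`() = D%:P.
  have firr := dehomog_irreducible pl Fm F0 Firr (Fl (i + 2)) m0.
  have [[k fk]|] := irr2_dvd_or_bezout f^`() firr sf; last first.
    by case=> g [h [D [D0 e]]]; exists g, h, D.
  have fn0 : f != 0 by rewrite -size_poly_gt0 (ltn_trans _ sf).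
  have := lt_size_deriv fn0; rewrite fk; have [k0|k0] := eqVneq k 0; last first.
    rewrite size_mul //; move: k0; rewrite -size_poly_gt0.
    by case: (size k) => // s _; rewrite addnS /= ltnNge leq_addr.
  have : q^`() = 0 by rewrite /q -(slice_fpoly _ (p i)) /slice deriv_map fk k0 mulr0 rmorph0.
  move=> /(congr1 (fun q : {poly C} => q`_m.-1)); rewrite coef_deriv coef0 prednK // qm.
  by move/eqP; rewrite mulrn_eq0 (negPf (vertex_neq0 _)) orbF => /eqP e; have := m0; rewrite e.
have simple r : r \in rs -> q^`().[r] != 0.
  move=> rrs; rewrite /q -(slice_fpoly _ (p i)).
  rewrite bE [f * K]mulrC in eK.
  apply: (edge_root_simple eK eD D0) => //.
  - by rewrite slice_fpoly.
  - by rewrite -horner_slice slice_fpoly; exact: qr.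
  - exact: ar.
  - exact: (chart_nonres bE (ar r rrs)).
exists rs; split.
- apply: prod_XsubC_uniq => r /simple; rewrite qE derivZ hornerZ mulf_eq0 negb_or.
  by case/andP.
- have := sq'; rewrite qE size_scale ?vertex_neq0 // size_prod_XsubC.
  by case.
- by move=> r /ar; rewrite wpolyE.
have := congr1 (fun q : {poly C} => q.[0]) qE; rewrite lpolyE hornerZ horner_prod.
have -> : \prod_(r <- rs) ('X - r%:P).[0] = \prod_(r <- rs) - r.
  by apply: eq_bigr => r _; rewrite hornerXsubC sub0r.
by move=> <-; apply: meval_eq => j; rewrite mul0r addr0.
Qed.

(* Compare the values of F at the two ends of each side. *)
Lemma carnot : exists rs : 'I_3 -> seq C,
  (forall i, [/\ uniq (rs i), size (rs i) = m &
     forall r, r \in rs i -> wf A (pt (p (i + 2)) (p i) (p (i + 1)) 0 r) (p i) = 0]) /\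
  \prod_i \prod_(r <- rs i) - r = 1.
Proof.
pose P i rs := [/\ uniq rs, size rs = m,
  forall r, r \in rs -> wf A (pt (p (i + 2)) (p i) (p (i + 1)) 0 r) (p i) = 0 &
  meval (p (i + 2)) F = meval (p (i + 1)) F * \prod_(r <- rs) - r].
have [rs h] : {rs & forall i, P i (rs i)} by apply: boolp.choice => i; exact: edge_roots.
exists rs; split=> [i|]; first by case: (h i).
have e k : \prod_(i < 3) meval (p (i + k)) F = \prod_(i < 3) meval (p i) F.
  by rewrite [RHS](reindex_inj (addIr k)).
have pn0 : \prod_(i < 3) meval (p i) F != 0.
  by apply/prodf_neq0 => i _; exact: vertex_neq0.
apply: (mulfI pn0); rewrite mulr1 -{1}(e 1) -big_split -(e 2) /=.
by apply: eq_bigr => i _; case: (h i).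
Qed.
End Curve.
End InvariantCurves.

(** * Degenerations of Carnot configurations *)

Section LimitData.
Variable C : numClosedFieldType.
Local Notation vec := ('I_3 -> C).
Implicit Types (x z u v w n : vec) (A : 'I_3 -> mpoly 3 C).

Definition cross u v : vec := fun j => u (j + 1) * v (j + 2) - u (j + 2) * v (j + 1).

Lemma cross_lin u v w (t : C) j :
  cross u (fun j => v j + t * w j) j = cross u v j + t * cross u w j.
Proof. by rewrite /cross; ring. Qed.

Lemma dot_cross u v : dot u (cross u v) = 0.
Proof. by rewrite /dot (sum3 _ 0) /cross !ord3_add !add0r; ring. Qed.

Lemma dot_cross2 u v : dot v (cross u v) = 0.
Proof. by rewrite /dot (sum3 _ 0) /cross !ord3_add !add0r; ring. Qed.

Lemma double_cross u v w j : cross u (cross v w) j = v j * dot u w - w j * dot u v.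
Proof. by rewrite /dot !(sum3 _ j) /cross !ord3_add; ring. Qed.

Lemma dot_crossA u v w : dot u (cross v w) = dot w (cross u v).
Proof. by rewrite /dot !(sum3 _ 0) /cross !ord3_add !add0r; ring. Qed.

Lemma dotZl u v c : dot (fun j => c * u j) v = c * dot u v.
Proof. by rewrite dotC dotZr dotC. Qed.

Lemma dot_dual u : (exists j, u j != 0) -> exists v, dot u v = 1.
Proof.
move=> [j uj]; exists (fun k => (k == j)%:R / u j); rewrite /dot (bigD1 j) //= eqxx.
by rewrite big1 ?addr0 => [|k /negPf ->]; rewrite ?mul0r ?mulr0 // mul1r mulfV.
Qed.

Lemma dot1_neq0 u v : dot u v != 0 -> exists j, u j != 0.
Proof.
move=> h; apply: contrapT => /forallNP h'; move/eqP: h; apply; rewrite /dot big1 // => j _.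
by have /negP/negPn/eqP -> := h' j; rewrite mul0r.
Qed.

Lemma adapted_basis (l z : vec) : (exists j, l j != 0) -> (exists j, z j != 0) ->
  dot l z = 0 -> exists u n, [/\ dot l n = 1, dot l u = 0 &
    forall w, exists a b c, forall j, w j = a * u j + b * n j + c * z j].
Proof.
move=> l0 z0 lz; have [n ln] := dot_dual l0; have [m] := dot_dual z0; rewrite dotC => mz.
have lm0 : exists j, cross l m j != 0.
  have [j lj] := l0; apply: contrapT => /forallNP h.
  have e : cross z (cross l m) j = l j by rewrite double_cross dotC mz dotC lz mulr0 subr0 mulr1.
  move/eqP: lj; apply; rewrite -e /cross.
  by have /negP/negPn/eqP := h (j + 1); have /negP/negPn/eqP := h (j + 2);
    rewrite /cross => -> ->; rewrite !mulr0 subrr.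
have [q] := dot_dual lm0; rewrite dotC => q1.
exists (cross l m), n; split=> // [|w]; first exact: dot_cross.
pose w1 j := w j + - dot l w * n j; pose w2 j := w1 j + - dot m w1 * z j.
have lw1 : dot l w1 = 0 by rewrite dotDr dotZr ln mulr1 subrr.
have lw2 : dot l w2 = 0 by rewrite dotDr dotZr lw1 lz mulr0 addr0.
have mw2 : dot m w2 = 0 by rewrite dotDr dotZr mz mulr1 subrr.
exists (dot q w2), (dot l w), (dot m w1) => j.
have e0 k : cross (cross l m) w2 k = 0.
  have -> : cross (cross l m) w2 k = - cross w2 (cross l m) k by rewrite /cross; ring.
  by rewrite double_cross ![dot w2 _]dotC lw2 mw2 !mulr0 subrr oppr0.
have := double_cross q (cross l m) w2 j; rewrite q1 mulr1.
have -> : cross q (cross (cross l m) w2) j = 0.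
  by rewrite {1}/cross !e0 !mulr0 subrr.
move=> /esym/eqP; rewrite subr_eq0 => /eqP; rewrite [_ * dot q w2]mulrC => ->.
by rewrite /w2 /w1; ring.
Qed.

Lemma cross_onto (l z n : vec) : dot l n = 1 -> dot l z = 0 ->
  forall j, z j = cross l (cross z n) j.
Proof. by move=> ln lz j; rewrite double_cross ln lz mulr1 mulr0 subr0. Qed.

Lemma avoid_hyperplanes (I : finType) (e : I -> vec) : (forall i, exists j, e i j != 0) ->
  exists x, \prod_i dot x (e i) != 0.
Proof.
move=> h; have p0 : \prod_i lform (e i) != 0.
  apply/prodf_neq0 => i _; apply/eqP => e0; have [v ev] := dot_dual (h i).
  have := congr1 (meval v) e0; rewrite meval_lform meval0 -/(dot _ _) ev => /eqP.
  by rewrite oner_eq0.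
apply: contrapT => /forallNP hn; move/eqP: p0; apply; apply: meval_inf => x.
rewrite rmorph_prod /=; apply/eqP; have /negP/negPn := hn x; congr (_ == _).
by apply: eq_bigr => i _; rewrite meval_lform dotC.
Qed.

Lemma eq_wf A z z' v v' : z =1 z' -> v =1 v' -> wf A z v = wf A z' v'.
Proof. by move=> hz hv; apply: eq_dot => // j; exact: meval_eq. Qed.

Lemma wf_lin A z u v (a b : C) :
  wf A z (fun j => a * u j + b * v j) = a * wf A z u + b * wf A z v.
Proof. by rewrite /wf dotDr !dotZr. Qed.

Lemma wf_line_deriv A z u v : exists2 P : {poly C},
  (forall s, P.[s] = wf A (fun j => z j + s * u j) v) & P^`().[0] = jac A z v u.
Proof.
exists (\sum_j lpoly z u (A j) * (v j)%:P) => [s|].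
  by rewrite horner_sum; apply: eq_bigr => j _; rewrite hornerM lpolyE hornerC.
rewrite raddf_sum /= horner_sum; apply: eq_bigr => j _.
rewrite derivM derivC mulr0 addr0 hornerM hornerC lpoly_deriv mulr_suml.
apply: eq_bigr => k _; rewrite mulrAC; congr (_ * _ * _); apply: meval_eq => i.
by rewrite mul0r addr0.
Qed.

(** On the line, the form is a constant times [l] times a product of linear forms vanishing at the
    points [e k]. The points of the line are the [cross l x], and [dot x (e k)] vanishes when this
    point is proportional to [e k]. The unknown constant is eliminated by cross-multiplication,
    which makes the condition closed. *)
Definition splits A (l : vec) (I : finType) (e : I -> vec) := forall x x' n n',
  wf A (cross l x) n * dot l n' * \prod_k dot x' (e k) =
  wf A (cross l x') n' * dot l n * \prod_k dot x (e k).

Section Splits.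
Variables (d : nat) (A : 'I_3 -> mpoly 3 C) (l : vec) (I : finType) (e : I -> vec).
Hypotheses (Af : is_form d A) (Ah : hypform A).
Hypotheses (l0 : exists j, l j != 0) (e0 : forall k, exists j, e k j != 0).
Hypotheses (le : forall k, dot l (e k) = 0) (spl : splits A l e).

Lemma splits_const : exists c, forall x n, wf A (cross l x) n = c * dot l n * \prod_k dot x (e k).
Proof.
have [n' ln'] := dot_dual l0; have [x' px'] := avoid_hyperplanes e0.
exists (wf A (cross l x') n' / \prod_k dot x' (e k)) => x n.
apply: (mulIf px'); have := spl x x' n n'; rewrite ln' mulr1 => ->.
by field.
Qed.

Lemma splits_inv : inv_line A l.
Proof.
have [c h] := splits_const; have [n ln] := dot_dual l0 => z v lz lv.
by rewrite (eq_wf A (cross_onto ln lz) (frefl v)) h lv mulr0 mul0r.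
Qed.

Lemma splits_sing k : forall j, meval (e k) (A j) = 0.
Proof.
have [c h] := splits_const; have [n ln] := dot_dual l0.
apply: wf_eq0 => v; rewrite (eq_wf A (cross_onto ln (le k)) (frefl v)) h.
by rewrite (bigD1 k) //= [dot _ (e k)]dotC dot_cross mul0r mulr0.
Qed.

(** A repeated point is a double zero of the form along the line, so the derivative in the direction
    of the line kills both the tangential and the transverse component, and [jacD] vanishes. *)
Lemma splits_distinct k k' : k != k' -> forall s, ~ (forall j, e k' j = s * e k j).
Proof.
move=> kk' s es; have [c h] := splits_const; set z := e k.
have [u [n [ln lu span]]] := adapted_basis l0 (e0 k) (le k).
have := hyp_at_basis Af (splits_sing k) (Ah (e0 k) (splits_sing k)) span.
rewrite /jacT /jacD -/z; suff [-> ->] : jac A z u u = 0 /\ jac A z n u = 0.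
  by rewrite mul0r mulr0 subrr nonhyp_det0.
split.
  have [P hP <-] := wf_line_deriv A z u u; have -> : P = 0.
    apply: horner_eq0 => t; rewrite hP; apply: splits_inv => //.
    by rewrite dotDr dotZr le lu mulr0 addr0.
  by rewrite deriv0 horner0.
have [P hP <-] := wf_line_deriv A z u n.
pose x0 := cross z n; pose x1 := cross u n.
have eP : P = c%:P * (('X * 'X) * ((dot x1 (e k) * dot x1 (e k'))%:P *
    \prod_(i | (i != k) && (i != k')) ((dot x0 (e i))%:P + (dot x1 (e i))%:P * 'X))).
  apply: poly_ext => t; rewrite hP.
  have ht : forall j, z j + t * u j = cross l (fun j => x0 j + t * x1 j) j.
    move=> j; have lz : dot l z = 0 := le k.
    by rewrite cross_lin; congr (_ + _ * _); exact: cross_onto.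
  transitivity (wf A (cross l (fun j => x0 j + t * x1 j)) n); first exact: eq_wf.
  rewrite h ln mulr1 (bigD1 k) // (bigD1 k') 1?eq_sym //.
  have de i : dot (fun j => x0 j + t * x1 j) (e i) = dot x0 (e i) + t * dot x1 (e i).
    by rewrite dotC dotDr dotZr ![dot (e i) _]dotC.
  rewrite !de.
  have x0k : dot x0 (e k) = 0 by rewrite dotC dot_cross.
  have -> : dot x0 (e k') = 0 by rewrite (eq_dot (frefl x0) es) dotZr x0k mulr0.
  rewrite x0k !add0r !hornerM !hornerC hornerX horner_prod.
  have -> : \prod_(i | (i != k) && (i != k')) dot (fun j => x0 j + t * x1 j) (e i) =
     \prod_(i | (i != k) && (i != k'))
        ((dot x0 (e i))%:P + (dot x1 (e i))%:P * 'X).[t].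
    by apply: eq_bigr => i _; rewrite de hornerD hornerM !hornerC hornerX mulrC.
  by set PP := \prod_(_ | _) _; rewrite /=; ring.
rewrite eP; set Q := _%:P * \prod_(_ | _) _.
by rewrite derivM derivC mul0r add0r !derivM derivX !(hornerM, hornerD, hornerX)
  !(mul0r, mulr0, addr0).
Qed.

End Splits.

Section Good.
Variables (d : nat) (A : 'I_3 -> mpoly 3 C) (p l : 'I_3 -> vec).
Hypotheses (Af : is_form d A) (Ah : hypform A) (pl : frame p l).
Hypothesis Al : forall i, inv_line A (l i).

(* No choice of m singular points on each side satisfies the relation of
   Carnot's theorem, so that there is no invariant curve besides the sides. *)
Definition good := forall (m : nat) (rs : 'I_3 -> seq C), (0 < m)%N ->
  (forall i, [/\ uniq (rs i), size (rs i) = m &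
     forall r, r \in rs i -> wf A (pt (p (i + 2)) (p i) (p (i + 1)) 0 r) (p i) = 0]) ->
  \prod_i \prod_(r <- rs i) - r != 1.

Lemma good_curve F m : good -> F \is @ishomog1 3 C m mdeg -> (0 < m)%N -> F != 0 ->
  (forall P Q, F = P * Q -> P \is a GRing.unit \/ Q \is a GRing.unit) ->
  inv_curve A F -> exists i, forall z, dot (l i) z = 0 -> meval z F = 0.
Proof.
move=> g Fm m0 F0 Firr Finv; apply: contrapT => /forallNP h.
have Fl i : exists z, dot (l i) z = 0 /\ meval z F != 0.
  have /existsNP[z /not_implyP[lz /eqP Fz]] := h i; by exists z.
have [rs [hrs e]] := carnot Af Ah pl Al Fm m0 F0 Firr Finv Fl.
by have := g m rs m0 hrs; rewrite e eqxx.
Qed.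

Lemma lform_homog (v : vec) : lform v \is @ishomog1 3 C 1 mdeg.
Proof.
by rewrite /lform; apply: rpred_sum => j _; apply: dhomogZ; rewrite dhomogX /= mdeg1.
Qed.

Lemma lform_neq0 (v : vec) : (exists j, v j != 0) -> lform v != 0.
Proof.
move=> v0; have [w vw] := dot_dual v0; apply/eqP => e.
have := congr1 (meval w) e; rewrite meval_lform -/(dot v w) vw meval0 => /eqP.
by rewrite oner_eq0.
Qed.

Lemma homog1_irreducible (F : mpoly 3 C) : F != 0 -> F \is @ishomog1 3 C 1 mdeg ->
  forall P Q, F = P * Q -> P \is a GRing.unit \/ Q \is a GRing.unit.
Proof.
move=> F0 /dhomogP F1 P Q e.
have P0 : P != 0 by apply: contraNneq F0 => P0; rewrite e P0 mul0r.
have Q0 : Q != 0 by apply: contraNneq F0 => Q0; rewrite e Q0 mulr0.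
have sF : (msize F <= 2)%N by rewrite msizeE; apply/bigmax_leqP_seq => k /F1 /= ->.
have unit_of (G : mpoly 3 C) : G != 0 -> (msize G <= 1)%N -> G \is a GRing.unit.
  move=> G0 /msize1_polyC eG; apply/mpoly_unitP; exists (mcoeff mnm0 G) => //.
  by apply: contraNneq G0 => g0; rewrite eG g0 mpolyC0.
have [sP|sP] := leqP (msize P) 1; first by left; exact: unit_of.
right; apply: unit_of => //; move: sF; rewrite e msizeM //.
by case: (msize P) sP => [|[|a]] //; case: (msize Q) => [|[|b]] //; rewrite !addSn !addnS.
Qed.

Lemma inv_line_curve (v : vec) : inv_line A v -> inv_curve A (lform v).
Proof.
move=> h z _ lz _ w lw; apply: h; first by rewrite /dot -meval_lform.
rewrite -[RHS]lw; apply: eq_bigr => j _; congr (_ * _).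
rewrite /lform (linear_sum (mderiv j)) (linear_sum (meval z)) (bigD1 j) //= big1 ?addr0 => [|k kj].
  rewrite mderivZ mevalZ; have -> : mderiv j (mpolyX C (mnm1 j)) = 1 :> mpoly 3 C.
    rewrite mderivX mnm1E eqxx scale1r -mpolyX0; congr mpolyX.
    by apply/mnmP => i; rewrite mnmBE mnm0E subnn.
  by rewrite meval1 mulr1.
by rewrite mderivZ mderivX mnm1E (negPf kj) scale0r scaler0 meval0.
Qed.

(** A linear form is an irreducible invariant curve, to which [good_curve] applies. *)
Lemma good_inv_line (v : vec) : good -> (exists j, v j != 0) -> inv_line A v ->
  exists i c, c != 0 /\ forall j, v j = c * l i j.
Proof.
move=> g v0 hv.
have [i h] := good_curve g (lform_homog v) (ltn0Sn 0) (lform_neq0 v0)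
  (homog1_irreducible (lform_neq0 v0) (lform_homog v)) (inv_line_curve hv).
have vE : forall j, v j = dot v (p i) * l i j.
  move=> j; have := h (fun k => (k == j)%:R + - l i j * p i k).
  rewrite meval_lform -/(dot v _) !dotDr !dotZr pl.1 eqxx mulr1.
  have dj (w : vec) : dot w (fun k => (k == j)%:R) = w j.
    by rewrite /dot (bigD1 j) //= eqxx mulr1 big1 ?addr0 // => k /negPf ->; rewrite mulr0.
  rewrite !dj subrr => /(_ erefl) /eqP; rewrite mulNr subr_eq0 => /eqP ->; exact: mulrC.
exists i, (dot v (p i)); split=> //.
by have [j vj] := v0; apply: contraNneq vj => e; rewrite vE e mul0r.
Qed.

End Good.

(* Closed conditions on lines l i and singular points e i k on them that pass
   to the limit along forms with an extra invariant curve: e i 0 and e i 1 are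
   vertices of the triangle, the other e i k are the remaining singular points,
   the first m of which satisfy the relation of Carnot's theorem.  The trace
   condition prevents the three lines from collapsing. *)
Definition limit_data d A (l : 'I_3 -> vec) (e : 'I_3 -> 'I_d.+1 -> vec) :=
  [/\ forall i k, dot (l i) (e i k) = 0,
      forall i, dot (l (i + 2)) (e i ord0) = 0 /\ dot (l (i + 1)) (e i (inord 1)) = 0,
      forall i, splits A (l i) (e i),
      forall i v v', jac A (e i ord0) v v * (dot (l i) v' * dot (l (i + 2)) v') =
        jac A (e i ord0) v' v' * (dot (l i) v * dot (l (i + 2)) v) &
      \prod_(1 <= m < d) (\prod_i \prod_(k < d.+1 | (1 < k < m.+2)%N) dot (l (i + 1)) (e i k)
        - (-1) ^+ m * \prod_i \prod_(k < d.+1 | (1 < k < m.+2)%N) dot (l (i + 2)) (e i k)) = 0].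

Lemma nonhyp_double (x : C) : nonhyp (x + x) (x * x).
Proof.
rewrite /nonhyp; apply/orP; right.
have -> : (x + x) ^+ 2 * (x * x)^* = 4 * ((x * x) * (x * x)^*) by ring.
by rewrite -normCK.
Qed.

(** The condition makes the three values distinct, so [g] is a permutation that keeps or reverses
    the cyclic order. *)
Lemma ord3_orientation (g : 'I_3 -> 'I_3) : (forall i, g i != g (i + 2)) ->
  (forall i, g (i + 1) = g i + 1 /\ g (i + 2) = g i + 2) \/
  (forall i, g (i + 1) = g i + 2 /\ g (i + 2) = g i + 1).
Proof.
move=> h; have h0 := h 0; have h1 := h 1; have h2 := h 2.
have E : (((0 + 2)%R = 2%R :> 'I_3) * ((1 + 2)%R = 0%R :> 'I_3) *
    ((2 + 2)%R = 1%R :> 'I_3) * ((0 + 1)%R = 1%R :> 'I_3) *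
    ((1 + 1)%R = 2%R :> 'I_3) * ((2 + 1)%R = 0%R :> 'I_3))%type.
  by do !split; exact: val_inj.
have cases (i : 'I_3) : [\/ i = 0, i = 1 | i = 2].
  case: i => [[|[|[|//]]] hi]; [apply: Or31|apply: Or32|apply: Or33]; exact: val_inj.
rewrite !E in h0 h1 h2.
case: (cases (g 0)) h0 h1 h2 => e0; case: (cases (g 1)) => e1; case: (cases (g 2)) => e2;
  rewrite ?e0 ?e1 ?e2 ?eqxx //= => _ _ _; [left|right|right|left|left|right];
  move=> i; case: (cases i) => ->; by rewrite ?E ?e0 ?e1 ?e2 ?E.
Qed.

Lemma size_ord_range d m : (m < d)%N ->
  size [seq k : 'I_d.+1 <- enum 'I_d.+1 | (1 < k < m.+2)%N] = m.
Proof.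
move=> md; rewrite size_filter -(count_map val (fun k => 1 < k < m.+2)%N) val_enum_ord.
have -> : d.+1 = (2 + (m + (d - m.+1)))%N by lia.
rewrite !iotaD !count_cat add0n.
have -> : count (fun k => 1 < k < m.+2)%N (iota 0 2) = 0%N by [].
have -> : count (fun k => 1 < k < m.+2)%N (iota 2 m) = size (iota 2 m).
  by apply/eqP; rewrite -all_count; apply/allP => k; rewrite mem_iota; lia.
have -> : count (fun k => 1 < k < m.+2)%N (iota (2 + m) (d - m.+1)) = 0%N.
  by apply/eqP; rewrite -leqn0 leqNgt -has_count; apply/hasPn => k; rewrite mem_iota; lia.
by rewrite size_iota addn0.
Qed.

(** Goodness makes the three lines sides of the triangle, the trace condition keeps them distinct,
    and hyperbolicity separates the points; what remains is a genuine Carnot relation. *)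
Lemma limit_data_good d A (p ls l : 'I_3 -> vec) (e : 'I_3 -> 'I_d.+1 -> vec) :
  (2 <= d)%N -> is_form d A -> hypform A -> frame p ls -> (forall i, inv_line A (ls i)) ->
  good A p -> (forall i, exists j, l i j != 0) -> (forall i k, exists j, e i k j != 0) ->
  limit_data A l e -> False.
Proof.
move=> d2 Af Ah pl Als gd l0 e0 [le lcorner spl tr car].
have linv i : inv_line A (l i) by exact: splits_inv (l0 i) (e0 i) (spl i).
have esing i k := splits_sing (l0 i) (e0 i) (le i) (spl i) k.
pose P i k := exists c, c != 0 /\ forall j, l i j = c * ls k j.
have [g hg] : {g & forall i, P i (g i)}.
  by apply: boolp.choice => i; exact: (good_inv_line Af Ah pl Als gd (l0 i) (linv i)).
pose Q i c := c != 0 /\ forall j, l i j = c * ls (g i) j.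
have [c hc] : {c & forall i, Q i (c i)} by apply: boolp.choice => i; exact: hg.
have c0 i : c i != 0 by case: (hc i).
have lE i v : dot (l i) v = c i * dot (ls (g i)) v.
  by rewrite -dotZl; apply: eq_dot => //; case: (hc i).
(* If two lines coincide, the symmetric part of the 1-jet is a multiple of the square of [L], and
   the two eigenvalues are equal. *)
have gneq i : g i != g (i + 2).
  apply/eqP => gi; pose L := ls (g i); set z := e i ord0.
  have L0 : exists j, L j != 0.
    by apply: (@dot1_neq0 L (p (g i))); rewrite pl.1 eqxx oner_eq0.
  have Lz : dot L z = 0 by apply: (mulfI (c0 i)); rewrite -lE mulr0 le.
  have [u [n [Ln Lu span]]] := adapted_basis L0 (e0 i ord0) Lz.
  have := hyp_at_basis Af (esing i ord0) (Ah _ (e0 i ord0) (esing i ord0)) span.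
  have quad v : jac A z v v = jac A z n n * (dot L v) ^+ 2.
    have := tr i v n; rewrite !lE -gi -/L Ln !mulr1 => h.
    by apply: (mulIf (mulf_neq0 (c0 i) (c0 (i + 2)))); rewrite h; ring.
  have uu : jac A z u u = 0 by rewrite quad Lu expr0n mulr0.
  have : jac A z u n + jac A z n u = 0.
    have := quad (fun j => 1 * u j + 1 * n j + 0 * z j).
    rewrite !dotDr !dotZr Lu Ln jac_lin !jac_linr uu !mul1r !mul0r !addr0 !add0r expr1n mulr1.
    by move=> h; apply: (addIr (jac A z n n)); rewrite add0r -addrA.
  move=> /eqP; rewrite addrC addr_eq0 => /eqP nu.
  rewrite /jacT /jacD -/z uu nu opprK mul0r sub0r mulrN opprK.
  by rewrite nonhyp_double.
have [m [m1 md em]] : exists m, [/\ (0 < m)%N, (m < d)%N &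
    \prod_i \prod_(k < d.+1 | (1 < k < m.+2)%N) dot (l (i + 1)) (e i k) =
    (-1) ^+ m * \prod_i \prod_(k < d.+1 | (1 < k < m.+2)%N) dot (l (i + 2)) (e i k)].
  move/eqP: car; rewrite big_seq_cond prodf_seq_eq0 => /hasP[m].
  rewrite mem_index_iota => /andP[m1 md] /andP[_]; rewrite subr_eq0 => /eqP h.
  by exists m.
pose K := [seq k : 'I_d.+1 <- enum 'I_d.+1 | (1 < k < m.+2)%N].
have sK : size K = m by exact: size_ord_range.
have prodK (F : 'I_d.+1 -> C) : \prod_(k < d.+1 | (1 < k < m.+2)%N) F k = \prod_(k <- K) F k.
  by rewrite big_filter big_enum_cond.
have hor := ord3_orientation gneq.
pose a i k := dot (ls (g i + 1)) (e i k); pose b i k := dot (ls (g i + 2)) (e i k).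
have eE i k j : e i k j = a i k * p (g i + 1) j + b i k * p (g i + 2) j.
  rewrite [LHS](pl.2 _ j) (sum3 _ (g i)) (_ : dot (ls (g i)) _ = 0) ?mul0r ?add0r //.
  by apply: (mulfI (c0 i)); rewrite -lE mulr0 le.
have par i k k' : k != k' -> a i k * b i k' != b i k * a i k'.
  move=> kk'; apply/eqP => ab.
  apply: (splits_distinct Af Ah (l0 i) (e0 i) (le i) (spl i) kk'
    (s := if a i k == 0 then b i k' / b i k else a i k' / a i k)) => j.
  case: eqVneq => [ak|ak]; last first.
    rewrite !eE mulrDr !mulrA divfK //; congr (_ + _ * _).
    by apply: (mulfI ak); rewrite ab; field.
  have [bk|bk] := eqVneq (b i k) 0.
    by have [j0] := e0 i k; rewrite eE ak bk !mul0r addr0 eqxx.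
  have ak' : a i k' = 0 by move/eqP: ab; rewrite ak mul0r eq_sym mulf_eq0 (negPf bk) => /eqP.
  by rewrite !eE ak ak' !mul0r !add0r mulrA divfK.
(* Reversing the orientation exchanges the two vertices, but both keep an index below 2. *)
have corner i : exists k0 k1 : 'I_d.+1, [/\ (k0 < 2)%N, (k1 < 2)%N, b i k0 = 0 & a i k1 = 0].
  have i1 : (inord 1 : 'I_d.+1) = 1%N :> nat by rewrite inordK //; lia.
  have [q1 q2] := lcorner i; rewrite !lE in q1 q2.
  move/eqP: q1; move/eqP: q2; rewrite !mulf_eq0 !(negPf (c0 _)) /= => /eqP q2 /eqP q1.
  case: hor => /(_ i)[g1 g2]; rewrite g1 in q2; rewrite g2 in q1.
    by exists ord0, (inord 1); split=> //; rewrite i1.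
  by exists (inord 1), ord0; split=> //; rewrite i1.
have ab0 i (k : 'I_d.+1) : k \in K -> b i k != 0 /\ a i k != 0.
  rewrite mem_filter => /andP[/andP[k1 _] _]; have [x [y [x2 y2 bx ay]]] := corner i.
  have kx : k != x by apply: contraTneq k1 => ->; rewrite -leqNgt.
  have ky : k != y by apply: contraTneq k1 => ->; rewrite -leqNgt.
  split; apply/eqP => h.
    by have := par i _ _ kx; rewrite bx h mulr0 mul0r eqxx.
  by have := par i _ _ ky; rewrite ay h mulr0 mul0r eqxx.
have ginj : injective g.
  move=> i i' gg; have h : [\/ i' = i, i' = i + 2 | i = i' + 2].
    by case: i i' {gg} => [[|[|[|//]]] hi] [[|[|[|//]]] hi'];
      (try by apply: Or31; exact: val_inj); (try by apply: Or32; exact: val_inj);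
      apply: Or33; exact: val_inj.
  case: h => // h; first by have := gneq i; rewrite -h gg eqxx.
  by have := gneq i'; rewrite -h gg eqxx.
have [gi gK Kg] := injF_bij ginj.
pose rs j := [seq a (gi j) k / b (gi j) k | k <- K].
have := gd m rs m1 => /(_ _)/negP; apply.
  move=> j; have Kj := Kg j; set i := gi j in Kj; split.
  - rewrite map_inj_in_uniq; first by rewrite filter_uniq // enum_uniq.
    move=> k k' kK k'K; have [bk _] := ab0 i _ kK; have [bk' _] := ab0 i _ k'K.
    move=> /eqP; rewrite eqr_div // => /eqP h; apply/eqP/negPn/negP => /(par i).
    by rewrite h mulrC eqxx.
  - by rewrite size_map.
  - move=> r /mapP[k kK ->]; have [bk _] := ab0 i _ kK.
    rewrite /wf /dot big1 // => q _.
    have -> : meval (pt (p (j + 2)) (p j) (p (j + 1)) 0 (a i k / b i k)) (A q) =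
       meval (fun s => (b i k)^-1 * e i k s) (A q).
      apply: meval_eq => s; rewrite /pt eE Kj mul0r addr0 -/i; field.
      exact: bk.
    by rewrite (meval_homog _ _ (Af.1 q)) esing mulr0 mul0r.
rewrite (reindex_inj ginj) /=.
pose PA := \prod_i \prod_(k <- K) a i k; pose PB := \prod_i \prod_(k <- K) b i k.
have PB0 : PB != 0.
  by apply/prodf_neq0 => i _; rewrite prodf_seq_neq0; apply/allP => k /(ab0 i)[].
have cs q : \prod_i \prod_(k <- K) c (i + q) = \prod_i \prod_(k <- K) c i.
  by rewrite [RHS](reindex_inj (addIr q)).
have cn0 : \prod_i \prod_(k <- K) c i != 0.
  by apply/prodf_neq0 => i _; rewrite prodf_seq_neq0; apply/allP => k _; rewrite implybE c0 orbT.
have lprod q (h : 'I_3 -> 'I_d.+1 -> C) :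
    (forall i k, dot (l (i + q)) (e i k) = c (i + q) * h i k) ->
    \prod_i \prod_(k < d.+1 | (1 < k < m.+2)%N) dot (l (i + q)) (e i k) =
    \prod_i \prod_(k <- K) c i * \prod_i \prod_(k <- K) h i k.
  move=> hh; rewrite -(cs q) -big_split; apply: eq_bigr => i _.
  by rewrite prodK -big_split; apply: eq_bigr => k _.
(* Under the reversed orientation [a] and [b] exchange roles; the sign is its own inverse, so the
   relation keeps its shape. *)
have PAB : PA = (-1) ^+ m * PB.
  case: hor => hor.
    have := em; rewrite (lprod 1 a) => [|i k]; last by rewrite lE (hor i).1.
    rewrite (lprod 2 b) => [|i k]; last by rewrite lE (hor i).2.
    by rewrite mulrCA => /(mulfI cn0).
  have := em; rewrite (lprod 1 b) => [|i k]; last by rewrite lE (hor i).1.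
  rewrite (lprod 2 a) => [|i k]; last by rewrite lE (hor i).2.
  rewrite mulrCA => /(mulfI cn0) e1.
  by rewrite /PB e1 mulrA -exprD addnn -mul2n exprM sqrrN expr1n expr1n mul1r.
have -> : \prod_i \prod_(r <- rs (g i)) - r = ((-1) ^+ m) ^+ 3 * PA / PB.
  have -> : ((-1) ^+ m) ^+ 3 = \prod_(i < 3) (-1) ^+ m :> C by rewrite prodr_const card_ord.
  rewrite /PA /PB -prodfV -!big_split; apply: eq_bigr => i _; rewrite /= /rs gK big_map.
  rewrite -prodfV -sK -[in (-1) ^+ _]sum1_size -prodrXr -!big_split /=.
  by apply: eq_bigr => k _; rewrite expr1 mulN1r mulNr.
rewrite PAB mulrA -exprM -exprD mulfK //.
have -> : (m * 3 + m = 2 * (2 * m))%N by lia.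
by rewrite exprM sqrrN expr1n expr1n.
Qed.

End LimitData.

(** * Configurations attached to an actual Carnot relation *)

Section LimitDataExists.
Variable C : numClosedFieldType.
Local Notation vec := ('I_3 -> C).
Implicit Types (x z u v w n : vec) (A : 'I_3 -> mpoly 3 C).

Lemma wf_scale d A c z v : is_form d A -> wf A (fun j => c * z j) v = c ^+ d.+1 * wf A z v.
Proof.
move=> Af; rewrite /wf /dot mulr_sumr; apply: eq_bigr => j _.
by rewrite (meval_homog _ _ (Af.1 j)) mulrA.
Qed.

Lemma mderiv_homog (F : mpoly 3 C) (m : nat) k : F \is @ishomog1 3 C m.+1 mdeg ->
  mderiv k F \is @ishomog1 3 C m mdeg.
Proof.
move=> /dhomogP h; apply/dhomogP => q; rewrite mcoeff_msupp mcoeff_mderiv => qF.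
have /h : mnm_add q (mnm1 k) \in msupp F.
  by rewrite mcoeff_msupp; apply: contraNneq qF => ->; rewrite mul0rn.
by rewrite /= mdegD mdeg1 addn1 => -[].
Qed.

Lemma jac_scale d A c z u v : is_form d A ->
  jac A (fun j => c * z j) u v = c ^+ d * jac A z u v.
Proof.
move=> Af; rewrite /jac mulr_sumr; apply: eq_bigr => j _.
rewrite mulr_sumr; apply: eq_bigr => k _.
by rewrite (meval_homog _ _ (mderiv_homog k (Af.1 j))) !mulrA.
Qed.

(** All conditions are homogeneous in each vector separately; hence representatives may be
    normalized into a compact set. *)
Lemma limit_data_scale d A (l : 'I_3 -> vec) (e : 'I_3 -> 'I_d.+1 -> vec)
    (c : 'I_3 -> C) (s : 'I_3 -> 'I_d.+1 -> C) : is_form d A -> limit_data A l e ->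
  limit_data A (fun i j => c i * l i j) (fun i k j => s i k * e i k j).
Proof.
move=> Af [h1 h2 h3 h4 h5]; split.
- by move=> i k; rewrite dotZl dotZr h1 !mulr0.
- by move=> i; have [e1 e2] := h2 i; rewrite !dotZl !dotZr e1 e2 !mulr0.
- move=> i x x' n n'.
  have cr y : cross (fun j => c i * l i j) y =1 (fun j => c i * cross (l i) y j).
    by move=> j; rewrite /cross; ring.
  rewrite !(eq_wf A (cr _) (frefl _)) !(wf_scale _ _ _ Af) !dotZl.
  have pr y : \prod_k dot y (fun j => s i k * e i k j) = (\prod_k s i k) * \prod_k dot y (e i k).
    by rewrite -big_split; apply: eq_bigr => k _; rewrite dotZr.
  rewrite !pr; have := h3 i x x' n n'; set P := \prod_k s i k; set a := wf A _ n.
  set a' := wf A _ n'; set b := \prod_k _; set b' := \prod_k _ => h.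
  transitivity (c i ^+ d.+1 * c i * P * (a * dot (l i) n' * b)); first by ring.
  by rewrite h; ring.
- move=> i v v'; rewrite !(jac_scale _ _ _ _ Af) !dotZl.
  transitivity (s i ord0 ^+ d * c i * c (i + 2) *
     (jac A (e i ord0) v v * (dot (l i) v' * dot (l (i + 2)) v'))); first by ring.
  by rewrite h4; ring.
move/eqP: h5; rewrite prodf_seq_eq0 => /hasP[m mi /andP[_ /eqP hm]].
apply/eqP; rewrite prodf_seq_eq0; apply/hasP; exists m => //; apply/andP; split=> //.
pose P (k : 'I_d.+1) := (1 < k < m.+2)%N.
have sc q : \prod_i \prod_(k | P k) dot (fun j => c (i + q) * l (i + q) j)
      (fun j => s i k * e i k j) =
    (\prod_i \prod_(k | P k) c i * \prod_i \prod_(k | P k) s i k) *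
    \prod_i \prod_(k | P k) dot (l (i + q)) (e i k).
  have -> : \prod_i \prod_(k | P k) c i = \prod_i \prod_(k | P k) c (i + q).
    by rewrite [LHS](reindex_inj (addIr q)).
  rewrite -!big_split; apply: eq_bigr => i _; rewrite /= -!big_split.
  by apply: eq_bigr => k _; rewrite /= dotZl dotZr; ring.
by rewrite !sc mulrCA -mulrBr hm mulr0.
Qed.

Section Edge.
Variables (d : nat) (A : 'I_3 -> mpoly 3 C) (p l : 'I_3 -> vec).
Hypotheses (Af : is_form d A) (Ah : hypform A) (pl : frame p l).
Hypothesis Al : forall i, inv_line A (l i).
Variable i : 'I_3.
Local Notation O := (p (i + 2)).
Local Notation U := (p i).
Local Notation V := (p (i + 1)).

Definition edge_poly : {poly C} := \sum_j lpoly O V (A j) * (U j)%:P.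

Lemma edge_polyE y : edge_poly.[y] = wf A (pt O U V 0 y) U.
Proof.
rewrite /edge_poly horner_sum; apply: eq_bigr => j _; rewrite hornerM lpolyE hornerC.
by congr (_ * _); apply: meval_eq => k; rewrite /pt mul0r addr0.
Qed.

Lemma wf_vertex k w : wf A (p k) w = 0.
Proof.
have e j : dot (l j) (p k) = (j == k)%:R := pl.1 j k.
have wE : wf A (p k) w = dot (l k) w * wf A (p k) (p k) +
    dot (l (k + 1)) w * wf A (p k) (p (k + 1)) + dot (l (k + 2)) w * wf A (p k) (p (k + 2)).
  by rewrite /wf -!dotZr -!dotDr; apply: eq_dot => // j; rewrite [LHS](pl.2 w j) (sum3 _ k).
rewrite wE (wf_euler Af) (Al (i := k + 2)) ?(Al (i := k + 1)) ?e ?pl.1 ?ord3_neq //.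
by rewrite !mulr0 !addr0.
Qed.

(** Vanishing at the two vertices gives the factor ['X] and kills the coefficient of degree [d + 1].
    The value of [q] at 0 is an eigenvalue at a vertex up to sign, nonzero by hyperbolicity. *)
Lemma edge_poly_factor : exists q : {poly C}, [/\ edge_poly = 'X * q, q != 0,
  (size q <= d)%N & q.[0] != 0].
Proof.
have e0 : edge_poly.[0] = 0.
  rewrite edge_polyE (eq_wf A (z' := O) _ (frefl _)) ?wf_vertex // => j.
  by rewrite /pt !mul0r !addr0.
have [q eq] := vanish_factor e0; rewrite subr0 in eq.
have [b bE] := betaE pl Al i.
have q0 : q.[0] != 0.
  have a00 : (wpoly A O U V U).[0%:P].[0] = 0 by exact: (alpha_00 pl Al).
  have := chart_nonres Af Ah pl Al bE a00 (n := 0) (k := 1) isT.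
  rewrite mul0r add0r mul1r -alpha_slice_deriv.
  have -> : slice 0 (wpoly A O U V U) = edge_poly.
    by apply: poly_ext => y; rewrite horner_slice wpolyE edge_polyE.
  by rewrite eq derivM derivX mul1r hornerD hornerM hornerX mul0r addr0.
exists q; split=> //.
  by apply: contraNneq q0 => ->; rewrite horner0.
have qn0 : q != 0 by apply: contraNneq q0 => ->; rewrite horner0.
have sE : (size edge_poly <= d.+2)%N.
  apply: (leq_trans (size_sum _ _ _)); apply/bigmax_leqP => j _.
  rewrite mulrC mul_polyC (leq_trans (size_scale_leq _ _)) //.
  by have [] := lpoly_lead O V (Af.1 j).
have cE : (edge_poly`_d.+1)%R = 0.
  rewrite coef_sum -[RHS](wf_vertex (i + 1) U); apply: eq_bigr => j _.
  by rewrite coefMC; have [_ ->] := lpoly_lead O V (Af.1 j).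
have : (size edge_poly <= d.+1)%N.
  rewrite leqNgt; apply/negP => sl; have se : size edge_poly = d.+2.
    by apply/eqP; rewrite eqn_leq sE.
  have : lead_coef edge_poly != 0 by rewrite lead_coef_eq0 -size_poly_eq0 se.
  by rewrite /lead_coef se cE eqxx.
by rewrite eq mulrC size_mulX.
Qed.

Definition edge_pt (ab : C * C) : vec := fun j => ab.1 * V j + ab.2 * O j.

(** The list consists of the two vertices, the given roots, the remaining roots of the edge
    polynomial with multiplicity, and one more copy of [(1, 0)] for each degree missing in [q]. *)
Lemma edge_data (rs : seq C) : uniq rs ->
  (forall r, r \in rs -> r != 0 /\ wf A (pt O U V 0 r) U = 0) ->
  exists ss : seq (C * C), [/\
    size [:: (1, 0), (0, 1) & [seq (r, 1) | r <- rs] ++ ss] = d.+1,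
    (forall ab, ab \in ss -> (ab.1 != 0) || (ab.2 != 0)) &
    splits A (l i) (fun k : 'I_d.+1 =>
      edge_pt (nth (0, 0) [:: (1, 0), (0, 1) & [seq (r, 1) | r <- rs] ++ ss] k))].
Proof.
move=> urs hrs; have [q [eq q0 sq q00]] := edge_poly_factor.
have qrs : all (root q) rs.
  apply/allP => r /hrs[r0]; rewrite -edge_polyE eq hornerM hornerX => /eqP.
  by rewrite mulf_eq0 (negPf r0).
have urs' : uniq_roots rs by rewrite uniq_rootsE.
have [q' qE] := uniq_roots_prod_XsubC qrs urs'.
have q'0 : q' != 0 by apply: contraNneq q0 => h; rewrite qE h mul0r.
have [ts q'E] := closed_field_poly_normal q'.
pose N := (size rs + size ts)%N.
have sN : size q = N.+1.
  rewrite qE size_Mmonic ?monic_prod_XsubC // size_prod_XsubC q'E.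
  by rewrite size_scale ?lead_coef_eq0 // size_prod_XsubC addSn addnS /= addnC.
have Nd : (N < d)%N by rewrite -sN.
pose c := lead_coef q'.
have epE y : wf A (pt O U V 0 y) U = c * y * \prod_(r <- rs ++ ts) (y - r).
  rewrite -edge_polyE eq qE q'E hornerM hornerX hornerM hornerZ !horner_prod big_cat /= -/c.
  set P := \prod_(_ <- rs) _; set Q := \prod_(_ <- ts) _.
  have -> : \prod_(r <- rs) (y - r) = P by apply: eq_bigr => r _; rewrite hornerXsubC.
  have -> : \prod_(r <- ts) (y - r) = Q by apply: eq_bigr => r _; rewrite hornerXsubC.
  ring.
have QE s t : wf A (edge_pt (s, t)) U =
    c * s * t ^+ (d - N) * \prod_(r <- rs ++ ts) (s - r * t).
  have [->|t0] := eqVneq t 0.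
    rewrite (eq_wf A (z' := fun j => s * V j) _ (frefl _)) => [|j]; last first.
      by rewrite /edge_pt /= mul0r addr0.
    by rewrite (wf_scale _ _ _ Af) wf_vertex expr0n subn_eq0 leqNgt Nd !mulr0 mul0r.
  rewrite (eq_wf A (z' := fun j => t * pt O U V 0 (s / t) j) _ (frefl _)) => [|j]; last first.
    by rewrite /edge_pt /pt /=; field.
  rewrite (wf_scale _ _ _ Af) epE.
  have -> : \prod_(r <- rs ++ ts) (s - r * t) = t ^+ N * \prod_(r <- rs ++ ts) (s / t - r).
    rewrite /N -size_cat -[in t ^+ _]sum1_size -prodrXr -big_split; apply: eq_bigr => r _.
    by rewrite /= expr1; field.
  rewrite -{1}(subnK (ltnW Nd)) -addSn exprD exprS; set P := \prod_(_ <- _) _.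
  move: (t ^+ N) (t ^+ (d - N)) => a b; field; exact: t0.
exists ([seq (t, 1) | t <- ts] ++ nseq (d.-1 - N) (1, 0)); split.
- rewrite /= !size_cat !size_map size_nseq; move: Nd; rewrite /N; move: (size rs) (size ts) => a b; clear; lia.
- move=> ab; rewrite mem_cat => /orP[/mapP[t _ ->]|]; first by rewrite /= oner_eq0 orbT.
  by move=> /nseqP[-> _]; rewrite /= oner_eq0.
set pts := [:: _, _ & _].
have spts : size pts = d.+1.
  by rewrite /= !size_cat !size_map size_nseq; move: Nd; rewrite /N; move: (size rs) (size ts) => a b; clear; lia.
(* Cross products of side equations are vertices, up to this determinant. *)
pose Delta := dot (l (i + 1)) (cross (l (i + 2)) (l i)).
have crossN u v j : cross u v j = - cross v u j by rewrite /cross; ring.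
have cV j : cross (l (i + 1)) (l i) j = - Delta * O j.
  rewrite [LHS](pl.2 _ j) (sum3 _ i) dot_cross2 dot_cross !mul0r !add0r; congr (_ * _).
  rewrite dot_crossA dot_crossA /Delta -mulN1r -dotZr; apply: eq_dot => // k.
  by rewrite mulN1r crossN.
have cO j : cross (l (i + 2)) (l i) j = Delta * V j.
  by rewrite [LHS](pl.2 _ j) (sum3 _ i) dot_cross2 dot_cross !mul0r add0r addr0.
have dV x : dot (l (i + 1)) (cross (l i) x) = - Delta * dot x O.
  by rewrite dot_crossA (eq_dot (frefl x) cV) dotZr.
have dO x : dot (l (i + 2)) (cross (l i) x) = Delta * dot x V.
  by rewrite dot_crossA (eq_dot (frefl x) cO) dotZr.
have ptsP x : \prod_(k < d.+1) dot x (edge_pt (nth (0, 0) pts k)) =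
    dot x V * dot x O * (\prod_(r <- rs ++ ts) (r * dot x V + dot x O)) *
    dot x V ^+ (d.-1 - N).
  have de ab : dot x (edge_pt ab) = ab.1 * dot x V + ab.2 * dot x O.
    by rewrite /edge_pt dotDr !dotZr.
  have -> : \prod_(k < d.+1) dot x (edge_pt (nth (0, 0) pts k)) =
      \prod_(ab <- pts) dot x (edge_pt ab).
    by rewrite (big_nth (0, 0)) spts big_mkord.
  rewrite !big_cons !big_cat !big_map /= big_nseq iter_mulr_1 !de /= !mul0r !mul1r addr0 add0r.
  rewrite -!mulrA; congr (_ * (_ * (_ * (_ * _)))).
  - by apply: eq_bigr => r _; rewrite de mul1r.
  - by apply: eq_bigr => r _; rewrite de mul1r.
have key x n : wf A (cross (l i) x) n = dot (l i) n *
    (c * - Delta * Delta ^+ (d - N) * (- Delta) ^+ N) *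
    \prod_(k < d.+1) dot x (edge_pt (nth (0, 0) pts k)).
  have -> : wf A (cross (l i) x) n = dot (l i) n * wf A (cross (l i) x) U.
    have := Al (i := i) (z := cross (l i) x) (v := fun j => 1 * n j + (- dot (l i) n) * U j).
    rewrite dot_cross dotDr !dotZr pl.1 eqxx mulr1 mul1r subrr wf_lin mul1r mulNr.
    by move=> /(_ erefl erefl)/eqP; rewrite subr_eq0 => /eqP.
  rewrite (eq_wf A (z' := edge_pt (- Delta * dot x O, Delta * dot x V)) _ (frefl _)); last first.
    move=> j; rewrite [LHS](pl.2 _ j) (sum3 _ i) dot_cross mul0r add0r dV dO //.
  rewrite QE ptsP.
  have -> : \prod_(r <- rs ++ ts) (- Delta * dot x O - r * (Delta * dot x V)) =
     (- Delta) ^+ N * \prod_(r <- rs ++ ts) (r * dot x V + dot x O).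
    rewrite /N -size_cat -[in (- Delta) ^+ _]sum1_size -prodrXr -big_split.
    by apply: eq_bigr => r _; rewrite /= expr1; ring.
  have -> : (d - N)%N = (d.-1 - N).+1 by move: Nd; lia.
  rewrite exprMn !exprS; move: (\prod_(_ <- _) _) ((- Delta) ^+ N) (Delta ^+ _) (dot x V ^+ _).
  by move=> *; ring.
move=> x x' n n'; rewrite !key.
move: (\prod_(_ < _) _) (\prod_(_ < _) _) (_ ^+ N) (_ ^+ (d - N)) => *; ring.
Qed.

End Edge.

Section Assemble.
Variables (d : nat) (A : 'I_3 -> mpoly 3 C) (p l : 'I_3 -> vec).
Hypotheses (Af : is_form d A) (Ah : hypform A) (pl : frame p l).
Hypothesis Al : forall i, inv_line A (l i).

(** Both sides through the vertex are invariant, so their directions are isotropic for the quadratic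
    form of the 1-jet, which is then a multiple of the product of the two side equations. *)
Lemma vertex_trace i v v' : jac A (p (i + 1)) v v * (dot (l i) v' * dot (l (i + 2)) v') =
  jac A (p (i + 1)) v' v' * (dot (l i) v * dot (l (i + 2)) v).
Proof.
set z := p (i + 1).
have wz w : wf A z w = 0 by exact: (wf_vertex Af pl Al).
have zr u : jac A z u z = 0 by rewrite (jac_eulerr Af) wz mulr0.
have zl u : jac A z z u = 0 by rewrite (jac_eulerl Af) wz oppr0.
have iso k k' : dot (l k) z = 0 -> dot (l k) (p k') = 0 -> jac A z (p k') (p k') = 0.
  move=> kz kk'; have [P hP <-] := wf_line_deriv A z (p k') (p k').
  suff -> : P = 0 by rewrite deriv0 horner0.
  apply: horner_eq0 => s; rewrite hP; apply: (Al (i := k)) => //.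
  by rewrite dotDr dotZr kz kk' mulr0 addr0.
suff h w : jac A z w w = (jac A z (p i) (p (i + 2)) + jac A z (p (i + 2)) (p i)) *
    (dot (l i) w * dot (l (i + 2)) w) by rewrite !h; ring.
have wE j : w j = dot (l i) w * p i j + dot (l (i + 2)) w * p (i + 2) j + dot (l (i + 1)) w * z j.
  by rewrite [LHS](pl.2 w j) (sum3 _ i) addrAC.
rewrite (eq_jac A z wE wE) jac_lin !jac_linr !zr !zl.
rewrite (iso (i + 2) i) ?pl.1 ?ord3_neq // (iso i (i + 2)) ?pl.1 ?ord3_neq //.
by move: (jac _ _ _ _) (jac _ _ _ _) => *; ring.
Qed.

Lemma limit_data_exists m (rs : 'I_3 -> seq C) : (0 < m)%N -> (m < d)%N ->
  (forall i, [/\ uniq (rs i), size (rs i) = m &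
     forall r, r \in rs i -> wf A (pt (p (i + 2)) (p i) (p (i + 1)) 0 r) (p i) = 0]) ->
  \prod_i \prod_(r <- rs i) - r = 1 ->
  exists e : 'I_3 -> 'I_d.+1 -> vec,
    (forall i k, exists j, e i k j != 0) /\ limit_data A l e.
Proof.
move=> m0 md hrs prs.
have rs0 i r : r \in rs i -> r != 0.
  move=> ri; apply: contra_eq_neq prs => /= r0; rewrite (bigD1 i) //=.
  have -> : \prod_(r <- rs i) - r = 0.
    by apply/eqP; rewrite prodf_seq_eq0; apply/hasP; exists r => //=; rewrite r0 oppr0.
  by rewrite mul0r eq_sym oner_eq0.
pose P i (ss : seq (C * C)) := [/\
    size [:: (1, 0), (0, 1) & [seq (r, 1) | r <- rs i] ++ ss] = d.+1,
    (forall ab, ab \in ss -> (ab.1 != 0) || (ab.2 != 0)) &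
    splits A (l i) (fun k : 'I_d.+1 =>
      edge_pt p i (nth (0, 0) [:: (1, 0), (0, 1) & [seq (r, 1) | r <- rs i] ++ ss] k))].
have [ss hss] : {ss & forall i, P i (ss i)}.
  apply: boolp.choice => i; have [ui _ ri] := hrs i.
  by apply: (edge_data Af Ah pl Al ui) => r hr; split; [exact: rs0 hr|exact: ri].
pose pts i := [:: (1, 0), (0, 1) & [seq (r, 1) | r <- rs i] ++ ss i].
exists (fun i k => edge_pt p i (nth (0, 0) (pts i) k)).
have d1 i ab : dot (l (i + 1)) (edge_pt p i ab) = ab.1.
  by rewrite /edge_pt dotDr !dotZr !pl.1 !ord3_neq eqxx mulr1 mulr0 addr0.
have d2 i ab : dot (l (i + 2)) (edge_pt p i ab) = ab.2.
  by rewrite /edge_pt dotDr !dotZr !pl.1 !ord3_neq eqxx mulr1 mulr0 add0r.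
have i1 : (inord 1 : 'I_d.+1) = 1%N :> nat by rewrite inordK //; lia.
split=> [i k|].
  have : nth (0, 0) (pts i) k \in pts i.
    by apply: mem_nth; have [-> _ _] := hss i; exact: ltn_ord.
  set ab := nth _ _ _ => hab.
  have ab0 : (ab.1 != 0) || (ab.2 != 0).
    move: hab; rewrite !inE mem_cat => /or4P[/eqP ->|/eqP ->|/mapP[r _ ->]|].
    - by rewrite oner_eq0.
    - by rewrite oner_eq0 orbT.
    - by rewrite /= oner_eq0 orbT.
    by have [_ h _] := hss i; exact: h.
  case/orP: ab0 => h.
    have : dot (edge_pt p i ab) (l (i + 1)) != 0 by rewrite dotC d1.
    exact: dot1_neq0.
  have : dot (edge_pt p i ab) (l (i + 2)) != 0 by rewrite dotC d2.
  exact: dot1_neq0.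
split.
- by move=> i k; rewrite /edge_pt dotDr !dotZr !pl.1 !ord3_neq !mulr0 addr0.
- by move=> i; rewrite d1 d2 i1.
- by move=> i; have [] := hss i.
- move=> i v v'.
  have e0 : edge_pt p i (nth (0, 0) (pts i) (ord0 : 'I_d.+1)) =1 (fun j => 1 * p (i + 1) j).
    by move=> j; rewrite /edge_pt /= mul0r addr0.
  have jE w : jac A (edge_pt p i (nth (0, 0) (pts i) (ord0 : 'I_d.+1))) w w = jac A (p (i + 1)) w w.
    rewrite -[RHS]mul1r -(expr1n _ d) -(jac_scale _ _ _ _ Af).
    by apply: eq_bigr => j _; apply: eq_bigr => k _; rewrite (meval_eq _ e0).
  by rewrite !jE vertex_trace.
apply/eqP; rewrite prodf_seq_eq0; apply/hasP; exists m; first by rewrite mem_index_iota m0.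
have rng i (f : C * C -> C) : \prod_(k < d.+1 | (1 < k < m.+2)%N) f (nth (0, 0) (pts i) k) =
    \prod_(r <- rs i) f (r, 1).
  have [_ sm _] := hrs i.
  rewrite -(big_mkord (fun k => 1 < k < m.+2)%N (fun k => f (nth (0, 0) (pts i) k))).
  have -> : index_iota 0 d.+1 = iota 0 2 ++ iota 2 m ++ iota (2 + m) (d - m.+1).
    by rewrite -!iotaD /index_iota; congr iota; move: md; clear; lia.
  rewrite !big_cat /= [X in X * _]big1_seq ?mul1r => [|k]; last first.
    by rewrite !inE => /andP[/andP[k1 _]] /orP[]/eqP e; rewrite e in k1.
  rewrite [X in _ * X]big1_seq ?mulr1 => [|k]; last first.
    by rewrite mem_iota => /andP[/andP[_ k1] /andP[k2 _]]; move: (leq_trans k1 k2); rewrite ltnn.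
  rewrite [RHS](big_nth 0) sm /index_iota subn0.
  have -> : iota 2 m = [seq (2 + k)%N | k <- iota 0 m] by rewrite -iotaDl.
  rewrite big_map big_seq_cond.
  rewrite [RHS]big_seq; apply: eq_big => [k|k]; rewrite mem_iota add0n.
    by rewrite !ltnS andbC; case: (k < m)%N; rewrite ?andbF //= addnC.
  rewrite leq0n andTb => /andP[km _]; congr f; rewrite /pts /= nth_cat size_map sm km.
  by rewrite (nth_map 0) // sm.
rewrite /= subr_eq0; apply/eqP.
have e1 : \prod_i \prod_(k < d.+1 | (1 < k < m.+2)%N)
    dot (l (i + 1)) (edge_pt p i (nth (0, 0) (pts i) k)) = \prod_i \prod_(r <- rs i) r.
  by apply: eq_bigr => i _; rewrite -(rng i fst); apply: eq_bigr => k _; rewrite d1.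
have e2 : \prod_i \prod_(k < d.+1 | (1 < k < m.+2)%N)
    dot (l (i + 2)) (edge_pt p i (nth (0, 0) (pts i) k)) = 1.
  rewrite big1 // => i _; transitivity (\prod_(r <- rs i) (1 : C)); last by rewrite big1.
  by rewrite -(rng i snd); apply: eq_bigr => k _; rewrite d2.
(* Carnot's product has one sign for each of the [3 m] points, and [(-1)^(3 m) = (-1)^m]. *)
rewrite e1 e2 mulr1; have sgn : ((-1) ^+ m) ^+ 3 * \prod_i \prod_(r <- rs i) r = 1 :> C.
  rewrite -[RHS]prs; have -> : ((-1) ^+ m) ^+ 3 = \prod_(i < 3) (-1) ^+ m :> C.
    by rewrite prodr_const card_ord.
  rewrite -big_split; apply: eq_bigr => i _; have [_ <- _] := hrs i.
  rewrite /= -[in (-1) ^+ _]sum1_size -prodrXr -big_split; apply: eq_bigr => r _.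
  by rewrite /= expr1 mulN1r.
have s0 : ((-1) ^+ m) ^+ 3 != 0 :> C by rewrite !expf_neq0 // oppr_eq0 oner_eq0.
apply: (mulfI s0); rewrite sgn -exprM -exprD.
have -> : (m * 3 + m = 2 * (2 * m))%N by lia.
by rewrite exprM sqrrN expr1n expr1n.
Qed.

End Assemble.
End LimitDataExists.

(** * Perturbation of one side *)

Section Perturbation.
Variable C : numClosedFieldType.
Local Notation vec := ('I_3 -> C).
Implicit Types (x z u v w n : vec).
Variables (d : nat) (A : 'I_3 -> mpoly 3 C) (p l : 'I_3 -> vec).
Hypotheses (d2 : (2 <= d)%N) (Af : is_form d A) (Ah : hypform A) (pl : frame p l).
Hypothesis Al : forall i, inv_line A (l i).
Local Notation LX := (lform (l 0)).
Local Notation LY := (lform (l 1)).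
Local Notation LZ := (lform (l 2)).
Local Notation e := (edge_poly A p 0).

(** Chosen so that [1 + t] times the new edge polynomial at [y] is the old one at [(1 + t) y]. The
    linear coefficient is unchanged, which is why the sum in [pert] starts at [j = 1]. *)
Definition pert_coef j t : C := (e`_j.+1)%R * ((1 + t) ^+ j - 1).

(* The form X Y Z (D dX/X + E dY/Y - (D + E) dZ/Z), where D is the change of the
   edge polynomial on X = 0 and E = - c Y^(d-1) restores the one on Z = 0. *)
Definition pert_dir j k : mpoly 3 C :=
  LY ^+ j.+1 * LZ ^+ (d.-1 - j) * (l 0 k *: LZ - l 2 k *: LX).
Definition pert_fix k : mpoly 3 C :=
  LY ^+ d.-1 * LX * (l 1 k *: LZ - l 2 k *: LY).

Definition pert t k : mpoly 3 C :=
  A k + \sum_(1 <= j < d) pert_coef j t *: pert_dir j k - pert_coef d.-1 t *: pert_fix k.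

Lemma wf_pert t z v : wf (pert t) z v = wf A z v +
  \sum_(1 <= j < d) pert_coef j t * (dot (l 1) z ^+ j.+1 * dot (l 2) z ^+ (d.-1 - j) *
     (dot (l 2) z * dot (l 0) v - dot (l 0) z * dot (l 2) v)) -
  pert_coef d.-1 t * (dot (l 1) z ^+ d.-1 * dot (l 0) z *
     (dot (l 2) z * dot (l 1) v - dot (l 1) z * dot (l 2) v)).
Proof.
have ev i : meval z (lform (l i)) = dot (l i) z by exact: meval_lform.
have lin (a b : C) i i' : a * dot (l i) v - b * dot (l i') v =
    \sum_k (l i k * a - l i' k * b) * v k.
  by rewrite /dot !mulr_sumr -sumrB; apply: eq_bigr => k _; ring.
rewrite {1}/wf {1}/dot; under eq_bigr do rewrite mevalB mevalD mulrBl mulrDl.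
rewrite sumrB big_split /=; congr (_ + _ - _).
  under eq_bigr do rewrite (linear_sum (meval z)) mulr_suml /=.
  rewrite exchange_big /=; apply: eq_bigr => j _; rewrite lin mulrA mulr_sumr.
  apply: eq_bigr => k _; rewrite mevalZ !mevalM !rmorphXn /= mevalB !mevalZ !ev.
  by rewrite !mulrA.
rewrite lin mulrA mulr_sumr; apply: eq_bigr => k _.
by rewrite /pert_fix mevalZ 2!mevalM rmorphXn /= mevalB !mevalZ !ev !mulrA.
Qed.

Lemma pert_is_form t : is_form d (pert t).
Proof.
have hl i : lform (l i) \is @ishomog1 3 C 1 mdeg by exact: lform_homog.
have hX i k : lform (l i) ^+ k \is @ishomog1 3 C k mdeg.
  by have := dhomogMn k (hl i); rewrite mul1n.
have hlin a b i i' : (a *: lform (l i) - b *: lform (l i')) \is @ishomog1 3 C 1 mdeg.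
  by apply: rpredB; apply: dhomogZ.
split=> [k|].
  apply: rpredB; first apply: rpredD; first by have [h _] := Af; exact: h.
    rewrite big_nat; apply: rpred_sum => j /andP[j1 jd]; apply: dhomogZ.
    have -> : d.+1 = (j.+1 + (d.-1 - j) + 1)%N by lia.
    exact: (dhomogM (dhomogM (hX _ _) (hX _ _)) (hlin _ _ _ _)).
  apply: dhomogZ; have -> : d.+1 = (d.-1 + 1 + 1)%N by lia.
  exact: (dhomogM (dhomogM (hX _ _) (hl _)) (hlin _ _ _ _)).
apply: meval_inf => z; rewrite raddf_sum /=.
transitivity (wf (pert t) z z).
  by apply: eq_bigr => k _; rewrite mevalM mevalXU mulrC.
rewrite wf_pert (wf_euler Af) add0r big1 => [|j _]; first by rewrite [dot (l 2) z * _]mulrC; ring.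
by rewrite [dot (l 2) z * _]mulrC subrr !mulr0.
Qed.

Lemma pert_inv t i : inv_line (pert t) (l i).
Proof.
move=> z v lz lv; rewrite wf_pert (Al lz lv) add0r.
have cases : [\/ i = 0, i = 1 | i = 2].
  by case: i {lz lv} => [[|[|[|//]]] hi]; [apply: Or31|apply: Or32|apply: Or33]; exact: val_inj.
case: cases lz lv => -> lz lv; rewrite lz lv ?expr0n ?mulr0 ?mul0r ?subrr ?mulr0 ?subr0.
- by rewrite big1 // => j _; rewrite !mulr0.
- by rewrite big1 // => j _; rewrite expr0n /= !mul0r mulr0.
- by rewrite big1 // => j _; rewrite !mulr0.
Qed.

Lemma pert0 k : pert 0 k = A k.
Proof.
have c0 j : pert_coef j 0 = 0 by rewrite /pert_coef addr0 expr1n subrr mulr0.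
by rewrite /pert c0 scale0r subr0 big1 ?addr0 // => j _; rewrite c0 scale0r.
Qed.

Lemma pert_edge0 t y :
  (1 + t) * wf (pert t) (pt (p 2) (p 0) (p 1) 0 y) (p 0) = e.[(1 + t) * y].
Proof.
have [q [eq q0 sq _]] := edge_poly_factor Af Ah pl Al 0.
have eE s : e.[s] = \sum_(0 <= j < d) e`_j.+1 * s ^+ j.+1.
  rewrite big_mkord (@horner_coef_wide _ d.+1) ?big_ord_recl /=.
    by rewrite eq coefXM mul0r add0r.
  by rewrite eq mulrC size_mulX.
set P := pt _ _ _ _ _.
have dl i : dot (l i) P = (i == 2)%:R + y * (i == 1)%:R.
  by rewrite !dotDr !dotZr !pl.1 mul0r addr0.
have l0 : dot (l 0) P = 0 by rewrite dl mulr0 addr0.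
have l1 : dot (l 1) P = y by rewrite dl mulr1 add0r.
have l2 : dot (l 2) P = 1 by rewrite dl mulr0 addr0.
have u0 : dot (l 0) (p 0) = 1 by rewrite pl.1.
have u1 : dot (l 1) (p 0) = 0 by rewrite pl.1.
have u2 : dot (l 2) (p 0) = 0 by rewrite pl.1.
have wA : wf A P (p 0) = e.[y].
  by have := edge_polyE A p 0 y; rewrite !add0r => ->.
rewrite wf_pert wA l0 l1 l2 u0 u1 u2 !mulr0 mul0r mulr0 !subr0 mulr1.
under eq_big_nat do rewrite expr1n !mulr1.
have d0 : (0 < d)%N by lia.
rewrite !eE !(big_ltn d0) expr1 expr1 -addrA -big_split /= mulrDr mulr_sumr.
congr (_ + _); first by rewrite mulrCA.
apply: eq_big_nat => j _; rewrite /pert_coef exprMn [(1 + t) ^+ j.+1]exprS; ring.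
Qed.

Lemma pert_edge t i y : i != 0 ->
  wf (pert t) (pt (p (i + 2)) (p i) (p (i + 1)) 0 y) (p i) =
  wf A (pt (p (i + 2)) (p i) (p (i + 1)) 0 y) (p i).
Proof.
set P := pt _ _ _ _ _ => i0.
have dl k : dot (l k) P = (k == i + 2)%:R + y * (k == i + 1)%:R.
  by rewrite !dotDr !dotZr !pl.1 mul0r addr0.
have e12 : (1 + 2 = 0 :> 'I_3) by exact: val_inj.
have e11 : (1 + 1 = 2 :> 'I_3) by exact: val_inj.
have e22 : (2 + 2 = 1 :> 'I_3) by exact: val_inj.
have e21 : (2 + 1 = 0 :> 'I_3) by exact: val_inj.
have cases : i = 1 \/ i = 2.
  by case: i i0 {P dl} => [[|[|[|//]]] hi] // _; [left|right]; exact: val_inj.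
rewrite wf_pert -[RHS]addr0 -addrA; congr (_ + _).
case: cases dl => -> dl.
  have l1 : dot (l 1) P = 0 by rewrite dl e12 e11 mulr0 addr0.
  have u2 : dot (l 2) (p 1) = 0 by rewrite pl.1.
  have d1 : (d.-1 == 0)%N = false by lia.
  rewrite l1 expr0n d1 !mul0r mulr0 subr0 big1 // => j _.
  by rewrite expr0n /= !mul0r mulr0.
have l0 : dot (l 0) P = y by rewrite dl e22 e21 mulr1 add0r.
have l1 : dot (l 1) P = 1 by rewrite dl e22 e21 mulr0 addr0.
have l2 : dot (l 2) P = 0 by rewrite dl e22 e21 mulr0 addr0.
have u2 : dot (l 2) (p 2) = 1 by rewrite pl.1.
rewrite l0 l1 l2 u2 !expr1n !mul1r !mul0r !sub0r mulr1.
have -> : d = d.-1.+1 by lia.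
rewrite big_nat_recr /=; last by lia.
rewrite expr1n subnn expr0 !mul1r big_nat big1 ?add0r; last first.
  by move=> j /andP[_ jd]; rewrite expr0n subn_eq0 leqNgt jd !(mulr0, mul0r).
by rewrite mulrN1 mulrN subrr.
Qed.

Lemma pert_neq0 t : exists k, pert t k != 0.
Proof.
apply: contrapT => /forallNP h; have [q [eq q0 _ _]] := edge_poly_factor Af Ah pl Al 1.
have : edge_poly A p 1 = 0.
  apply: horner_eq0 => y; rewrite edge_polyE -(pert_edge t) //.
  rewrite /wf /dot big1 // => k _.
  by have /negP/negPn/eqP -> := h k; rewrite meval0 mul0r.
by rewrite eq => /eqP; rewrite mulf_eq0 polyX_eq0 (negPf q0).
Qed.

Lemma edge_root_list i : exists ul : seq C, uniq ul /\
  forall r, wf A (pt (p (i + 2)) (p i) (p (i + 1)) 0 r) (p i) = 0 -> r \in ul.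
Proof.
have [q [eq q0 _ _]] := edge_poly_factor Af Ah pl Al i.
have e0 : edge_poly A p i != 0 by rewrite eq mulf_neq0 // polyX_eq0.
have [rl eE] := closed_field_poly_normal (edge_poly A p i).
exists (undup rl); split=> [|r]; first exact: undup_uniq.
rewrite -edge_polyE mem_undup => er.
have : root (edge_poly A p i) r by apply/eqP.
by rewrite eE rootZ ?lead_coef_eq0 // root_prod_XsubC.
Qed.

(** Any choice of distinct singular points on a side is a subset of one fixed list, so only finitely
    many products occur. *)
Lemma uniq_prod_subset (ul s : seq C) : uniq ul -> uniq s -> {subset s <= ul} ->
  exists S : {set 'I_(size ul)}, \prod_(r <- s) - r = \prod_(k in S) - ul`_k.
Proof.
move=> uul us sub; exists [set k : 'I_(size ul) | ul`_k \in s].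
rewrite (eq_bigl (fun k : 'I_(size ul) => ul`_k \in s)) => [|k]; last by rewrite inE.
rewrite -(big_mkord (fun k => ul`_k \in s) (fun k => - ul`_k)).
rewrite -(big_nth 0 (fun r => r \in s) (fun r => - r)) -[RHS]big_filter; apply: perm_big.
apply: uniq_perm => // [|r]; first exact: filter_uniq.
by rewrite mem_filter; case: (boolP (r \in s)) => // /sub ->.
Qed.

(** The roots on side 0 are divided by [1 + t] and the others stay, so a relation with [m] points
    per side says that [(1 + t)^m] is a product of old roots up to sign. [B] multiplies all these
    equations, together with [1 + t] to keep the scaling invertible. *)
Lemma pert_good : exists B : {poly C}, B != 0 /\ forall t, B.[t] != 0 -> good (pert t) p.
Proof.
have [u0 [uu0 h0]] := edge_root_list 0; have [u1 [uu1 h1]] := edge_root_list 1.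
have [u2 [uu2 h2]] := edge_root_list 2.
pose pr (ul : seq C) (S : {set 'I_(size ul)}) := \prod_(k in S) - ul`_k.
pose b S0 S1 S2 m : {poly C} := (1 + 'X) ^+ m - (@pr u0 S0 * @pr u1 S1 * @pr u2 S2)%:P.
pose B := (1 + 'X) * \prod_S0 \prod_S1 \prod_S2 \prod_(m < size u0) b S0 S1 S2 m.+1.
have X1 (t : C) : (1 + 'X : {poly C}).[t] = 1 + t by rewrite hornerD hornerX hornerC.
exists B; split.
  have X0 : 1 + 'X != 0 :> {poly C}.
    apply/eqP => e1; have := congr1 (fun q : {poly C} => q.[0]) e1.
    by rewrite X1 horner0 addr0 => /eqP; rewrite oner_eq0.
  rewrite mulf_neq0 //; apply/prodf_neq0 => S0 _; apply/prodf_neq0 => S1 _.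
  apply/prodf_neq0 => S2 _; apply/prodf_neq0 => m _; rewrite subr_eq0; apply/eqP => e1.
  (* A power of [1 + 'X] with positive exponent is no constant: its values at 0 and -1 differ. *)
  have := congr1 (fun q : {poly C} => q.[-1]) e1; have := congr1 (fun q : {poly C} => q.[0]) e1.
  rewrite !horner_exp !X1 !hornerC addrN addr0 expr1n expr0n /= => <- /eqP.
  by rewrite eq_sym oner_eq0.
move=> t; rewrite hornerM mulf_eq0 negb_or X1 => /andP[t1 Bt] m rs m0 hrs.
apply/eqP => prs.
have [un0 sz0 rt0] := hrs 0; have [un1 sz1 rt1] := hrs 1; have [un2 sz2 rt2] := hrs 2.
pose s0 := [seq (1 + t) * r | r <- rs 0].
have us0 : uniq s0 by rewrite map_inj_uniq //; exact: mulfI.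
have sub0 : {subset s0 <= u0}.
  move=> _ /mapP[r /rt0 + ->]; rewrite !add0r => rt; apply: h0.
  have := edge_polyE A p 0 ((1 + t) * r); rewrite !add0r => <-.
  by rewrite -pert_edge0 rt mulr0.
have sub1 : {subset rs 1 <= u1} by move=> r /rt1; rewrite pert_edge // => /h1.
have sub2 : {subset rs 2 <= u2} by move=> r /rt2; rewrite pert_edge // => /h2.
have [S0 e0] := uniq_prod_subset uu0 us0 sub0.
have [S1 e1] := uniq_prod_subset uu1 un1 sub1.
have [S2 e2] := uniq_prod_subset uu2 un2 sub2.
have sm : (m <= size u0)%N by rewrite -sz0 -(size_map ( *%R (1 + t))) uniq_leq_size.
have s0E : \prod_(r <- s0) - r = (1 + t) ^+ m * \prod_(r <- rs 0) - r.
  rewrite big_map -sz0 -[in (1 + t) ^+ _]sum1_size -prodrXr -big_split.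
  by apply: eq_bigr => r _; rewrite /= expr1 mulrN.
move/negP: Bt; apply; rewrite horner_prod prodf_seq_eq0; apply/hasP.
exists S0; first by rewrite mem_index_enum.
rewrite /= horner_prod prodf_seq_eq0; apply/hasP; exists S1; first by rewrite mem_index_enum.
rewrite /= horner_prod prodf_seq_eq0; apply/hasP; exists S2; first by rewrite mem_index_enum.
rewrite /= horner_prod prodf_seq_eq0; apply/hasP.
have m1 : (m.-1 < size u0)%N by rewrite prednK.
exists (Ordinal m1); first by rewrite mem_index_enum.
rewrite /= prednK // /b hornerD hornerN horner_exp X1 hornerC subr_eq0; apply/eqP.
rewrite /pr -e0 -e1 -e2 s0E -!mulrA.
have <- : \prod_i \prod_(r <- rs i) - r =
  \prod_(r <- rs 0) - r * (\prod_(r <- rs 1) - r * \prod_(r <- rs 2) - r).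
  rewrite !big_ord_recl big_ord0 mulr1; congr (_ * (_ * _)); congr (\prod_(r <- rs _) _); exact: val_inj.
by rewrite prs mulr1.
Qed.

End Perturbation.

(** * Common factors, linear parts and root estimates *)

Section LocalAlgebra.
Variable C : numClosedFieldType.
Local Notation vec := ('I_3 -> C).
Implicit Types (a b h : {poly {poly C}}) (x y t : C).

(** The cofactors of every common factor through the point vanish there as well, a property that a
    tangent field with invertible linear part will force. The multiplier [c] absorbs the
    denominators in [x] of a gcd over C(x). *)
Definition transverse a b x0 y0 := forall (c : {poly C}) h a1 b1,
  slice x0 h != 0 -> h.[y0%:P].[x0] = 0 -> c *: a = h * a1 -> c *: b = h * b1 ->
  a1.[y0%:P].[x0] = 0 /\ b1.[y0%:P].[x0] = 0.

(* A common factor h of a and b vanishes somewhere off the zeros of the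
   cofactors a / h, b / h. *)
Lemma transverse_bezout a b : (a != 0) || (b != 0) ->
  (forall x0 y0, a.[y0%:P].[x0] = 0 -> b.[y0%:P].[x0] = 0 -> transverse a b x0 y0) ->
  exists u w (r : {poly C}), r != 0 /\ u * a + w * b = r%:P.
Proof.
move=> ab0 tr; set h := gcdp a b.
have h0 : h != 0 by rewrite gcdp_eq0 negb_and.
have [[u w]/= /eqpP[[c3 c4] /andP[/= c30 c40] e]] := Bezoutp a b; rewrite -/h in e.
have [sh|sh] := leqP (size h) 1.
  have /size_poly1P[r r0 er] : size h == 1%N.
    by rewrite eqn_leq sh lt0n size_poly_eq0.
  exists (c3 *: u), (c3 *: w), (c4 * r); split; first by rewrite mulf_neq0.
  by rewrite -!scalerAl -scalerDr e er -mul_polyC polyCM.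
have /Pdiv.Idomain.dvdpP[[c1 q1]/= c10 ea] := dvdp_gcdl a b.
have /Pdiv.Idomain.dvdpP[[c2 q2]/= c20 eb] := dvdp_gcdr a b.
rewrite -/h in ea eb.
have rE : (c3 * c2) *: (u * q1) + (c3 * c1) *: (w * q2) = (c1 * c2 * c4)%:P.
  apply: (mulIf h0); rewrite mulrDl -!scalerAl -!mulrA -ea -eb.
  transitivity ((c1 * c2)%:P * (c3 *: (u * a + w * b))).
    by rewrite -!mul_polyC !polyCM; ring.
  by rewrite e -mul_polyC !polyCM; ring.
pose R := c1 * c2 * c4 * lead_coef h.
have [x0 Rx] : exists x0, R.[x0] != 0.
  by apply: poly_nonroot; rewrite !mulf_neq0 ?lead_coef_eq0.
have sh' : size (slice x0 h) = size h.
  rewrite /slice size_map_poly_id0 //; apply: contra Rx => /eqP l0.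
  by rewrite hornerM [(lead_coef h).[x0]]l0 mulr0.
have [y0 y0h] : exists y0, root (slice x0 h) y0.
  have [|c [q ->]] := @closed_rootP C (slice x0 h); first by rewrite sh'.
  by exists c; rewrite rootM root_XsubC eqxx.
have h00 : h.[y0%:P].[x0] = 0 by rewrite -horner_slice; exact/eqP.
have sh0 : slice x0 h != 0 by rewrite -size_poly_eq0 sh' -lt0n (ltn_trans _ sh).
have [[c1x c2x] rx] : (c1.[x0] != 0 /\ c2.[x0] != 0) /\ (c1 * c2 * c4).[x0] != 0.
  move: Rx; rewrite hornerM mulf_eq0 negb_or => /andP[h1 _]; split=> //.
  by move: h1; rewrite !hornerM !mulf_eq0 !negb_or => /andP[/andP[]].
have zero q (c : {poly C}) (f : {poly {poly C}}) : c.[x0] != 0 -> c *: f = q * h -> f.[y0%:P].[x0] = 0.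
  move=> cx /(congr1 (fun g : {poly {poly C}} => g.[y0%:P].[x0])).
  rewrite hornerZ hornerM hornerM hornerM h00 mulr0 => /eqP.
  by rewrite mulf_eq0 (negPf cx) => /eqP.
have := tr x0 y0 (zero _ _ _ c1x ea) (zero _ _ _ c2x eb) (c1 * c2) h (c2 *: q1) (c1 *: q2) sh0 h00.
case.
- by rewrite mulrC -scalerA ea -scalerAr mulrC.
- by rewrite -scalerA eb -scalerAr mulrC.
rewrite !hornerZ !hornerM => /eqP z1 /eqP z2.
move: z1 z2; rewrite !mulf_eq0 (negPf c1x) (negPf c2x) /= => /eqP z1 /eqP z2.
have := congr1 (fun g : {poly {poly C}} => g.[y0%:P].[x0]) rE.
rewrite hornerD hornerZ hornerZ hornerM hornerM hornerC.
rewrite hornerD !hornerM z1 z2 !mulr0 addr0 => r0.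
by move: rx; rewrite !hornerM -r0 eqxx.
Qed.

(** With [M] the matrix of the [m]'s, the pair of linear forms is orthogonal to [v M] for every [v],
    hence is [g] times a quarter turn of [v M]. Evaluation at three vectors suffices. *)
Lemma jet_relation (ax ay bx by' m00 m01 m10 m11 : C) :
  m00 * m11 - m01 * m10 != 0 ->
  (forall v0 v1, (ax * v0 + ay * v1) * (v0 * m00 + v1 * m10) +
                 (bx * v0 + by' * v1) * (v0 * m01 + v1 * m11) = 0) ->
  exists g, [/\ ax = g * m01, bx = - (g * m00), ay = g * m11 & by' = - (g * m10)].
Proof.
set D := _ - _ => D0 h.
have h1 := h 1 0; have h2 := h 0 1; have h3 := h 1 1.
rewrite !(mulr1, mulr0, mul1r, mul0r, addr0, add0r) in h1 h2 h3.
have h4 : ax * m10 + bx * m11 + (ay * m00 + by' * m01) = 0.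
  transitivity ((ax + ay) * (m00 + m10) + (bx + by') * (m01 + m11) -
    (ax * m00 + bx * m01) - (ay * m10 + by' * m11)); first by ring.
  by rewrite h1 h2 h3 !subr0.
have h5 : ax * m10 + bx * m11 = - (ay * m00 + by' * m01) by apply/eqP; rewrite -addr_eq0 h4.
pose g := - (ax * m10 + bx * m11) / D; have gD : g * D = - (ax * m10 + bx * m11) by rewrite divfK.
have e1 : ax * m00 = - (bx * m01) by apply/eqP; rewrite -addr_eq0 h1.
have e2 : ay * m10 = - (by' * m11) by apply/eqP; rewrite -addr_eq0 h2.
exists g; split; apply: (mulIf D0).
- rewrite mulrAC gD /D mulrBr !mulrA e1; ring.
- rewrite mulNr mulrAC gD /D; transitivity ((ax * m00) * m10 + bx * m00 * m11); last by ring.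
  rewrite e1; ring.
- rewrite mulrAC gD h5 opprK /D; transitivity (ay * m00 * m11 - (ay * m10) * m01); first by ring.
  rewrite e2; ring.
- rewrite mulNr mulrAC gD h5 opprK /D; transitivity (- ((ay * m10) * m00 + by' * m01 * m10)); last by ring.
  rewrite e2; ring.
Qed.

Lemma order_factor2 a b : (a != 0) || (b != 0) -> exists n (a' b' : {poly {poly C}}),
  [/\ a = 'X^n * a', b = 'X^n * b' & (a'.[0] != 0) || (b'.[0] != 0)].
Proof.
have [k] := ubnP (size a + size b); elim: k a b => // k IH a b sk ab0.
have [h|] := boolP ((a.[0] != 0) || (b.[0] != 0)).
  by exists 0%N, a, b; rewrite !mul1r.
rewrite negb_or !negbK => /andP[a0 b0].
have fac (f : {poly {poly C}}) : f.[0] == 0 -> exists2 q, f = 'X * q & f != 0 -> (size q < size f)%N.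
  move=> /factor_theorem[q ->]; exists q; first by rewrite subr0 mulrC.
  rewrite subr0 => qX; have q0 : q != 0 :> {poly {poly C}} by apply: contraNneq qX => ->; rewrite mul0r.
  by rewrite size_mulX.
have [a1 ea sa] := fac a a0; have [b1 eb sb] := fac b b0.
have le (f q : {poly {poly C}}) : f = 'X * q -> (size q <= size f)%N.
  by move=> ->; have [->|q0] := eqVneq q 0; rewrite ?mulr0 // mulrC size_mulX.
have [||n [a' [b' [ea' eb' h]]]] := IH a1 b1.
- move: sk (le _ _ ea) (le _ _ eb); case/orP: ab0 => [/sa|/sb] {IH ea eb sa sb};
    move: (size a) (size b) (size a1) (size b1) => *; lia.
- by move: ab0; rewrite ea eb !mulf_eq0 !polyX_eq0.
by exists n.+1, a', b'; rewrite ea eb ea' eb' exprS !mulrA.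
Qed.

(** Factor by factor: [|s - r| <= |r| (1 + |s| / e)] as soon as [|r| >= e]. *)
Lemma root_bound (P : {poly C}) (N : nat) (e s : C) : 0 < e -> (size P <= N.+1)%N ->
  (forall r, root P r -> e <= `|r|) -> `|P.[s]| <= `|P.[0]| * (1 + `|s| / e) ^+ N.
Proof.
move=> e0 sP h; have [->|P0] := eqVneq P 0; first by rewrite !horner0 normr0 mul0r.
have [rs PE] := closed_field_poly_normal P.
have srs : (size rs <= N)%N.
  by move: sP; rewrite PE size_scale ?lead_coef_eq0 // size_prod_XsubC.
have hr r : r \in rs -> e <= `|r|.
  by move=> rin; apply: h; rewrite PE rootZ ?lead_coef_eq0 // root_prod_XsubC.
have B1 : 1 <= 1 + `|s| / e by rewrite lerDl divr_ge0 // ltW.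
rewrite PE !hornerZ !normrM -mulrA ler_wpM2l //.
apply: le_trans (ler_wpM2l (normr_ge0 _) (ler_weXn2l B1 srs)).
rewrite !horner_prod !normr_prod; elim: rs {PE srs} hr => [|r rs IH] hr.
  by rewrite !big_nil mulr1.
rewrite !big_cons !hornerXsubC sub0r normrN /= exprS mulrACA ler_pM ?prodr_ge0 //.
  rewrite (le_trans (ler_normB _ _)) // mulrDr mulr1 addrC lerD2l mulrCA ler_peMr //.
  by rewrite ler_pdivlMr // mul1r hr ?mem_head.
by apply: IH => t tin; apply: hr; rewrite inE tin orbT.
Qed.

End LocalAlgebra.

(** * Linear forms, frames, rescaling of the 1-form *)

Section Lines.
Variable C : numClosedFieldType.
Local Notation vec := ('I_3 -> C).
Implicit Types (A : 'I_3 -> mpoly 3 C) (p l : 'I_3 -> vec) (F : mpoly 3 C).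

Lemma homog1_lform F : F \is @ishomog1 3 C 1 mdeg -> exists v, F = lform v.
Proof.
move=> F1; exists (fun k => meval (fun=> 0) (mderiv k F)); apply: meval_inj => z.
rewrite meval_lform -[LHS]mul1r -(euler z F1); apply: eq_bigr => k _; congr (_ * _).
have := meval_homog 0 z (mderiv_homog k F1); rewrite expr0 mul1r => <-.
by apply: meval_eq => j; rewrite mul0r.
Qed.

Lemma frame_exists l : (forall z, (forall i, dot (l i) z = 0) -> forall j, z j = 0) ->
  exists p, frame p l.
Proof.
move=> gp; pose L : 'M[C]_3 := \matrix_(i, j) l i j.
have uL : L \in unitmx.
  rewrite unitmxE unitfE -det_tr; apply/negP => /det0P[v v0 vL].
  move/eqP: v0; apply; apply/rowP => j; rewrite mxE; apply: (gp (fun j => v 0 j)) => i.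
  have := congr1 (fun w : 'rV[C]_3 => w 0 i) vL; rewrite !mxE => e; rewrite -[RHS]e.
  by apply: eq_bigr => k _; rewrite !mxE mulrC.
exists (fun k j => invmx L j k); split=> [i k|z j].
  have := congr1 (fun M : 'M[C]_3 => M i k) (mulmxV uL); rewrite !mxE => <-.
  by apply: eq_bigr => m _; rewrite !mxE.
pose w : 'cV[C]_3 := \col_j z j.
have := congr1 (fun v : 'cV[C]_3 => v j 0) (mulKmx uL w); rewrite !mxE => <-.
apply: eq_bigr => i _; rewrite mulrC !mxE; congr (_ * _).
by apply: eq_bigr => k _; rewrite !mxE.
Qed.

Lemma vanish_line F m (v : vec) : F \is @ishomog1 3 C m mdeg -> F != 0 ->
  (forall P Q, F = P * Q -> P \is a GRing.unit \/ Q \is a GRing.unit) ->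
  (exists j, v j != 0) -> (forall z, dot v z = 0 -> meval z F = 0) ->
  exists2 c, c != 0 & F = c *: lform v.
Proof.
move=> Fm F0 Firr v0 h; have [w vw] := dot_dual v0.
have [Q e] := lform_dvd vw h; have [u|/mpoly_unitP[c c0 eQ]] := Firr _ _ e; last first.
  by exists c => //; rewrite e eQ mulrC mul_mpolyC.
move: u => /mpoly_unitP[c c0 ec]; have := congr1 (meval (fun=> 0)) ec.
rewrite meval_lform mevalC big1 => [c0'|j _]; last by rewrite mulr0.
by rewrite -c0' eqxx in c0.
Qed.

Section Scaling.
Variables (A A' : 'I_3 -> mpoly 3 C) (c : C).
Hypotheses (c0 : c != 0) (AA : forall j, A' j = c *: A j).

Lemma wf_scaled z v : wf A' z v = c * wf A z v.
Proof. by rewrite /wf /dot mulr_sumr; apply: eq_bigr => j _; rewrite AA mevalZ mulrA. Qed.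

Lemma jac_scaled z u v : jac A' z u v = c * jac A z u v.
Proof.
rewrite /jac mulr_sumr; apply: eq_bigr => j _; rewrite mulr_sumr; apply: eq_bigr => k _.
by rewrite AA mderivZ mevalZ !mulrA.
Qed.

Lemma sing_scaled z : (forall j, meval z (A' j) = 0) -> forall j, meval z (A j) = 0.
Proof.
by move=> h j; have /eqP := h j; rewrite AA mevalZ mulf_eq0 (negPf c0) => /eqP.
Qed.

Lemma hypform_scaled : hypform A -> hypform A'.
Proof.
move=> h z z0 /sing_scaled sz; have [u [v n]] := h z z0 sz; exists u, v.
apply: contra n => /(nonhyp_scale c^-1); rewrite /jacT /jacD !jac_scaled.
by congr (is_true (nonhyp _ _)); field.
Qed.

Lemma inv_line_scaled v : inv_line A v -> inv_line A' v.
Proof. by move=> h z w lz lw; rewrite wf_scaled h ?mulr0. Qed.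

Lemma good_scaled p : good A p -> good A' p.
Proof.
move=> h m rs m0 hrs; apply: (h m) => // i; have [h1 h2 h3] := hrs i; split=> // r /h3 /eqP.
by rewrite wf_scaled mulf_eq0 (negPf c0) => /eqP.
Qed.

Lemma limit_data_scaled d l (e : 'I_3 -> 'I_d.+1 -> vec) : limit_data A l e -> limit_data A' l e.
Proof.
move=> [h1 h2 h3 h4 h5]; split=> //.
  by move=> i x x' n n'; rewrite !wf_scaled -!mulrA; congr (_ * _); rewrite !mulrA; exact: h3.
by move=> i v v'; rewrite !jac_scaled -!mulrA; congr (_ * _); exact: h4.
Qed.

End Scaling.

Section NoLimitData.
Variables (d : nat) (A : 'I_3 -> mpoly 3 C) (p l : 'I_3 -> vec).
Hypotheses (Af : is_form d A) (Ah : hypform A) (pl : frame p l).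
Hypothesis Al : forall i, inv_line A (l i).

Lemma frame_neq0 i : exists j, l i j != 0.
Proof.
by apply: (@dot1_neq0 _ (l i) (p i)); rewrite pl.1 eqxx oner_eq0.
Qed.

(** The points of a Carnot relation are nonzero roots of the factor [q] of the edge polynomial, of
    degree below [d]; so [m < d], the range over which the product in [limit_data] runs. *)
Lemma no_limit_data_good : ~ (exists l' e, [/\ forall i, exists j, l' i j != 0,
    forall i k, exists j, e i k j != 0 & limit_data (d := d) A l' e]) -> good A p.
Proof.
move=> nl m rs m0 hrs; apply/eqP => prs; apply: nl.
have md : (m < d)%N.
  have [q [eq q0 sq _]] := edge_poly_factor Af Ah pl Al 0; apply: leq_trans sq.
  have [un <- hr] := hrs 0; apply: max_poly_roots => //; apply/allP => r r0.
  have := hr r r0; rewrite -edge_polyE eq hornerM hornerX => /eqP; rewrite mulf_eq0.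
  case/orP => // /eqP re; move/eqP: prs; rewrite (bigD1 (0 : 'I_3)) //=.
  have -> : \prod_(r <- rs 0) - r = 0.
    by apply/eqP; rewrite prodf_seq_eq0; apply/hasP; exists r => //=; rewrite re oppr0.
  by rewrite mul0r eq_sym oner_eq0.
have [e [e0 le]] := limit_data_exists Af Ah pl Al m0 md hrs prs.
by exists l, e; split=> //; exact: frame_neq0.
Qed.

End NoLimitData.
End Lines.

(** * Compactness and continuity *)

Local Open Scope classical_set_scope.
Local Open Scope ring_scope.

Section ComplexTopology.
Variable R : realType.
Local Notation C := (Cplx R).

Lemma real_complex_continuous : continuous (fun a : R => (real_complex R a : C)).
Proof.
move=> a; apply/cvgrPdist_lt => e; rewrite ltcE /= => /andP[/eqP ei er].
near=> t; have ht : `|a - t| < complex.Re e by near: t; exact: cvgr_dist_lt.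
rewrite -raddfB /= normc_def /= expr0n /= addr0 sqrtr_sqr.
by rewrite ltcE /= ei eqxx.
Unshelve. all: by end_near.
Qed.

Lemma complex_continuous : continuous (fun ab : R * R => (Complex ab.1 ab.2 : C)).
Proof.
have -> : (fun ab : R * R => (Complex ab.1 ab.2 : C)) =
    (fun ab => (real_complex R ab.1 : C) + 'i * (real_complex R ab.2 : C)).
  apply/funext => -[a b]; exact: complexE.
move=> ab; apply: cvgD.
  apply: continuous_comp; [exact: cvg_fst|exact: real_complex_continuous].
apply: cvgMr; apply: continuous_comp; [exact: cvg_snd|exact: real_complex_continuous].
Qed.

(** A square instead of a disc, so that compactness comes from a product of segments. *)
Definition csquare : set C :=
  (fun ab : R * R => (Complex ab.1 ab.2 : C)) @` (`[-1, 1] `*` `[-1, 1]).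

Lemma csquare_compact : compact csquare.
Proof.
apply: continuous_compact; last by apply: compact_setX; exact: segment_compact.
by apply: continuous_subspaceT; exact: complex_continuous.
Qed.

Lemma csquareP (z : C) : `|z| <= 1 -> csquare z.
Proof.
case: z => a b; rewrite normc_def lecE /= => /andP[_ h].
have h2 : a ^+ 2 + b ^+ 2 <= 1.
  by rewrite -(@sqr_sqrtr _ (a ^+ 2 + b ^+ 2)) ?addr_ge0 ?sqr_ge0 // exprn_ile1.
have ha (x : R) : x ^+ 2 <= 1 -> -1 <= x <= 1.
  by move=> x1; rewrite -ler_norml -(@ler_pXn2r _ 2) ?nnegrE // real_normK ?num_real // expr1n.
exists (a, b) => //; split; rewrite /= in_itv /=; apply: ha; apply: le_trans h2.
  by rewrite lerDl sqr_ge0.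
by rewrite lerDr sqr_ge0.
Qed.

Lemma conj_continuous : continuous (fun z : C => z^*).
Proof.
move=> a; apply/(@cvgrPdist_lt _ _ _ _ (nbhs_filter (a : C))) => e e0.
have /(@cvgrPdist_lt _ _ _ _ (nbhs_filter (a : C)))/(_ e e0) : (id : C -> C) x @[x --> a] --> a by exact: cvg_id.
by apply: filterS => t; rewrite -rmorphB norm_conjC.
Qed.

End ComplexTopology.

(** The tube lemma: compactness of [K] yields a single neighbourhood of [x] that works for all its
    points. *)
Lemma closed_projection (T1 T2 : topologicalType) (K : set T2) (Z : set (T1 * T2)) :
  compact K -> closed Z -> closed [set x | exists2 y, K y & Z (x, y)].
Proof.
move=> cK cZ; rewrite -[X in closed X]setCK; apply/open_closedC.
rewrite openE => x /forall2NP hx; rewrite /interior /=.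
move: cK => /compact_near_coveringP/(_ T1 (nbhs x) (fun x' y => ~ Z (x', y)) _) h.
have : \forall x' \near nbhs x, K `<=` (fun y => ~ Z (x', y)).
  apply: h => y Ky; have [//|nZ] := hx y.
  have : open (~` Z) by exact/closed_openC.
  rewrite openE => /(_ (x, y) nZ) [[B1 B2] /= [n1 n2] sub].
  by exists (B2, B1) => //= -[y' x'] /= [b2 b1]; exact: (sub (x', y')).
by apply: filterS => x' h' [y Ky Zy]; exact: h' Zy.
Qed.

Section ContinuousFunctions.
Variables (R : realType) (T : topologicalType).
Local Notation C := (Cplx R).
Implicit Types f g : T -> C.

Definition cts f := forall x, f @ nbhs x --> f x.

Lemma cts_const c : cts (fun=> c).
Proof. by move=> x; exact: cvg_cst. Qed.

Lemma ctsD f g : cts f -> cts g -> cts (fun x => f x + g x).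
Proof. by move=> hf hg x; exact: cvgD (hf x) (hg x). Qed.

Lemma ctsM f g : cts f -> cts g -> cts (fun x => f x * g x).
Proof. by move=> hf hg x; exact: cvgM (hf x) (hg x). Qed.

Lemma ctsN f : cts f -> cts (fun x => - f x).
Proof. by move=> hf x; exact: cvgN (hf x). Qed.

Lemma ctsB f g : cts f -> cts g -> cts (fun x => f x - g x).
Proof. by move=> hf hg; exact: (ctsD hf (ctsN hg)). Qed.

Lemma cts_sum (J : Type) (r : seq J) (P : pred J) (f : J -> T -> C) :
  (forall i, cts (f i)) -> cts (fun x => \sum_(i <- r | P i) f i x).
Proof.
move=> h; elim: r => [|i r IH].
  under eq_fun do rewrite big_nil; exact: cts_const.
under eq_fun do rewrite big_cons; by case: (P i); [exact: (ctsD (h i) IH)|exact: IH].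
Qed.

Lemma cts_prod (J : Type) (r : seq J) (P : pred J) (f : J -> T -> C) :
  (forall i, cts (f i)) -> cts (fun x => \prod_(i <- r | P i) f i x).
Proof.
move=> h; elim: r => [|i r IH].
  under eq_fun do rewrite big_nil; exact: cts_const.
under eq_fun do rewrite big_cons; by case: (P i); [exact: (ctsM (h i) IH)|exact: IH].
Qed.

Lemma ctsX f n : cts f -> cts (fun x => f x ^+ n).
Proof.
move=> h; elim: n => [|n IH]; first by under eq_fun do rewrite expr0; exact: cts_const.
by under eq_fun do rewrite exprS; exact: (ctsM h IH).
Qed.

Lemma cts_norm f : cts f -> cts (fun x => `|f x|).
Proof. by move=> h x; exact: cvg_norm (h x). Qed.

Lemma cts_conj f : cts f -> cts (fun x => (f x)^*).
Proof. by move=> h x; exact: cvg_comp (h x) (@conj_continuous R (f x)). Qed.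

Lemma closed_cts0 f : cts f -> closed [set x | f x = 0].
Proof.
move=> h; have -> : [set x | f x = 0] = f @^-1` [set 0] by [].
apply: preimage_closed; first by move=> x _; exact: h.
apply: accessible_closed_set1; apply: hausdorff_accessible; exact: norm_hausdorff.
Qed.

Lemma closed_all (J : Type) (Z : J -> set T) :
  (forall i, closed (Z i)) -> closed [set x | forall i, Z i x].
Proof.
move=> h; have -> : [set x | forall i, Z i x] = \bigcap_(i in setT) Z i.
  by apply/seteqP; split=> x hx i; [move=> _; exact: hx|exact: hx].
by apply: closed_bigI => i _; exact: h.
Qed.

Lemma cts_meval n (z : T -> 'I_n -> C) (p : mpoly n C) :
  (forall j, cts (z^~ j)) -> cts (fun x => meval (z x) p).
Proof.
move=> h; elim/mpoly_alg_ind: p => [c|i|p q hp hq|p q hp hq].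
- by under eq_fun do rewrite mevalC; exact: (@cts_const c).
- under eq_fun do rewrite mevalXU; exact: (h i).
- by under eq_fun do rewrite mevalD; exact: (ctsD hp hq).
- by under eq_fun do rewrite mevalM; exact: (ctsM hp hq).
Qed.

Definition cts_poly n (p : T -> mpoly n C) m :=
  (forall x, p x \is @ishomog1 n C m mdeg) /\
  (forall k, cts (fun x => mcoeff k (p x))).

Lemma homog_msize n (p : mpoly n C) m : p \is @ishomog1 n C m mdeg -> (msize p <= m.+1)%N.
Proof.
by move=> /dhomogP h; rewrite msizeE; apply/bigmax_leqP_seq => k /h /= ->.
Qed.

(** The fixed degree turns evaluation into a sum over one finite set of monomials, so continuity in
    the coefficients and in the point combine. *)
Lemma cts_meval2 n (z : T -> 'I_n -> C) (p : T -> mpoly n C) m :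
  (forall j, cts (z^~ j)) -> cts_poly p m -> cts (fun x => meval (z x) (p x)).
Proof.
move=> hz [hm hp].
have -> : (fun x => meval (z x) (p x)) = (fun x => \sum_(k : bmultinom n m.+1)
    mcoeff k (p x) * meval (z x) (mpolyX C k)).
  apply/funext => x; rewrite {1}(mpolywE (homog_msize (hm x))) raddf_sum /=.
  by apply: eq_bigr => k _; rewrite mevalZ.
by apply: cts_sum => k; exact: (ctsM (hp k) (@cts_meval n z _ hz)).
Qed.

Lemma cts_mderiv n (z : T -> 'I_n -> C) (p : T -> mpoly n C) m i :
  (forall j, cts (z^~ j)) -> cts_poly p m -> cts (fun x => meval (z x) (mderiv i (p x))).
Proof.
move=> hz [hm hp].
have -> : (fun x => meval (z x) (mderiv i (p x))) = (fun x => \sum_(k : bmultinom n m.+1)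
    mcoeff k (p x) * meval (z x) (mderiv i (mpolyX C k))).
  apply/funext => x; rewrite {1}(mpolywE (homog_msize (hm x))) (linear_sum (mderiv i)) (linear_sum (meval (z x))) /=.
  by apply: eq_bigr => k _; rewrite mderivZ mevalZ.
by apply: cts_sum => k; exact: (ctsM (hp k) (@cts_meval n z _ hz)).
Qed.

Lemma cts_dot (u v : T -> 'I_3 -> C) :
  (forall j, cts (u^~ j)) -> (forall j, cts (v^~ j)) -> cts (fun x => dot (u x) (v x)).
Proof. by move=> hu hv; apply: cts_sum => j; exact: (ctsM (hu j) (hv j)). Qed.

Lemma cts_wf (A : T -> 'I_3 -> mpoly 3 C) m (z v : T -> 'I_3 -> C) :
  (forall j, cts_poly (fun x => A x j) m) ->
  (forall j, cts (z^~ j)) -> (forall j, cts (v^~ j)) -> cts (fun x => wf (A x) (z x) (v x)).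
Proof.
by move=> hA hz hv; apply: cts_sum => j; exact: (ctsM (cts_meval2 hz (hA j)) (hv j)).
Qed.

Lemma cts_jac (A : T -> 'I_3 -> mpoly 3 C) m (z u v : T -> 'I_3 -> C) :
  (forall j, cts_poly (fun x => A x j) m) -> (forall j, cts (z^~ j)) ->
  (forall j, cts (u^~ j)) -> (forall j, cts (v^~ j)) ->
  cts (fun x => jac (A x) (z x) (u x) (v x)).
Proof.
move=> hA hz hu hv; apply: cts_sum => j; apply: cts_sum => k.
exact: (ctsM (ctsM (@cts_mderiv 3 z _ m k hz (hA j)) (hu j)) (hv k)).
Qed.

(** The order conditions are turned into equations: [w <= 0] means [|w| + w = 0], and [w' >= 0]
    means [|w'| - w' = 0]. *)
Lemma closed_nonhyp f g : cts f -> cts g -> closed [set x | nonhyp (f x) (g x)].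
Proof.
move=> hf hg; pose w x := f x ^+ 2 * (g x)^*; pose w' x := w x - 4 * `|g x| ^+ 2.
have -> : [set x | nonhyp (f x) (g x)] =
    [set x | (`|w x| + w x) * (`|w' x| - w' x) = 0].
  apply/seteqP; split=> x /=; rewrite /nonhyp -/(w x).
    case/orP => h; first by rewrite (ler0_norm h) addNr mul0r.
    by rewrite (@ger0_norm _ (w' x)) ?subr_ge0 // subrr mulr0.
  move=> /eqP; rewrite mulf_eq0 addr_eq0 subr_eq0 => /orP[]/eqP e; apply/orP.
    by left; rewrite -oppr_ge0 -e normr_ge0.
  by right; rewrite -subr_ge0 -/(w' x) -e normr_ge0.
have cw : cts w by exact: (ctsM (@ctsX f 2 hf) (cts_conj hg)).
have cw' : cts w'.
  by exact: (ctsB cw (ctsM (@cts_const 4) (@ctsX _ 2 (cts_norm hg)))).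
by apply: closed_cts0; exact: (ctsM (ctsD (cts_norm cw) cw) (ctsB (cts_norm cw') cw')).
Qed.

End ContinuousFunctions.

(** * Open conditions on the coefficients of a form *)

Section FormTopology.
Variables (R : realType) (d : nat).
Local Notation C := (Cplx R).
Local Notation vec := ('I_3 -> C).
Local Notation form := (projective_form R d).

Definition coefs (W : form) : 'I_3 -> mpoly 3 C := fun j => val W j.

Lemma coefs_is_form W : is_form d (coefs W).
Proof.
have /and3P[_ /forallP h /eqP e] := valP W; split=> [j|]; first exact: h.
exact: e.
Qed.

Lemma coefs_cts j : cts_poly (fun W => coefs W j) d.+1.
Proof.
split=> [W|k W]; first by have [h _] := coefs_is_form W; exact: h.
have h1 := @initial_continuous _ _ (@form_coefs R d) W.
have h2 := @proj_continuous _ (fun=> C) (j, k) (form_coefs W).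
exact: (cvg_comp _ _ h1 h2).
Qed.

Section NormalizedTuples.
Variable J : eqType.
Local Notation E := {ptws (J * 'I_3)%type -> C}.

(* Families of vectors in the unit square with some coordinate equal to 1:
   compact representatives of families of points of the projective plane. *)
Definition normalized : set E := [set f | (forall i, csquare (f i)) /\
  (forall i, \prod_j (f (i, j) - 1) = 0)].

Lemma ptws_cts i : cts (fun f : E => f i).
Proof. by move=> f; exact: (@proj_continuous _ (fun=> C) i f). Qed.

Lemma normalized_compact : compact normalized.
Proof.
have -> : normalized = [set f : E | forall i, \prod_j (f (i, j) - 1) = 0] `&`
    [set f : E | forall i, csquare (f i)].
  by apply/seteqP; split=> f [h1 h2].
rewrite setIC; apply: compact_closedI.
  by apply: (@tychonoff _ (fun=> C) (fun=> csquare (R := R))) => i; exact: csquare_compact.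
apply: closed_all => i; apply: closed_cts0; apply: cts_prod => j.
exact: (ctsB (@ptws_cts (i, j)) (@cts_const _ _ _)).
Qed.

Lemma normalized_neq0 f i : normalized f -> exists j, f (i, j) != 0.
Proof.
move=> [_ /(_ i)/eqP/prodf_eq0[j _]]; rewrite subr_eq0 => /eqP h.
by exists j; rewrite h oner_eq0.
Qed.

End NormalizedTuples.

(** Division by an entry of largest modulus. *)
Lemma normalize (v : vec) : (exists j, v j != 0) ->
  exists c : C, [/\ c != 0, forall j, csquare (c * v j) & \prod_j (c * v j - 1) = 0].
Proof.
move=> [j0 vj0]; have nr k : `|v k| \is Num.real by rewrite normr_real.
pose F k := complex.Re `|v k|.
have FE k : `|v k| = (F k)%:C%C by rewrite /F RRe_real.
have [k _ kmax] := @Order.TotalTheory.arg_maxP _ _ _ j0 xpredT F isT.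
have le j : `|v j| <= `|v k| by rewrite !FE lecR; exact: kmax.
have vk : v k != 0.
  by rewrite -normr_gt0; apply: lt_le_trans (le j0); rewrite normr_gt0.
exists (v k)^-1; split; first by rewrite invr_eq0.
  by move=> j; apply: csquareP; rewrite normrM normfV mulrC ler_pdivrMr ?normr_gt0 // mul1r.
by apply/eqP/prodf_eq0; exists k => //; rewrite mulVf // subrr.
Qed.

Lemma hyp_at_scale (A : 'I_3 -> mpoly 3 C) c (z : vec) : is_form d A -> hyp_at A (fun j => c * z j) -> hyp_at A z.
Proof.
move=> Af [u [v h]]; exists u, v; apply: contra h => /(@nonhyp_scale _ (c ^+ d)).
rewrite /jacT /jacD !(jac_scale _ _ _ _ Af) -mulrBr.
by congr (is_true (nonhyp _ _)); ring.
Qed.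

Lemma hypform_open : open [set W : form | hypform (coefs W)].
Proof.
pose Y := {ptws (unit * 'I_3)%type -> C}.
pose zz (x : form * Y) j := x.2 (tt, j).
pose Z := [set x : form * Y | (forall j, meval (zz x) (coefs x.1 j) = 0) /\
  (forall u v, nonhyp (jacT (coefs x.1) (zz x) u v) (jacD (coefs x.1) (zz x) u v))].
have cz j : cts (zz^~ j).
  by move=> x; exact: (cvg_comp _ _ (@cvg_snd _ _ _ _ _) (@ptws_cts _ (tt, j) x.2)).
have cA j : cts_poly (fun x : form * Y => coefs x.1 j) d.+1.
  have [h1 h2] := coefs_cts j; split=> [x|k x]; first exact: h1.
  exact: (cvg_comp _ _ (@cvg_fst _ _ _ _ _) (h2 k x.1)).
have cj u v : cts (fun x => jac (coefs x.1) (zz x) u v).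
  exact: (cts_jac cA cz (fun j => @cts_const _ _ (u j)) (fun j => @cts_const _ _ (v j))).
have cZ : closed Z.
  apply: closedI.
    by apply: closed_all => j; apply: closed_cts0; exact: (cts_meval2 cz (cA j)).
  apply: closed_all => u; apply: closed_all => v; apply: closed_nonhyp.
    exact: (ctsB (cj u v) (cj v u)).
  exact: (ctsB (ctsM (cj u u) (cj v v)) (ctsM (cj u v) (cj v u))).
have := closed_projection (@normalized_compact unit) cZ.
move=> /closed_openC; congr open; apply/seteqP; split=> W hW.
  move=> z z0 sz; have [c [c0 cs pr]] := normalize z0.
  apply: (@hyp_at_scale _ c _ (coefs_is_form W)); apply: contrapT => nh; apply: hW.
  exists (fun ij => c * z ij.2) => //; split=> /= [j|u v].
    by have [h _] := coefs_is_form W; rewrite (meval_homog _ _ (h j)) sz mulr0.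
  by apply: contrapT => /negP h; apply: nh; exists u, v.
move=> [f nf [sz nh]]; have f0 := normalized_neq0 tt nf.
have [u [v /negP h]] := hW (fun j => f (tt, j)) f0 sz; apply: h; exact: nh.
Qed.

Lemma limit_data_open : open [set W : form |
  ~ exists l e, [/\ forall i, exists j, l i j != 0, forall i k, exists j, e i k j != 0 &
     limit_data (d := d) (coefs W) l e]].
Proof.
(* Lines and points are packed into one family: [None] marks the line, [Some k] the points on it. *)
pose J := ('I_3 * option 'I_d.+1)%type.
pose Y := {ptws (J * 'I_3)%type -> C}.
pose ll (f : Y) i j := f ((i, None), j); pose ee (f : Y) i k j := f ((i, Some k), j).
pose Z := [set x : form * Y | limit_data (coefs x.1) (ll x.2) (ee x.2)].
have cA j : cts_poly (fun x : form * Y => coefs x.1 j) d.+1.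
  have [h1 h2] := coefs_cts j; split=> [x|k x]; first exact: h1.
  exact: (cvg_comp _ _ (@cvg_fst _ _ _ _ _) (h2 k x.1)).
have cf i : cts (fun x : form * Y => x.2 i).
  by move=> x; exact: (cvg_comp _ _ (@cvg_snd _ _ _ _ _) (@ptws_cts _ i x.2)).
have cl i j : cts (fun x : form * Y => ll x.2 i j) by exact: cf.
have ce i k j : cts (fun x : form * Y => ee x.2 i k j) by exact: cf.
have cc (v : vec) j : cts (fun _ : form * Y => v j) by exact: (@cts_const _ _ (v j)).
have ccr i (v : vec) j : cts (fun x : form * Y => cross (ll x.2 i) v j).
  exact: (ctsB (ctsM (cl _ _) (cc v _)) (ctsM (cl _ _) (cc v _))).
have ceq (f g : form * Y -> C) : cts f -> cts g -> closed [set x | f x = g x].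
  move=> hf hg; have := closed_cts0 (ctsB hf hg); congr closed.
  by apply/seteqP; split=> x /=; [move/eqP; rewrite subr_eq0 => /eqP|move=> ->; rewrite subrr].
have cZ : closed Z.
  have -> : Z = [set x | forall i k, dot (ll x.2 i) (ee x.2 i k) = 0] `&`
     ([set x | forall i, dot (ll x.2 (i + 2)) (ee x.2 i ord0) = 0] `&`
     ([set x | forall i, dot (ll x.2 (i + 1)) (ee x.2 i (inord 1)) = 0] `&`
     ([set x | forall i, splits (coefs x.1) (ll x.2 i) (ee x.2 i)] `&`
     ([set x | forall i v v', jac (coefs x.1) (ee x.2 i ord0) v v *
          (dot (ll x.2 i) v' * dot (ll x.2 (i + 2)) v') =
        jac (coefs x.1) (ee x.2 i ord0) v' v' *
          (dot (ll x.2 i) v * dot (ll x.2 (i + 2)) v)] `&`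
      [set x | \prod_(1 <= m < d) (\prod_i \prod_(k < d.+1 | (1 < k < m.+2)%N)
            dot (ll x.2 (i + 1)) (ee x.2 i k)
        - (-1) ^+ m * \prod_i \prod_(k < d.+1 | (1 < k < m.+2)%N)
            dot (ll x.2 (i + 2)) (ee x.2 i k)) = 0])))).
    apply/seteqP; split=> x.
      move=> [h1 h2 h3 h4 h5]; split; first exact: h1.
      split; first by move=> i; case: (h2 i).
      split; first by move=> i; case: (h2 i).
      by split; [exact: h3|split; [exact: h4|exact: h5]].
    move=> [h1 [h2 [h2' [h3 [h4 h5]]]]].
    by split; [exact: h1|move=> i; split; [exact: h2|exact: h2']|exact: h3|exact: h4|exact: h5].
  have cd i i' k : cts (fun x : form * Y => dot (ll x.2 i) (ee x.2 i' k)).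
    exact: (cts_dot (cl i) (ce i' k)).
  have cdv i v : cts (fun x : form * Y => dot (ll x.2 i) v).
    exact: (cts_dot (cl i) (cc v)).
  have cve i k v : cts (fun x : form * Y => dot v (ee x.2 i k)).
    exact: (cts_dot (cc v) (ce i k)).
  have cw i v n : cts (fun x : form * Y => wf (coefs x.1) (cross (ll x.2 i) v) n).
    exact: (cts_wf cA (ccr i v) (cc n)).
  have cj i v : cts (fun x : form * Y => jac (coefs x.1) (ee x.2 i ord0) v v).
    exact: (cts_jac cA (ce i ord0) (cc v) (cc v)).
  apply: closedI.
    by apply: closed_all => i; apply: closed_all => k; exact: (closed_cts0 (cd i i k)).
  apply: closedI; first by apply: closed_all => i; exact: (closed_cts0 (cd _ _ _)).
  apply: closedI; first by apply: closed_all => i; exact: (closed_cts0 (cd _ _ _)).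
  apply: closedI.
    apply: closed_all => i; apply: closed_all => v; apply: closed_all => v'.
    apply: closed_all => n; apply: closed_all => n'; apply: ceq.
      exact: (ctsM (ctsM (cw i v n) (cdv i n')) (cts_prod (fun k => cve i k v'))).
    exact: (ctsM (ctsM (cw i v' n') (cdv i n)) (cts_prod (fun k => cve i k v))).
  apply: closedI.
    apply: closed_all => i; apply: closed_all => v; apply: closed_all => v'; apply: ceq.
      exact: (ctsM (cj i v) (ctsM (cdv i v') (cdv (i + 2) v'))).
    exact: (ctsM (cj i v') (ctsM (cdv i v) (cdv (i + 2) v))).
  have cp q m : cts (fun x : form * Y => \prod_i \prod_(k < d.+1 | (1 < k < m.+2)%N)
      dot (ll x.2 (i + q)) (ee x.2 i k)).
    by apply: cts_prod => i; apply: cts_prod => k; exact: cd.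
  apply: closed_cts0; apply: cts_prod => m.
  exact: (ctsB (cp 1 m) (ctsM (@cts_const _ _ _) (cp 2 m))).
have := closed_projection (@normalized_compact J) cZ.
move=> /closed_openC; congr open; apply/seteqP; split=> W hW.
  move=> [l [e [l0 e0 ld]]]; apply: hW.
  pose v (i : J) := if i.2 is Some k then e i.1 k else l i.1.
  have v0 i : exists j, v i j != 0 by case: i => i [k|] /=; [exact: e0|exact: l0].
  pose P i (c : C) := [/\ c != 0, forall j, csquare (c * v i j) & \prod_j (c * v i j - 1) = 0].
  have [c hc] : {c & forall i, P i (c i)} by apply: boolp.choice => i; exact: normalize.
  exists (fun ij => c ij.1 * v ij.1 ij.2).
    split=> [[i j]|i] /=; first by case: (hc i).
    by case: (hc i).
  exact: (limit_data_scale (fun i => c (i, None)) (fun i k => c (i, Some k)) (coefs_is_form W) ld).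
move=> [f nf ld]; apply: hW; exists (ll f), (ee f); split=> //.
  by move=> i; exact: (normalized_neq0 (i, None) nf).
by move=> i k; exact: (normalized_neq0 (i, Some k) nf).
Qed.

End FormTopology.

(** * Tangent vector fields *)

Section LocalFields.
Variable K : numFieldType.
Local Notation plane := 'rV[K]_2.
Implicit Types (X : plane -> plane) (q v : plane).

Lemma jacobian_quotient X q v i : differentiable X q -> X q = 0 ->
  (t^-1 * X (t *: v + q) 0 i) @[t --> 0^'] --> (v *m jacobian X q) 0 i.
Proof.
move=> dX Xq; have /cvg_ex[l hl] := @diff_derivable _ _ _ X q v dX.
have e : 'D_v X q = l := cvg_lim (@norm_hausdorff _ _) hl.
have -> : v *m jacobian X q = l by rewrite -deriveEjacobian ?e.
have := cvg_comp _ _ hl (@coord_continuous _ 1 2 0 i l).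
apply: cvg_trans; apply: near_eq_cvg; near=> t.
by rewrite /= mxE Xq subr0.
Unshelve. all: by end_near. Qed.

Lemma entry_le (v : plane) i : `|v 0 i| <= `|v|.
Proof.
have h : `|v 0 i|%:nng <= \big[Num.max/0%:nng]_(ij : 'I_1 * 'I_2) `|v ij.1 ij.2|%:nng.
  exact: (le_bigmax _ (fun ij : 'I_1 * 'I_2 => `|v ij.1 ij.2|%:nng) (0, i)).
by move: h; rewrite -num_le [X in _ -> _ <= X]mx_normE.
Qed.

Lemma norm_entries (v : plane) : `|v| <= `|v 0 0| + `|v 0 1|.
Proof.
have [->|/mx_norm_neq0[[i j] /= e]] := eqVneq `|v| 0; first by rewrite addr_ge0.
rewrite [leLHS]e ord1; case: j {e} => [[|[|//]] hj].
  by rewrite (_ : Ordinal hj = 0) ?lerDl //; exact: val_inj.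
by rewrite (_ : Ordinal hj = 1) ?lerDr //; exact: val_inj.
Qed.

Lemma mulmx2E (v : plane) (N : 'M[K]_2) i : (v *m N) 0 i = v 0 0 * N 0 i + v 0 1 * N 1 i.
Proof. by rewrite mxE !big_ord_recr big_ord0 /= add0r; congr (v 0 _ * N _ i + v 0 _ * N _ i); exact: val_inj. Qed.

Lemma mulmx_bounded (N : 'M[K]_2) : exists2 B : K, 0 < B & forall v, `|v *m N| <= B * `|v|.
Proof.
exists (1 + (`|N 0 0| + `|N 1 0|) + (`|N 0 1| + `|N 1 1|)).
  by rewrite -addrA ltr_pwDl // !addr_ge0.
move=> v; apply: le_trans (norm_entries _) _; rewrite -addrA mulrDl mul1r ler_wpDl // mulrDl.
have h i : `|(v *m N) 0 i| <= (`|N 0 i| + `|N 1 i|) * `|v|.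
  rewrite mulmx2E (le_trans (ler_normD _ _)) // mulrDl !normrM.
  by rewrite lerD // mulrC ler_wpM2l // entry_le.
exact: lerD.
Qed.

Lemma jacobian_littleo X q (e : K) : differentiable X q -> X q = 0 -> 0 < e ->
  \forall p \near q, `|X p - (p - q) *m jacobian X q| <= e * `|p - q|.
Proof.
move=> dX Xq e0; have [_ /eqaddoP h] := (diff_locallyP q X).1 dX.
rewrite (near_shift 0 q) subr0; near=> h0.
rewrite /= addrK /jacobian mul_rV_lin1.
have : `|(X \o shift q - (cst (X q) + 'd X q)) h0| <= e * `|h0|.
  by near: h0; exact: h.
by rewrite Xq [_ h0]/= add0r.
Unshelve. all: by end_near. Qed.

(** The invertible linear part is bounded below by a multiple of [|p - q|], which beats the
    remainder. *)
Lemma isolated_zero X q : differentiable X q -> X q = 0 -> jacobian X q \in unitmx ->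
  \forall p \near q, p != q -> X p != 0.
Proof.
move=> dX Xq u; have [B B0 hB] := mulmx_bounded (invmx (jacobian X q)).
have e0 : 0 < (2 * B)^-1 by rewrite invr_gt0 mulr_gt0.
near=> p; move=> pq; apply/eqP => Xp.
have : `|X p - (p - q) *m jacobian X q| <= (2 * B)^-1 * `|p - q|.
  by near: p; exact: jacobian_littleo.
rewrite Xp sub0r normrN => h; have := hB ((p - q) *m jacobian X q); rewrite mulmxK //.
have n0 : 0 < `|p - q| by rewrite normr_gt0 subr_eq0.
move=> /le_trans /(_ (ler_wpM2l (ltW B0) h)).
rewrite mulrA invfM mulrCA mulfV ?gt_eqF // mulr1 lt_geF //.
by rewrite gtr_pMl // invf_lt1 // ltr1n.
Unshelve. all: by end_near. Qed.

End LocalFields.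

(** * The linear part of a tangent field against the 1-jet of the form *)

Section TangentFields.
Variable R : realType.
Local Notation C := (Cplx R).
Local Notation vec := ('I_3 -> C).
Local Notation plane := 'rV[C]_2.
Implicit Types (X : plane -> plane) (q u v : plane) (k : 'I_3).

Lemma poly_dnbhs (p : {poly C}) : p.[t] @[t --> (0 : C)^'] --> p.[0].
Proof.
have c : cts (fun t : C => p.[t]).
  have -> : (fun t : C => p.[t]) = (fun t => \sum_(i < size p) p`_i%R * t ^+ i).
    by apply/funext => t; rewrite horner_coef.
  apply: cts_sum => i; apply: ctsM; first exact: (@cts_const _ _ p`_i%R).
  by apply: (@ctsX _ _ (fun t => t)) => t; exact: cvg_id.
exact: cvg_within_filter (c 0).
Qed.

Lemma linear_relation_limit (p1 p2 : {poly C}) (f g : C -> C) (m n : C) :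
  t^-1 * f t @[t --> 0^'] --> m -> t^-1 * g t @[t --> 0^'] --> n ->
  (\forall t \near 0^', p1.[t] * f t + p2.[t] * g t = 0) -> p1.[0] * m + p2.[0] * n = 0.
Proof.
move=> hf hg rel.
have h := cvgD (cvgM (@poly_dnbhs p1) hf) (cvgM (@poly_dnbhs p2) hg).
have h0 : p1.[t] * (t^-1 * f t) + p2.[t] * (t^-1 * g t) @[t --> 0^'] --> (0 : C).
  apply: (@cvg_trans _ ((fun=> 0 : C) @ 0^')); last exact: cvg_cst.
  apply: near_eq_cvg; near=> t.
  rewrite /= !(mulrCA _ t^-1) -mulrDr (_ : _ + _ = 0) ?mulr0 //; near: t; exact: rel.
exact: (cvg_unique (@norm_hausdorff _ _) (h _ _ _) h0).
Unshelve. all: by end_near. Qed.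

(** A tangent vector of the chart in homogeneous coordinates, where the coordinate normalized to 1
    does not vary. *)
Definition ext k v : vec := fun j => if unlift k j is Some i then v 0 i else 0.

Lemma chart_line k u v t : chart k (t *: v + u) =1 (fun j => chart k u j + t * ext k v j).
Proof. by move=> j; rewrite /chart /ext; case: unliftP => [i _|_]; rewrite ?mxE ?mulr0 ?addr0 // addrC. Qed.

Lemma chart_pt k q r0 r1 x y :
  chart k (q + x *: r0 + y *: r1) =1 pt (chart k q) (ext k r0) (ext k r1) x y.
Proof.
by move=> j; rewrite /chart /pt /ext; case: unliftP => [i _|_]; rewrite ?mxE ?mulr0 ?addr0.
Qed.

Lemma extD k u v j : ext k (u + v) j = ext k u j + ext k v j.
Proof. by rewrite /ext; case: unlift => [i|]; rewrite ?mxE ?addr0. Qed.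

Lemma extZ k t v j : ext k (t *: v) j = t * ext k v j.
Proof. by rewrite /ext; case: unlift => [i|]; rewrite ?mxE ?mulr0. Qed.

Definition axis0 : plane := delta_mx 0 0.
Definition axis1 : plane := delta_mx 0 1.

Lemma planeE v : v = v 0 0 *: axis0 + v 0 1 *: axis1.
Proof.
apply/rowP => i; rewrite !mxE /=; case: i => [[|[|//]]] hi.
  by rewrite (_ : Ordinal hi = 0) ?eqxx ?mulr1 ?mulr0 ?addr0 //; exact: val_inj.
by rewrite (_ : Ordinal hi = 1) ?eqxx ?mulr1 ?mulr0 ?add0r //; exact: val_inj.
Qed.

Lemma extE k v j : ext k v j = v 0 0 * ext k axis0 j + v 0 1 * ext k axis1 j.
Proof. by rewrite {1}(planeE v) extD !extZ. Qed.

Variable A : 'I_3 -> mpoly 3 C.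

Lemma wf_ext k z v : wf A z (ext k v) = wf A z (ext k axis0) * v 0 0 + wf A z (ext k axis1) * v 0 1.
Proof.
rewrite (eq_wf _ (frefl z) (extE k v)) wf_lin; ring.
Qed.

Definition tangent_field k q X := [/\ differentiable X q, X q = 0, jacobian X q \in unitmx &
  \forall p \near q, wf A (chart k p) (ext k (X p)) = 0].

Lemma near_line (P : set plane) q v : (\forall p \near q, P p) ->
  \forall t \near (0 : C)^', P (t *: v + q).
Proof.
move=> h; have c : (t *: v + q) @[t --> (0 : C)] --> q.
  have sc : t *: v @[t --> (0 : C)] --> (0 : C) *: v.
    by apply: (@scalel_continuous _ _ v (0 : C)).
  have F := nbhs_filter (0 : C).
  have cq : q @[t --> (0 : C)] --> q by exact: (@cvg_cst _ _ _ _ F).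
  have := @cvgD _ _ _ _ F _ _ _ _ sc cq; rewrite scale0r add0r => hh; exact: hh.
exact: (nbhs_dnbhs (c _ h)).
Qed.

(** Along a line through [q] both the form and the field vanish to first order, so the tangency
    relation is divided by [t^2] before taking the limit. *)
Lemma tangent_jet k q X v : (forall j, meval (chart k q) (A j) = 0) -> tangent_field k q X ->
  jac A (chart k q) (ext k axis0) (ext k v) * (v *m jacobian X q) 0 0 +
  jac A (chart k q) (ext k axis1) (ext k v) * (v *m jacobian X q) 0 1 = 0.
Proof.
move=> sq [dX Xq _ tX]; set z := chart k q.
have fac e : exists2 Q : {poly C}, Q.[0] = jac A z e (ext k v) &
    forall t, wf A (fun j => z j + t * ext k v j) e = t * Q.[t].
  have [P PE dP] := wf_line_deriv A z (ext k v) e.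
  have : P.[0] = 0.
    rewrite PE (eq_wf _ (z' := z) _ (frefl e)) => [|j]; last by rewrite mul0r addr0.
    by rewrite /wf /dot big1 // => j _; rewrite sq mul0r.
  move=> /vanish_factor[Q PQ]; rewrite subr0 in PQ; exists Q => [|t].
    by rewrite -dP PQ derivM derivX mul1r hornerD hornerM hornerX mul0r addr0.
  by rewrite -PE PQ hornerM hornerX.
have [Q0 <- h0] := fac (ext k axis0); have [Q1 <- h1] := fac (ext k axis1).
apply: (@linear_relation_limit Q0 Q1 (fun t => X (t *: v + q) 0 0) (fun t => X (t *: v + q) 0 1)
  _ _ (@jacobian_quotient _ X q v 0 dX Xq) (@jacobian_quotient _ X q v 1 dX Xq)).
have := near_line v tX => nt; near=> t.
have t0 : t != 0 by near: t; exact: nbhs_dnbhs_neq.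
have : wf A (chart k (t *: v + q)) (ext k (X (t *: v + q))) = 0 by near: t; exact: nt.
rewrite wf_ext !(eq_wf _ (chart_line k q v t) (frefl _)) h0 h1 => h.
by apply: (mulfI t0); rewrite mulr0 -[RHS]h; ring.
Unshelve. all: by end_near. Qed.

Lemma det2 (F : comNzRingType) (M : 'M[F]_2) : \det M = M 0 0 * M 1 1 - M 0 1 * M 1 0.
Proof.
rewrite (expand_det_row _ 0) !big_ord_recr big_ord0 /= add0r /cofactor.
rewrite !det_mx11 !mxE /=.
rewrite expr0 expr1 mul1r mulN1r mulrN; congr (M _ _ * M _ _ - M _ _ * M _ _); exact: val_inj.
Qed.

(** Up to a scalar the 1-jet of the form is a quarter turn of that of the field; hence [jacT] and
    [jacD] are [g] times the trace and [g^2] times the determinant. *)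
Lemma jet_factor k q X : (forall j, meval (chart k q) (A j) = 0) -> tangent_field k q X ->
  let M := jacobian X q in let J u v := jac A (chart k q) (ext k u) (ext k v) in
  exists g, [/\ J axis0 axis0 = g * M 0 1, J axis1 axis0 = - (g * M 0 0),
    J axis0 axis1 = g * M 1 1 & J axis1 axis1 = - (g * M 1 0)].
Proof.
move=> sq tX M J; have [dX Xq uM _] := tX; apply: jet_relation.
  by rewrite -det2 -unitfE -unitmxE.
move=> v0 v1; pose v : plane := v0 *: axis0 + v1 *: axis1.
have v00 : v 0 0 = v0 by rewrite !mxE /= mulr1 mulr0 addr0.
have v01 : v 0 1 = v1 by rewrite !mxE /= mulr1 mulr0 add0r.
have := tangent_jet v sq tX; rewrite !mulmx2E v00 v01 -/M.
have Jv u : jac A (chart k q) (ext k u) (ext k v) = J u axis0 * v0 + J u axis1 * v1.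
  have ev j : ext k v j = v0 * ext k axis0 j + v1 * ext k axis1 j + 0 * ext k axis1 j.
    by rewrite extE v00 v01 mul0r addr0.
  by rewrite (eq_jac _ _ (frefl _) ev) jac_linr mul0r addr0 mulrC [v1 * _]mulrC.
by rewrite !Jv.
Qed.

Lemma chart_span k q (x : vec) : exists a b c, forall j,
  x j = a * ext k axis0 j + b * ext k axis1 j + c * chart k q j.
Proof.
exists (x (lift k 0) - x k * q 0 0), (x (lift k 1) - x k * q 0 1), (x k) => j.
rewrite /ext /chart; case: unliftP => [i ->|->]; last by rewrite !mulr0 !add0r mulr1.
rewrite !mxE /=; case: i => [[|[|//]]] hi.
  have -> : Ordinal hi = 0 by exact: val_inj.
  by rewrite mulr1 mulr0 addr0 subrK.
have -> : Ordinal hi = 1 by exact: val_inj.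
by rewrite mulr1 mulr0 add0r subrK.
Qed.

Lemma char_poly2 (M : 'M[C]_2) l1 l2 : char_poly M = ('X - l1%:P) * ('X - l2%:P) ->
  M 0 0 + M 1 1 = l1 + l2 /\ \det M = l1 * l2.
Proof.
move=> e; split.
  have := @char_poly_trace _ 2 M isT; rewrite e /= => /(congr1 -%R); rewrite opprK.
  have -> : \tr M = M 0 0 + M 1 1.
    rewrite /mxtrace !big_ord_recr big_ord0 /= add0r; congr (M _ _ + M _ _); exact: val_inj.
  move=> <-; have -> : ('X - l1%:P) * ('X - l2%:P) = (l1 * l2)%:P + 'X * ('X - (l1 + l2)%:P).
    by rewrite polyCM polyCD; ring.
  by rewrite coefD coefC coefXM coefB coefX coefC /= sub0r add0r opprK.
have := char_poly_det M; rewrite e expr2 mulrNN !mul1r => <-.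
by rewrite -horner_coef0 hornerM !hornerXsubC !sub0r mulrNN.
Qed.

Lemma char_nonreal (d : nat) k q X (l1 l2 : C) : is_form d A -> tangent_field k q X ->
  (forall j, meval (chart k q) (A j) = 0) -> hyp_at A (chart k q) ->
  char_poly (jacobian X q) = ('X - l1%:P) * ('X - l2%:P) -> l1 / l2 \isn't Num.real.
Proof.
move=> Af tX sq hz /char_poly2[tr de]; apply/negP => rl.
have [g [J00 J10 J01 J11]] := jet_factor sq tX.
have /negP := hyp_at_basis Af sq hz (chart_span k q); apply.
have l20 : l2 != 0.
  have [_ _ u _] := tX; move: u; rewrite unitmxE unitfE de mulf_eq0 negb_or => /andP[] //.
have nh : nonhyp (l1 + l2) (l1 * l2).
  by apply: (real_ratio_nonhyp rl); rewrite divfK.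
have := nonhyp_scale g nh; rewrite -tr -de det2 /jacT /jacD J00 J10 J01 J11.
by congr (is_true (nonhyp _ _)); ring.
Qed.

(** A nonzero 1-jet of the form makes the scalar of [jet_factor] nonzero, so [nonhyp] transfers back
    to the eigenvalues of the field. *)
Lemma tangent_hyp_at k q X : tangent_field k q X ->
  (forall j, meval (chart k q) (A j) = 0) ->
  (exists u v, jac A (chart k q) (ext k u) (ext k v) != 0) ->
  (forall l1 l2, char_poly (jacobian X q) = ('X - l1%:P) * ('X - l2%:P) -> l1 / l2 \isn't Num.real) ->
  hyp_at A (chart k q).
Proof.
move=> tX sq [u [v uv]] hc; have [_ _ uM _] := tX.
have [g [J00 J10 J01 J11]] := jet_factor sq tX.
have g0 : g != 0.
  apply: contraNneq uv => g0; move: J00 J10 J01 J11; rewrite g0 !mul0r oppr0 => J00 J10 J01 J11.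
  have eE w j : ext k w j = w 0 0 * ext k axis0 j + w 0 1 * ext k axis1 j + 0 * ext k axis1 j.
    by rewrite mul0r addr0 -extE.
  rewrite (eq_jac _ _ (eE u) (eE v)) jac_lin !jac_linr J00 J10 J01 J11.
  by rewrite !mulr0 !addr0 !mulr0 !addr0.
exists (ext k axis0), (ext k axis1); apply/negP => nh.
have [s sE] := closed_field_poly_normal (char_poly (jacobian X q)).
move: sE; rewrite (monicP (char_poly_monic _)) scale1r => sE.
have ss : size s = 2%N.
  by have := size_char_poly (jacobian X q); rewrite sE size_prod_XsubC => -[].
case: s ss sE => [|l1 [|l2 [|//]]] // _; rewrite big_cons big_seq1 => sE.
have /negP := hc _ _ sE; apply; have [tr de] := char_poly2 sE.
have : l1 * l2 != 0 by rewrite -de -unitfE -unitmxE.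
rewrite mulf_eq0 negb_or => /andP[l10 l20]; apply: nonhyp_real_ratio => //.
have := nonhyp_scale g^-1 nh; rewrite -tr -de det2 /jacT /jacD J00 J10 J01 J11.
by congr (is_true (nonhyp _ _)); field.
Qed.

Lemma poly_near_neq0 (p : {poly C}) : p != 0 -> \forall t \near (0 : C)^', p.[t] != 0.
Proof.
move=> p0; have [m [psi [psi0 ->]]] := order_factor 0 p0.
have := cvgr_neq0 _ (@poly_dnbhs psi) psi0.
move=> h; near=> t.
have t0 : t != 0 by near: t; exact: nbhs_dnbhs_neq.
rewrite hornerM horner_exp hornerXsubC subr0 mulf_neq0 ?expf_neq0 //; near: t; exact: h.
Unshelve. all: by end_near. Qed.

End TangentFields.

(** * Common factors of the coefficients and finiteness of singular points *)

Section SingularLocus.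
Variable R : realType.
Local Notation C := (Cplx R).
Local Notation vec := ('I_3 -> C).
Local Notation plane := 'rV[C]_2.
Local Notation U k := (ext k (@axis0 R)).
Local Notation V k := (ext k (@axis1 R)).
Implicit Types (X : plane -> plane) (q u v w : plane) (k : 'I_3).
Variable A : 'I_3 -> mpoly 3 C.

Definition poly_line (x0 y0 x1 y1 : C) (h : {poly {poly C}}) : {poly C} :=
  (map_poly (comp_poly (x0%:P + x1 *: 'X)) h).[y0%:P + y1 *: 'X].

Lemma poly_lineE x0 y0 x1 y1 h t :
  (poly_line x0 y0 x1 y1 h).[t] = h.[(y0 + y1 * t)%:P].[x0 + x1 * t].
Proof.
rewrite /poly_line [LHS]slice_horner hornerD hornerC hornerZ hornerX -horner_slice.
congr (_.[_]); apply/polyP => i; rewrite /slice !coef_map /= /horner_eval horner_comp.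
by rewrite hornerD hornerC hornerZ hornerX.
Qed.

Definition frame_form k q (N : 'M[C]_2) (f : vec) :=
  wpoly A (chart k q) (ext k (row 0 N)) (ext k (row 1 N)) f.

Lemma frame_formE k q N f w :
  (frame_form k q N f).[(w 0 1)%:P].[w 0 0] = wf A (chart k (q + w *m N)) f.
Proof.
rewrite wpolyE; apply: eq_wf => // j; rewrite -chart_pt -addrA; congr (chart _ (_ + _) j).
by apply/rowP => i; rewrite mulmx2E !mxE.
Qed.

Lemma plane_ex (x y : C) : exists v : plane, v 0 0 = x /\ v 0 1 = y.
Proof. by exists (x *: axis0 R + y *: axis1 R); rewrite !mxE /= !mulr1 !mulr0 addr0 add0r. Qed.

Lemma relation_descent (c h a b fa fb x y : C) : c * fa = h * a -> c * fb = h * b ->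
  fa * x + fb * y = 0 -> h != 0 -> a * x + b * y = 0.
Proof.
move=> ha hb rel h0; apply: (mulfI h0); transitivity (c * fa * x + c * fb * y).
  by rewrite ha hb; ring.
by transitivity (c * (fa * x + fb * y)); [ring|rewrite rel !mulr0].
Qed.

(** On a line through the point where the common factor [h] is not identically zero, the tangency
    relation can be divided by [h]. In the limit the cofactors at the point annihilate the image of
    the direction, and two independent directions make them vanish. *)
Lemma tangent_transverse k q N w X : N \in unitmx -> tangent_field A k (q + w *m N) X ->
  transverse (frame_form k q N (U k)) (frame_form k q N (V k)) (w 0 0) (w 0 1).
Proof.
move=> uN [dX Xq uM tX] c h a1 b1 h0 hw ea eb.
set q0 := q + w *m N in dX Xq uM tX; set M := jacobian X q0 in uM.
set x0 := w 0 0 in ea eb hw h0 *; set y0 := w 0 1 in ea eb hw h0 *.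
have key (v : plane) : poly_line x0 y0 (v 0 0) (v 0 1) h != 0 ->
    a1.[y0%:P].[x0] * (v *m (N *m M)) 0 0 + b1.[y0%:P].[x0] * (v *m (N *m M)) 0 1 = 0.
  move=> hl; rewrite mulmxA; set l := poly_line x0 y0 (v 0 0) (v 0 1) in hl *.
  have l0 g : (l g).[0] = g.[y0%:P].[x0] by rewrite poly_lineE !mulr0 !addr0.
  rewrite -!l0; set n := v *m N.
  apply: (@linear_relation_limit _ (l a1) (l b1) (fun t => X (t *: n + q0) 0 0) (fun t => X (t *: n + q0) 0 1)
    _ _ (@jacobian_quotient _ X q0 n 0 dX Xq) (@jacobian_quotient _ X q0 n 1 dX Xq)).
  have nt := near_line n tX; have nh := poly_near_neq0 hl; near=> t.
  have ht : (l h).[t] != 0 by near: t; exact: nh.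
  have : wf A (chart k (t *: n + q0)) (ext k (X (t *: n + q0))) = 0 by near: t; exact: nt.
  rewrite wf_ext; set Y := X _.
  have -> : t *: n + q0 = q + (w + t *: v) *m N.
    by rewrite mulmxDl -scalemxAl -/n addrC /q0 addrA.
  rewrite -!frame_formE; set w' := w + _ => rel.
  have lE g : (l g).[t] = g.[(w' 0 1)%:P].[w' 0 0].
    by rewrite poly_lineE !mxE ![_ * t]mulrC.
  have hc (a a' : {poly {poly C}}) : c *: a = h * a' ->
      c.[w' 0 0] * a.[(w' 0 1)%:P].[w' 0 0] = (l h).[t] * (l a').[t].
    by move=> e; rewrite !lE -!hornerM -e hornerZ hornerM.
  exact: (relation_descent (hc _ _ ea) (hc _ _ eb) rel ht).
have uB : N *m M \in unitmx by rewrite unitmx_mul uN.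
set B := N *m M in key uB.
have dB : B 0 0 * B 1 1 - B 0 1 * B 1 0 != 0 by rewrite -det2 -unitfE -unitmxE.
have [y1 hy1] := poly_nonroot h0.
have k1 : a1.[y0%:P].[x0] * B 1 0 + b1.[y0%:P].[x0] * B 1 1 = 0.
  have [v [v0 v1]] := plane_ex 0 1; have := key v.
  rewrite !mulmx2E v0 v1 !mul0r !add0r !mul1r; apply.
  apply/eqP => /(congr1 (fun p : {poly C} => p.[y1 - y0])).
  rewrite poly_lineE mul1r mul0r addr0 addrC subrK horner0 -horner_slice => /eqP.
  by rewrite (negPf hy1).
(* A second direction, not vertical, along which [h] is not identically zero. *)
have [x1 hx1] : exists x1, (('X - x0%:P) * h.[y1%:P]).[x1] != 0.
  apply: poly_nonroot; rewrite mulf_neq0 ?polyXsubC_eq0 //; apply: contraNneq hy1 => e.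
  by rewrite horner_slice e horner0.
move: hx1; rewrite hornerM hornerXsubC mulf_eq0 negb_or => /andP[x10 hx1].
have [v [v0 v1]] := plane_ex (x1 - x0) (y1 - y0).
have k0 : a1.[y0%:P].[x0] * B 0 0 + b1.[y0%:P].[x0] * B 0 1 = 0.
  have := key v; rewrite !mulmx2E v0 v1 => kv; apply: (mulfI x10); rewrite mulr0.
  have := congr1 ( *%R (y1 - y0)) k1; rewrite mulr0 => k1'.
  rewrite -[RHS]kv; first by rewrite -[LHS]addr0 -k1'; ring.
  apply/eqP => /(congr1 (fun p : {poly C} => p.[1])).
  rewrite poly_lineE !mulr1 ![_ + (_ - _)]addrC !subrK horner0 => /eqP.
  by rewrite (negPf hx1).
split; apply: (mulIf dB); rewrite mul0r.
  transitivity ((a1.[y0%:P].[x0] * B 0 0 + b1.[y0%:P].[x0] * B 0 1) * B 1 1 -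
    (a1.[y0%:P].[x0] * B 1 0 + b1.[y0%:P].[x0] * B 1 1) * B 0 1); first by ring.
  by rewrite k0 k1 !mul0r subr0.
transitivity ((a1.[y0%:P].[x0] * B 1 0 + b1.[y0%:P].[x0] * B 1 1) * B 0 0 -
    (a1.[y0%:P].[x0] * B 0 0 + b1.[y0%:P].[x0] * B 0 1) * B 1 0); first by ring.
by rewrite k0 k1 !mul0r subr0.
Unshelve. all: by end_near. Qed.

Variable d : nat.
Hypotheses (Af : is_form d A) (A0 : exists j, A j != 0).

Lemma chart_sing_wf k q : wf A (chart k q) (U k) = 0 -> wf A (chart k q) (V k) = 0 ->
  forall j, meval (chart k q) (A j) = 0.
Proof.
move=> hU hV; apply: wf_eq0 => v; have [a [b [c e]]] := chart_span k q v.
have e' j : v j = a * U k j + 1 * (b * V k j + c * chart k q j) by rewrite e mul1r addrA.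
by rewrite (eq_wf _ (frefl _) e') wf_lin wf_lin hU hV (wf_euler Af) !mulr0 addr0 mulr0 addr0.
Qed.

Lemma chart_scale k (z : vec) : z k != 0 ->
  exists q, forall j, z j = z k * chart k q j.
Proof.
move=> zk; exists (\row_i (z (lift k i) / z k)) => j; rewrite /chart.
by case: unliftP => [i ->|->]; rewrite ?mulr1 // mxE mulrCA mulfV ?mulr1.
Qed.

Lemma chart_form_neq0 k : exists q, exists j, meval (chart k q) (A j) != 0.
Proof.
apply: contrapT => /forallNP h; have [j Aj] := A0.
have : A j * mpolyX C (mnm1 k) = 0.
  apply: meval_inf => z; rewrite mevalM mevalXU.
  have [->|zk] := eqVneq (z k) 0; first by rewrite mulr0.
  have [q zE] := chart_scale zk; rewrite (meval_eq _ zE).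
  have [hA _] := Af; rewrite (meval_homog _ _ (hA j)).
  by have /forallNP/(_ j)/negP/negPn/eqP -> := h q; rewrite mulr0 mul0r.
move=> /eqP; rewrite mulf_eq0 (negPf Aj) => /eqP /(congr1 (meval (fun=> 1))) /eqP.
by rewrite mevalXU meval0 oner_eq0.
Qed.

(* The coordinates of the singular points in an affine frame of a chart are
   roots of a polynomial. *)
Lemma frame_bezout k q N : N \in unitmx ->
  (forall p, (forall j, meval (chart k p) (A j) = 0) -> exists X, tangent_field A k p X) ->
  exists r : {poly C}, r != 0 /\ forall w,
    (forall j, meval (chart k (q + w *m N)) (A j) = 0) -> r.[w 0 0] = 0.
Proof.
move=> uN ht; 
have [a ea] : {a | a = frame_form k q N (U k)} by eexists.
have [b eb] : {b | b = frame_form k q N (V k)} by eexists.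
have aE w : a.[(w 0 1)%:P].[w 0 0] = wf A (chart k (q + w *m N)) (U k) by rewrite ea frame_formE.
have bE w : b.[(w 0 1)%:P].[w 0 0] = wf A (chart k (q + w *m N)) (V k) by rewrite eb frame_formE.
have [||u [u' [r [r0 e]]]] := @transverse_bezout _ a b.
- rewrite -negb_and; apply/negP => /andP[/eqP a0 /eqP b0].
  have [p [j /negP]] := chart_form_neq0 k; apply; apply/eqP.
  have pE : p = q + ((p - q) *m invmx N) *m N by rewrite mulmxKV // addrC subrK.
  by move: j; apply: chart_sing_wf; rewrite pE;
    [rewrite -aE a0|rewrite -bE b0]; rewrite !horner0.
- move=> x0 y0; have [w [<- <-]] := plane_ex x0 y0.
  rewrite aE bE => ha hb; have [X tX] := ht _ (chart_sing_wf ha hb).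
  by rewrite ea eb; exact: tangent_transverse uN tX.
exists r; split=> // w sw; have wz f : wf A (chart k (q + w *m N)) f = 0.
  by rewrite /wf /dot big1 // => j _; rewrite sw mul0r.
have := congr1 (fun g : {poly {poly C}} => g.[(w 0 1)%:P].[w 0 0]) e.
by rewrite 2!hornerD 4!hornerM aE bE !wz !mulr0 addr0 hornerC.
Qed.

End SingularLocus.

(** * Lowest order terms of the form in a chart of the blow-up *)

Section BlowUp.
Variable R : realType.
Local Notation C := (Cplx R).
Local Notation vec := ('I_3 -> C).
Variables (A : 'I_3 -> mpoly 3 C) (z p r : vec).

(* The pullback of A j by (u, t) |-> z + u t p + t r. *)
Definition blow (F : mpoly 3 C) : {poly {poly C}} :=
  mmap (polyC \o polyC)
    (fun j => (z j)%:P%:P + ((p j)%:P * 'X + (r j)%:P)%:P * 'X) F.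

Lemma blowE F u t : (blow F).[t%:P].[u] = meval (pt z p r (u * t) t) F.
Proof.
rewrite -[LHS]/((horner_eval u \o horner_eval t%:P) _) rmorph_mmap.
apply: eq_mmap => c /=; rewrite /horner_eval; first by rewrite !hornerE.
by rewrite !hornerE /pt /=; ring.
Qed.

Definition blow_form (v : vec) : {poly {poly C}} := \sum_j blow (A j) * (v j)%:P%:P.

Lemma blow_formE v u t : (blow_form v).[t%:P].[u] = wf A (pt z p r (u * t) t) v.
Proof.
rewrite /blow_form !horner_sum; apply: eq_bigr => j _.
by rewrite !hornerM blowE !hornerC.
Qed.

Lemma size_horner_bound (f : {poly {poly C}}) :
  exists N : nat, forall t : C, (size f.[t%:P] <= N)%N.
Proof.
elim/poly_ind: f => [|f c [N h]]; first by exists 0%N => t; rewrite horner0 size_poly0.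
exists (maxn N (size c)) => t; rewrite hornerMXaddC mulrC mul_polyC.
rewrite (leq_trans (size_polyD _ _)) // geq_max leq_maxr andbT.
by rewrite (leq_trans (size_scale_leq _ _)) // leq_max h.
Qed.

(** Without a root at distance less than 1 from [u0], [root_bound] would bound the value at a fixed
    [u1] by a multiple of the value at [u0]; as [t] tends to 0 the latter tends to zero and the
    former does not. *)
Lemma nearby_root (f : {poly {poly C}}) (u0 : C) : f.[0] != 0 -> f.[0].[u0] = 0 ->
  \forall t \near (0 : C)^', exists s, `|s| < 1 /\ f.[t%:P].[u0 + s] = 0.
Proof.
move=> f0 fu; have [u1 hu1] := poly_nonroot f0; pose s1 := u1 - u0.
have [N sN] := size_horner_bound f.
pose g t := f.[t%:P] \Po (u0%:P + 'X).
have gE t s : (g t).[s] = f.[t%:P].[u0 + s] by rewrite horner_comp hornerD hornerC hornerX.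
pose B : C := (1 + `|s1| / 1) ^+ N.
have sl u : (slice u f).[t] @[t --> (0 : C)^'] --> f.[0].[u].
  by have := @poly_dnbhs _ (slice u f); rewrite horner_slice.
have sl1 : `|(slice u1 f).[t]| @[t --> (0 : C)^'] --> `|f.[0].[u1]|.
  by apply: cvg_norm; exact: sl.
have sl0 : `|(slice u0 f).[t]| @[t --> (0 : C)^'] --> (0 : C).
  have h : `|(slice u0 f).[t]| @[t --> (0 : C)^'] --> `|f.[0].[u0]|.
    by apply: cvg_norm; exact: sl.
  by rewrite fu normr0 in h.
have e0 : 0 < `|f.[0].[u1]| by rewrite normr_gt0.
have B0 : 0 < B by rewrite exprn_gt0 // ltr_pwDl // divr_ge0.
have lt : \forall t \near (0 : C)^', `|(slice u0 f).[t]| * B < `|(slice u1 f).[t]|.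
  have d1 : 0 < `|f.[0].[u1]| / 2 by rewrite divr_gt0.
  have d0 : 0 < `|f.[0].[u1]| / 2 / B by rewrite divr_gt0.
  have n1 := cvgr_dist_lt _ _ sl1 _ d1; have n0 := cvgr_dist_lt _ _ sl0 _ d0.
  near=> t.
  have h1 : `|(`|f.[0].[u1]| - `|(slice u1 f).[t]|)| < `|f.[0].[u1]| / 2 by near: t; exact: n1.
  have h0 : `|(0 - `|(slice u0 f).[t]|)| < `|f.[0].[u1]| / 2 / B by near: t; exact: n0.
  rewrite sub0r normrN normr_id ltr_pdivlMr // in h0; apply: lt_trans h0 _.
  have : `|f.[0].[u1]| < `|f.[0].[u1]| / 2 + `|(slice u1 f).[t]|.
    have := ler_normD (`|f.[0].[u1]| - `|(slice u1 f).[t]|) `|(slice u1 f).[t]|.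
    by rewrite subrK !normr_id => /le_lt_trans; apply; rewrite ltrD2r.
  by rewrite {1}(splitr `|f.[0].[u1]|) ltrD2l.
near=> t; apply: contrapT => /forallNP h.
have : `|(slice u0 f).[t]| * B < `|(slice u1 f).[t]| by near: t; exact: lt.
rewrite !horner_slice; suff /le_gtF -> : `|f.[t%:P].[u1]| <= `|f.[t%:P].[u0]| * B by [].
have := @root_bound C (g t) N 1 s1 ltr01; rewrite !gE addr0 /s1 [u0 + _]addrC subrK; apply.
  rewrite /g size_comp_poly2; first exact: leq_trans (sN t) (leqnSn _).
  by rewrite addrC size_XaddC.
move=> s /rootP; rewrite gE => e; have := h s.
by have [//|s1'] := @real_leP _ 1 `|s| (@real1 _) (normr_real s); case.
Unshelve. all: by end_near. Qed.

Section Branch.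
(** [Y0] and [Y1] stand for the components of the tangent field in coordinates where its linear part
    is the identity. *)
Variables (f0 f1 : vec) (Y0 Y1 : C -> C -> C).
Hypothesis rel : exists2 e : C, 0 < e & forall x y, `|x| < e -> `|y| < e ->
  wf A (pt z p r x y) f0 * Y0 x y + wf A (pt z p r x y) f1 * Y1 x y = 0.
Hypothesis Y0t : forall u, t^-1 * Y0 (u * t) t @[t --> (0 : C)^'] --> u.
Hypothesis Y1t : forall u, t^-1 * Y1 (u * t) t @[t --> (0 : C)^'] --> (1 : C).
Hypothesis Y1n : forall K : C, 0 < K -> exists2 e : C, 0 < e & forall x y,
  y != 0 -> `|y| < e -> `|x| <= K * `|y| -> Y1 x y != 0.
Hypothesis fin : exists2 q : {poly C}, q != 0 & forall x y,
  wf A (pt z p r x y) f0 = 0 -> wf A (pt z p r x y) f1 = 0 -> q.[y] = 0.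
Hypothesis jet0 : jac A z f0 r = 0.
Hypothesis nz : exists x y, y != 0 /\ (wf A (pt z p r x y) f0 != 0 \/ wf A (pt z p r x y) f1 != 0).

(* Otherwise the lowest order part of the first coefficient has a root u0, and
   roots near u0 of the first coefficient at small t are common zeros because
   Y1 does not vanish there; they are infinitely many. *)
Lemma blow_order : exists n (c : C) (a b : {poly {poly C}}), [/\ n != 1%N, c != 0,
  blow_form f0 = 'X^n * a, blow_form f1 = 'X^n * b &
  a.[0] = c%:P /\ b.[0] = - (c *: 'X)].
Proof.
have ab0 : (blow_form f0 != 0) || (blow_form f1 != 0).
  rewrite -negb_and; apply/negP => /andP[/eqP z0 /eqP z1].
  have [x [y [y0 h]]] := nz.
  have xy : x = x / y * y by rewrite divfK.
  by rewrite xy -!blow_formE z0 z1 !horner0 eqxx in h; case: h.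
have [n [a [b [ea eb h0]]]] := order_factor2 ab0.
have val f g u t : blow_form f = 'X^n * g -> wf A (pt z p r (u * t) t) f = t ^+ n * (slice u g).[t].
  move=> e; rewrite -blow_formE e hornerM hornerM horner_exp hornerX -rmorphXn hornerC.
  by rewrite horner_slice.
have [e e0 hrel] := rel.
have small (u : C) : \forall t \near (0 : C)^', `|u * t| < e /\ `|t| < e.
  have h : \forall t \near (0 : C)^', `|t| < e / (1 + `|u|).
    by apply: dnbhs0_lt; rewrite divr_gt0 // ltr_pwDl.
  near=> t; have : `|t| < e / (1 + `|u|) by near: t; exact: h.
  rewrite ltr_pdivlMr ?ltr_pwDl // mulrDr mulr1 mulrC normrM => lt.
  by split; apply: le_lt_trans lt; rewrite ?lerDl ?lerDr // mulrC.
(* The lowest order part of tangency to a field that is radial to first order. *)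
have ab u : a.[0].[u] * u + b.[0].[u] = 0.
  rewrite -[b.[0].[u]]mulr1.
  have := @linear_relation_limit _ (slice u a) (slice u b) (fun t => Y0 (u * t) t)
    (fun t => Y1 (u * t) t) _ _ (@Y0t u) (@Y1t u); rewrite !horner_slice; apply.
  have sm := small u; near=> t.
  have t0 : t != 0 by near: t; exact: nbhs_dnbhs_neq.
  have [xe ye] : `|u * t| < e /\ `|t| < e by near: t; exact: sm.
  have := hrel _ _ xe ye; rewrite (val _ _ _ _ ea) (val _ _ _ _ eb) -!mulrA -mulrDr => /eqP.
  by rewrite mulf_eq0 expf_eq0 (negPf t0) andbF => /eqP.
have bE : b.[0] = - ('X * a.[0]).
  apply: poly_ext => u; rewrite hornerN hornerM hornerX; apply/eqP; rewrite -addr_eq0.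
  by rewrite mulrC addrC ab.
have a00 : a.[0] != 0.
  by move: h0; rewrite bE oppr_eq0 mulf_eq0 polyX_eq0 /= orbb.
have sa : (size a.[0] <= 1)%N.
  rewrite leqNgt; apply/negP => /closed_rootP[u0 [q eq]].
  have au0 : a.[0].[u0] = 0 by rewrite eq hornerM hornerXsubC subrr mul0r.
  have nr := nearby_root a00 au0; have [q' q'0 hq'] := fin.
  pose K : C := `|u0| + 1; have K0 : 0 < K by rewrite ltr_wpDl.
  have [e' e'0 hY] := Y1n K0; have nq := poly_near_neq0 q'0.
  have de : \forall t \near (0 : C)^', `|t| < e' by exact: dnbhs0_lt.
  have sm := small K.
  near (0 : C)^' => t.
  have t0 : t != 0 by near: t; exact: nbhs_dnbhs_neq.
  have [s [s1 hs]] : exists s, `|s| < 1 /\ a.[t%:P].[u0 + s] = 0 by near: t; exact: nr.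
  have te' : `|t| < e' by near: t; exact: de.
  have [xe ye] : `|K * t| < e /\ `|t| < e by near: t; exact: sm.
  have : q'.[t] != 0 by near: t; exact: nq.
  case/negP; apply/eqP; have xK : `|(u0 + s) * t| <= K * `|t|.
    by rewrite normrM ler_wpM2r // (le_trans (ler_normD _ _)) // lerD2l ltW.
  have w0 : wf A (pt z p r ((u0 + s) * t) t) f0 = 0.
    by rewrite (val _ _ _ _ ea) horner_slice hs mulr0.
  apply: (hq' _ _ w0); have xe' : `|(u0 + s) * t| < e.
    by apply: le_lt_trans xK _; rewrite normrM gtr0_norm in xe.
  have := hrel _ _ xe' ye; rewrite w0 mul0r add0r => /eqP; rewrite mulf_eq0.
  by rewrite (negPf (hY _ _ t0 te' xK)) orbF => /eqP.
have aC := size1_polyC sa; set c := (a.[0]`_0)%R in aC.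
exists n, c, a, b; split=> //; last 2 first.
- by apply: contraNneq a00 => c0; rewrite aC c0 polyC0.
- by split=> //; rewrite bE {1}aC mulrC mul_polyC.
(* Order 1 would make the nonzero constant [c] an entry of the 1-jet of the form. *)
apply/eqP => n1.
have [P PE dP] := wf_line_deriv A z r f0; move: jet0.
suff -> : jac A z f0 r = a.[0].[0].
  by rewrite aC hornerC => c0; move/eqP: a00; apply; rewrite aC c0 polyC0.
rewrite -dP; have -> : P = 'X * slice 0 a.
  apply: poly_ext => t; transitivity (t ^+ n * (slice 0 a).[t]); last by rewrite n1 hornerM hornerX.
  rewrite PE -(val _ _ _ _ ea).
  by apply: eq_wf => // j; rewrite /pt; ring.
by rewrite derivM derivX mul1r hornerD hornerM hornerX mul0r addr0 -horner_slice.
Unshelve. all: by end_near. Qed.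

End Branch.
End BlowUp.

(** * Nonvanishing of the 1-jet at a nondegenerate singular point *)

Section NonzeroJet.
Variable R : realType.
Local Notation C := (Cplx R).
Local Notation vec := ('I_3 -> C).
Local Notation plane := 'rV[C]_2.
Local Notation U k := (ext k (@axis0 R)).
Local Notation V k := (ext k (@axis1 R)).
Implicit Types (u v w : plane).
Variables (A : 'I_3 -> mpoly 3 C) (d : nat).
Hypotheses (Af : is_form d A) (A0 : exists j, A j != 0).
Variable k : 'I_3.
Hypothesis tf : forall p, (forall j, meval (chart k p) (A j) = 0) -> exists X, tangent_field A k p X.

Section Point.
Variables (q : plane) (X : plane -> plane).
Hypotheses (sq : forall j, meval (chart k q) (A j) = 0) (tX : tangent_field A k q X).
Local Notation M := (jacobian X q).
Local Notation N := (invmx M).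
Local Notation z := (chart k q).
Local Notation E0 := (ext k (row 0 N)).
Local Notation E1 := (ext k (row 1 N)).

Let uM : M \in unitmx. Proof. by case: tX. Qed.

Lemma near_frame (P : set plane) : (\forall p \near q, P p) ->
  exists2 e : C, 0 < e & forall w, `|w 0 0| < e -> `|w 0 1| < e -> P (q + w *m N).
Proof.
move=> /nbhs_ballP[e /= e0 he]; have [B B0 hB] := mulmx_bounded N.
exists (e / (2 * B)); first by rewrite divr_gt0 // mulr_gt0.
move=> w w0 w1; apply: he; rewrite -ball_normE /ball_ /= opprD addNKr normrN.
apply: le_lt_trans (hB w) _; rewrite mulrC -ltr_pdivlMr //.
apply: le_lt_trans (norm_entries w) _; rewrite invfM mulrA [e / 2]mulrC -mulrA in w0 w1.
by rewrite [e / B](splitr (e / B)) ltrD // mulrC.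
Qed.

(** In the frame given by the rows of the inverse jacobian, the field is radial to first order. *)
Lemma frame_quotient w i : t^-1 * X (q + (t *: w) *m N) 0 i @[t --> (0 : C)^'] --> w 0 i.
Proof.
have [dX Xq _ _] := tX; have := @jacobian_quotient _ X q (w *m N) i dX Xq.
rewrite mulmxKV //; apply: cvg_trans; apply: near_eq_cvg; near=> t.
by rewrite /= -scalemxAl addrC.
Unshelve. all: by end_near. Qed.

(** In a cone around the [i]-th axis, the [i]-th entry of the radial part dominates the
    remainder. *)
Lemma frame_nonzero (K : C) i : 0 < K -> exists2 e : C, 0 < e & forall w, w 0 i != 0 ->
  `|w 0 i| < e -> `|w 0 0| <= K * `|w 0 i| -> `|w 0 1| <= K * `|w 0 i| ->
  X (q + w *m N) 0 i != 0.
Proof.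
move=> K0; have [dX Xq _ _] := tX; have [B B0 hB] := mulmx_bounded N.
(* In the cone [|w| <= 2 K |w_i|], so with this constant the remainder is at most half of
   [|w_i|]. *)
pose h : C := (4 * K * B)^-1; have h0 : 0 < h by rewrite invr_gt0 !mulr_gt0.
have [e e0 he] := near_frame (jacobian_littleo dX Xq h0).
exists (e / K); first by rewrite divr_gt0.
move=> w wi; rewrite ltr_pdivlMr // mulrC => we w0 w1.
have := he w (le_lt_trans w0 we) (le_lt_trans w1 we).
have -> : q + w *m N - q = w *m N by rewrite addrC addKr.
rewrite mulmxKV // => hX; apply/eqP => Xi.
have wi0 : 0 < `|w 0 i| by rewrite normr_gt0.
have := entry_le (X (q + w *m N) - w) i; rewrite mxE Xi add0r mxE normrN.
move=> /le_trans/(_ hX)/le_trans/(_ (ler_wpM2l (ltW h0) (hB w))).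
have w2 : `|w| <= 2 * K * `|w 0 i|.
  by apply: le_trans (norm_entries w) _; rewrite -mulrA mulr_natl mulr2n lerD.
move=> /le_trans/(_ (ler_wpM2l (ltW h0) (ler_wpM2l (ltW B0) w2))).
have -> : h * (B * (2 * K * `|w 0 i|)) = `|w 0 i| / 2.
  by rewrite /h; field; rewrite !gt_eqF.
by rewrite lt_geF // ltr_pdivrMr // ltr_pMr // ltr1n.
Qed.

Lemma order_unique (P Q : {poly C}) m n : 'X^m * P = 'X^n * Q -> P.[0] != 0 -> Q.[0] != 0 -> m = n.
Proof.
have le (P' Q' : {poly C}) m' n' : 'X^m' * P' = 'X^n' * Q' -> P'.[0] != 0 -> (n' <= m')%N.
  move=> e p0; rewrite leqNgt; apply: contra p0 => mn; apply/eqP.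
  have : 'X^m' * P' = 'X^m' * ('X^(n' - m') * Q') by rewrite mulrA -exprD subnKC // ltnW.
  move=> /mulfI ->; last by rewrite expf_neq0 // polyX_eq0.
  by rewrite hornerM hornerXn expr0n subn_eq0 leqNgt mn mul0r.
move=> e p0 q0; apply/eqP; rewrite eqn_leq (le _ _ _ _ e p0).
by rewrite (le _ _ _ _ (esym e) q0).
Qed.

Hypothesis jet0 : forall u v, jac A z (ext k u) (ext k v) = 0.

(* Both charts of the blow-up give lowest order terms c (y dx - x dy), which
   match only in order 1. *)
Lemma zero_jet_absurd : False.
Proof.
have wfE x y w f : w 0 0 = x -> w 0 1 = y ->
    wf A (pt z E0 E1 x y) f = wf A (chart k (q + w *m N)) f.
  move=> w0 w1; apply: eq_wf => // j; rewrite -chart_pt -addrA.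
  by congr (chart _ (_ + _) j); apply/rowP => i; rewrite mulmx2E !mxE w0 w1.
have [dX Xq _ tan] := tX.
have uN : N \in unitmx by rewrite unitmx_inv.
have swap_pt x y f : wf A (pt z E1 E0 y x) f = wf A (pt z E0 E1 x y) f.
  by apply: eq_wf => // j; rewrite /pt addrAC.
pose w (x y : C) : plane := x *: axis0 R + y *: axis1 R.
have w0 x y : w x y 0 0 = x by rewrite !mxE /= mulr1 mulr0 addr0.
have w1 x y : w x y 0 1 = y by rewrite !mxE /= mulr1 mulr0 add0r.
have wZ t x y : w (t * x) (t * y) = t *: w x y by rewrite /w -!scalerA scalerDr.
have [e e0 he] := near_frame tan.
have rel x y : `|x| < e -> `|y| < e ->
    wf A (pt z E0 E1 x y) (U k) * X (q + w x y *m N) 0 0 +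
    wf A (pt z E0 E1 x y) (V k) * X (q + w x y *m N) 0 1 = 0.
  move=> xe ye; have := he (w x y); rewrite w0 w1 => /(_ xe ye).
  by rewrite wf_ext -!(wfE x y).
have quo (s : C) i : t^-1 * X (q + w (s * t) t *m N) 0 i @[t --> (0 : C)^'] --> w s 1 0 i.
  have := @frame_quotient (w s 1) i; apply: cvg_trans; apply: near_eq_cvg; near=> t.
  by rewrite -wZ mulr1 [t * s]mulrC.
have quo' (s : C) i : t^-1 * X (q + w t (s * t) *m N) 0 i @[t --> (0 : C)^'] --> w 1 s 0 i.
  have := @frame_quotient (w 1 s) i; apply: cvg_trans; apply: near_eq_cvg; near=> t.
  by rewrite -wZ mulr1 [t * s]mulrC.
pose S : 'M[C]_2 := \matrix_(i, j) (i != j)%:R.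
have uS : S \in unitmx.
  by rewrite unitmxE unitfE det2 !mxE /= mul0r mulr1 sub0r oppr_eq0 oner_eq0.
have wS x y : w y x *m (S *m N) = w x y *m N.
  rewrite mulmxA; congr (_ *m N); rewrite [RHS]planeE; apply/rowP => i.
  rewrite mulmx2E w0 w1 !mxE; case: i => [[|[|//]]] hi /=.
    by rewrite /= !mulr1 !mulr0 ?addr0 ?add0r; ring.
  by rewrite /= !mulr1 !mulr0 ?addr0 ?add0r; ring.
have sing x y : wf A (pt z E0 E1 x y) (U k) = 0 -> wf A (pt z E0 E1 x y) (V k) = 0 ->
    forall j, meval (chart k (q + w x y *m N)) (A j) = 0.
  by rewrite !(@wfE x y (w x y)) //; exact: (chart_sing_wf Af).
have [r0 [r00 hr0]] := frame_bezout Af A0 q uN tf.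
have uSN : S *m N \in unitmx by rewrite unitmx_mul uS.
have [r1 [r10 hr1]] := frame_bezout Af A0 q uSN tf.
have fin0 x y : wf A (pt z E0 E1 x y) (U k) = 0 -> wf A (pt z E0 E1 x y) (V k) = 0 -> r0.[x] = 0.
  by move=> hU hV; have := hr0 _ (sing _ _ hU hV); rewrite w0.
have fin1 x y : wf A (pt z E0 E1 x y) (U k) = 0 -> wf A (pt z E0 E1 x y) (V k) = 0 -> r1.[y] = 0.
  by move=> hU hV; have := hr1 (w y x); rewrite wS w0; apply; exact: sing.
have nonz i : forall K : C, 0 < K -> exists2 e : C, 0 < e & forall x y, w x y 0 i != 0 ->
    `|w x y 0 i| < e -> `|x| <= K * `|w x y 0 i| -> `|y| <= K * `|w x y 0 i| ->
    X (q + w x y *m N) 0 i != 0.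
  move=> K K0; have [e' e'0 h] := frame_nonzero i K0; exists e' => // x y.
  by have := h (w x y); rewrite w0 w1.
have K1 (K y : C) : 0 <= K -> `|y| <= (K + 1) * `|y|.
  by move=> K0; rewrite ler_peMl // lerDr.
have K2 (K x y : C) : `|x| <= K * `|y| -> `|x| <= (K + 1) * `|y|.
  by move=> h; apply: le_trans h _; rewrite ler_wpM2r // lerDl.
have branch0 : exists n (c : C) (a b : {poly {poly C}}), [/\ n != 1%N, c != 0,
    blow_form A z E0 E1 (U k) = 'X^n * a, blow_form A z E0 E1 (V k) = 'X^n * b &
    a.[0] = c%:P /\ b.[0] = - (c *: 'X)].
  apply: (@blow_order R A z E0 E1 (U k) (V k)
    (fun x y => X (q + w x y *m N) 0 0) (fun x y => X (q + w x y *m N) 0 1)).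
  - by exists e.
  - by move=> s; have := @quo s 0; rewrite w0.
  - by move=> s; have := @quo s 1; rewrite w1.
  - move=> K K0; have [e' e'0 h] := nonz 1 (K + 1) (addr_gt0 K0 ltr01); exists e' => // x y y0 ye xy.
    by have := h x y; rewrite w1; apply=> //; [exact: K2|exact/K1/ltW].
  - by exists r1.
  - exact: jet0.
  - have [|y] := @poly_nonroot C (r1 * 'X); first by rewrite mulf_neq0 // polyX_eq0.
    rewrite hornerM hornerX mulf_eq0 negb_or => /andP[ry y0]; exists 0, y; split=> //.
    apply/orP; rewrite -negb_and; apply: contra ry => /andP[/eqP h1 /eqP h2].
    by apply/eqP; exact: (fin1 0 y).
have branch1 : exists n (c : C) (a b : {poly {poly C}}), [/\ n != 1%N, c != 0,
    blow_form A z E1 E0 (V k) = 'X^n * a, blow_form A z E1 E0 (U k) = 'X^n * b &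
    a.[0] = c%:P /\ b.[0] = - (c *: 'X)].
  apply: (@blow_order R A z E1 E0 (V k) (U k)
    (fun x y => X (q + w y x *m N) 0 1) (fun x y => X (q + w y x *m N) 0 0)).
  - by exists e => // x y xe ye; rewrite !swap_pt addrC; exact: rel.
  - by move=> s; have := @quo' s 1; rewrite w1.
  - by move=> s; have := @quo' s 0; rewrite w0.
  - move=> K K0; have [e' e'0 h] := nonz 0 (K + 1) (addr_gt0 K0 ltr01); exists e' => // x y y0 ye xy.
    by have := h y x; rewrite w0; apply=> //; [exact/K1/ltW|exact: K2].
  - by exists r0 => // x y; rewrite !swap_pt => hV hU; exact: fin0 hU hV.
  - exact: jet0.
  - have [|y] := @poly_nonroot C (r0 * 'X); first by rewrite mulf_neq0 // polyX_eq0.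
    rewrite hornerM hornerX mulf_eq0 negb_or => /andP[ry y0]; exists 0, y; split=> //.
    apply/orP; rewrite -negb_and; apply: contra ry; rewrite !swap_pt => /andP[/eqP h1 /eqP h2].
    by apply/eqP; exact: (fin0 y 0).
have [n [c [a [b [n1 c0 _ eb [_ b0]]]]]] := branch0.
have [n' [c' [a' [_ [_ c'0 ea' _ [a'0 _]]]]]] := branch1.
(* Change of charts of the blow-up: the point [(t, s t)] of the second chart is [(u t', t')] in the
   first one, with [t' = s t] and [u = s^-1]. *)
have key (s t : C) : s != 0 -> (s * t) ^+ n * (slice s^-1 b).[s * t] = t ^+ n' * (slice s a').[t].
  move=> s0; rewrite !horner_slice.
  have ev (f g : {poly {poly C}}) m (x y : C) : f = 'X^m * g -> f.[y%:P].[x] = y ^+ m * g.[y%:P].[x].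
    by move=> ->; rewrite hornerM hornerM horner_exp hornerX -rmorphXn hornerC.
  rewrite -(ev _ _ _ _ _ eb) -(ev _ _ _ _ _ ea') !blow_formE swap_pt.
  by congr (wf A (pt _ _ _ _ _) _); rewrite mulKf.
have sb (s : C) : (slice s b).[0] = - (c * s).
  by rewrite horner_slice b0 hornerN hornerZ hornerX.
have sa (s : C) : (slice s a').[0] = c' by rewrite horner_slice a'0 hornerC.
have nn : n = n'.
  apply: (@order_unique (slice 1^-1 b) (slice 1 a')); first last.
  - by rewrite sa.
  - by rewrite sb oppr_eq0 invr1 mulr1.
  apply: poly_ext => t; rewrite !hornerM !hornerXn.
  by have := key 1 t (oner_neq0 _); rewrite !mul1r.
have val (s : C) : s != 0 -> s ^+ n * - (c * s^-1) = c'.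
  move=> s0; rewrite -sb -(sa s).
  pose P : {poly C} := s ^+ n *: (slice s^-1 b \Po (s *: 'X)) - slice s a'.
  have /eqP : 'X^n * P = 0.
    apply: poly_ext => t; rewrite horner0 hornerM hornerXn hornerD hornerN hornerZ horner_comp.
    rewrite hornerZ hornerX mulrBr mulrA [t ^+ n * s ^+ n]mulrC -exprMn key // nn.
    by rewrite subrr.
  rewrite mulf_eq0 expf_eq0 polyX_eq0 andbF /= => /eqP/(congr1 (fun P : {poly C} => P.[0])).
  rewrite hornerD hornerN hornerZ horner_comp hornerZ hornerX mulr0 horner0 => /eqP.
  by rewrite subr_eq0 => /eqP.
(* The power [s^(n - 1)] does not depend on [s]; comparing [s = 1] with [s = 2] gives [n = 1], which
   both branches exclude. *)
have v1 := val 1 (oner_neq0 _); have v2 := val 2 _; rewrite pnatr_eq0 in v2.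
have := v2 isT; rewrite -v1 expr1n invr1 mulr1 mul1r !mulrN => /oppr_inj.
have two : (2 : C) != 0 by rewrite pnatr_eq0.
rewrite mulrCA -[RHS]mulr1 => /(mulfI c0)/(congr1 ( *%R^~ 2)); rewrite divfK // mul1r.
rewrite -natrX => /eqP; rewrite eqr_nat => /eqP e2; move/eqP: n1; apply.
by apply/eqP; rewrite -(eqn_exp2l (m := 2)) // e2.
Unshelve. all: by end_near. Qed.

End Point.
End NonzeroJet.

(** * Hyperbolicity by vector fields and by 1-jets *)

Section HyperbolicForms.
Local Open Scope quotient_scope.
Variables (R : realType) (d : nat).
Local Notation C := (Cplx R).
Local Notation vec := ('I_3 -> C).
Local Notation plane := 'rV[C]_2.
Local Notation U k := (ext k (@axis0 R)).
Local Notation V k := (ext k (@axis1 R)).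

Section Form.
Variable A : 'I_3 -> mpoly 3 C.
Hypotheses (Af : is_form d A).

Lemma differentiable_meval k (F : mpoly 3 C) p : differentiable (fun u : plane => (meval (chart k u) F : C)) p.
Proof.
elim/mpoly_alg_ind: F => [c|j|F G hF hG|F G hF hG].
- by under eq_fun do rewrite mevalC; exact: differentiable_cst.
- under eq_fun do rewrite mevalXU /chart; case: (unlift k j) => [i|]; last exact: differentiable_cst.
  exact: differentiable_coord.
- by under eq_fun do rewrite mevalD; exact: (differentiableD hF hG).
- by under eq_fun do rewrite mevalM; exact: (differentiableM hF hG).
Qed.

Lemma differentiable_wf k v p : differentiable (fun u : plane => (wf A (chart k u) v : C)) p.
Proof.
have -> : (fun u : plane => (wf A (chart k u) v : C)) =
    (fun u => meval (chart k u) (\sum_j A j * mpolyC 3 (v j))).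
  apply/funext => u; rewrite (linear_sum (meval (chart k u))); apply: eq_bigr => j _.
  by rewrite /= mevalM mevalC.
exact: differentiable_meval.
Qed.

(** The field dual to the form under the area form of the chart; it spans the kernel away from
    singular points. *)
Definition rot_field k (u : plane) : plane :=
  wf A (chart k u) (V k) *: @axis0 R + (- wf A (chart k u) (U k)) *: @axis1 R.

Lemma rot_fieldE k u : rot_field k u 0 0 = wf A (chart k u) (V k) /\
  rot_field k u 0 1 = - wf A (chart k u) (U k).
Proof. by rewrite !mxE /= !mulr1 !mulr0 addr0 add0r. Qed.

Lemma differentiable_rot k p : differentiable (rot_field k) p.
Proof.
apply: (@differentiableD _ _ _ (fun u => wf A (chart k u) (V k) *: @axis0 R)
  (fun u => (- wf A (chart k u) (U k)) *: @axis1 R)); apply: differentiableZl.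
  exact: differentiable_wf.
exact: (differentiableN (differentiable_wf _ _ _)).
Qed.

(** Its jacobian determinant is [jacD], and a zero value of [jacD] would satisfy [nonhyp]. *)
Lemma rot_tangent k q : (forall j, meval (chart k q) (A j) = 0) -> hyp_at A (chart k q) ->
  tangent_field A k q (rot_field k).
Proof.
move=> sq hz; have wz f : wf A (chart k q) f = 0.
  by rewrite /wf /dot big1 // => j _; rewrite sq mul0r.
have dX := differentiable_rot k q.
have Xq : rot_field k q = 0 by rewrite /rot_field !wz oppr0 !scale0r addr0.
split=> //; last first.
  near=> p; rewrite wf_ext; have [-> ->] := rot_fieldE k p.
  by rewrite mulrN mulrC subrr.
have jet f v : t^-1 * wf A (chart k (t *: v + q)) f @[t --> (0 : C)^'] --> jac A (chart k q) f (ext k v).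
  have [P PE <-] := wf_line_deriv A (chart k q) (ext k v) f.
  have P0 : P.[0] = 0.
    by rewrite PE -[RHS](wz f); apply: eq_wf => // j; rewrite mul0r addr0.
  have [Q PQ] := vanish_factor P0; rewrite subr0 in PQ.
  have -> : P^`().[0] = Q.[0].
    by rewrite PQ derivM derivX mul1r hornerD hornerM hornerX mul0r addr0.
  have := @poly_dnbhs _ Q; apply: cvg_trans; apply: near_eq_cvg; near=> t.
  have t0 : t != 0 by near: t; exact: nbhs_dnbhs_neq.
  by rewrite (eq_wf _ (chart_line k q v t) (frefl _)) -PE PQ hornerM hornerX mulKf.
have J0 v : (v *m jacobian (rot_field k) q) 0 0 = jac A (chart k q) (V k) (ext k v).
  have h := @jacobian_quotient _ (rot_field k) q v 0 dX Xq.
  apply: (cvg_unique (@norm_hausdorff _ _) h); have := jet (V k) v.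
  by apply: cvg_trans; apply: near_eq_cvg; near=> t; rewrite (rot_fieldE _ _).1.
have J1 v : (v *m jacobian (rot_field k) q) 0 1 = - jac A (chart k q) (U k) (ext k v).
  have h := @jacobian_quotient _ (rot_field k) q v 1 dX Xq.
  apply: (cvg_unique (@norm_hausdorff _ _) h).
  have : - (t^-1 * wf A (chart k (t *: v + q)) (U k)) @[t --> (0 : C)^'] -->
      - jac A (chart k q) (U k) (ext k v) by apply: cvgN; exact: jet.
  by apply: cvg_trans; apply: near_eq_cvg; near=> t; rewrite (rot_fieldE _ _).2 /= mulrN.
have [a [a0 a1]] := @plane_ex R 1 0; have [b [b0 b1]] := @plane_ex R 0 1.
have ea : a = @axis0 R by rewrite (planeE a) a0 a1 scale1r scale0r addr0.
have eb : b = @axis1 R by rewrite (planeE b) b0 b1 scale1r scale0r add0r.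
have := J0 a; have := J0 b; have := J1 a; have := J1 b.
rewrite !mulmx2E a0 a1 b0 b1 !mul1r !mul0r !addr0 !add0r ea eb => m11 m01 m10 m00.
rewrite unitmxE unitfE det2 m11 m01 m10 m00.
have /negP h := hyp_at_basis Af sq hz (chart_span k q); apply/eqP => e; apply: h.
suff -> : jacD A (chart k q) (U k) (V k) = 0 by exact: nonhyp_det0.
rewrite /jacD -[RHS]e; ring.
Unshelve. all: by end_near. Qed.

End Form.

Implicit Types G : form_space R d.

Lemma form_of_is_form G : is_form d (form_of G).
Proof. exact: (coefs_is_form (repr (G : {eq_quot @proportional R d}))). Qed.

Lemma form_neq0 (W : projective_form R d) : exists j, coefs W j != 0.
Proof.
have /and3P[/eqP W0 _ _] := valP W; apply: contrapT => /forallNP h; apply: W0.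
by apply/ffunP => j; rewrite ffunE; apply/eqP/negPn/negP => /h.
Qed.

Lemma form_of_neq0 G : exists j, form_of G j != 0.
Proof. exact: (form_neq0 (repr (G : {eq_quot @proportional R d}))). Qed.

Lemma chart_formE G k u v : chart_form G k u v = wf (form_of G) (chart k u) (ext k v).
Proof.
rewrite /wf /dot (bigD1_ord k) //= /ext unlift_none mulr0 add0r.
by apply: eq_bigr => i _; rewrite liftK.
Qed.

Lemma nondegenerate_tangent G k q X :
  nondegenerate_field G k q X -> tangent_field (form_of G) k q X.
Proof.
move=> [dX tX [Xq _] uX]; split=> //; first exact: (nbhs_singleton dX).
by near=> p; rewrite -chart_formE; near: p.
Unshelve. all: by end_near. Qed.

(** The dual field witnesses nondegeneracy; characteristic numbers computed with any other tangent
    field are controlled by [char_nonreal]. *)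
Lemma hypform_hyperbolic G k q : hypform (form_of G) -> singular_point G k q -> hyperbolic G k q.
Proof.
move=> hG sq; have hz : hyp_at (form_of G) (chart k q).
  by apply: hG => //; exists k; rewrite /chart unlift_none oner_eq0.
have tX := rot_tangent (form_of_is_form G) sq hz.
split.
  exists (rot_field (form_of G) k); have [dX Xq uX tan] := tX; split=> //.
  - by near=> p; exact: differentiable_rot.
  - by near=> p; rewrite chart_formE; near: p.
  - by split=> //; exact: isolated_zero.
move=> _ [X [/nondegenerate_tangent tX' [l1 [l2 [e ->]]]]].
exact: char_nonreal (form_of_is_form G) tX' sq hz e.
Unshelve. all: by end_near. Qed.

Lemma hyperbolic_hypform G :
  (forall k q, singular_point G k q -> hyperbolic G k q) -> hypform (form_of G).
Proof.
move=> hG z [k zk] sz; have Af := form_of_is_form G.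
have tf p : (forall j, meval (chart k p) (form_of G j) = 0) -> exists X, tangent_field (form_of G) k p X.
  by move=> /(hG k p)[[X hX] _]; exists X; exact: nondegenerate_tangent.
have [q zE] := chart_scale zk.
have sq : singular_point G k q.
  move=> j; have [hA _] := Af; have := sz j.
  rewrite (meval_eq _ zE) (meval_homog _ _ (hA j)) => /eqP.
  by rewrite mulf_eq0 expf_eq0 (negPf zk) andbF => /eqP.
apply: (@hyp_at_scale R d (form_of G) (z k)^-1 z Af).
have -> : (fun j => (z k)^-1 * z j) = chart k q.
  by apply/funext => j; rewrite [z j]zE mulKf.
have [[X hX] hc] := hG k q sq; have tX := nondegenerate_tangent hX.
apply: (tangent_hyp_at tX sq).
  apply: contrapT => /forallNP h; apply: (zero_jet_absurd Af (form_of_neq0 G) tf tX) => u v.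
  by have /forallNP/(_ v)/negP/negPn/eqP := h u.
by move=> l1 l2 e; apply: hc; exists X; split=> //; exists l1, l2.
Qed.

End HyperbolicForms.

(** * Codimension of the singular locus *)

Section Codimension.
Variables (R : realType) (d : nat).
Local Notation C := (Cplx R).
Local Notation vec := ('I_3 -> C).
Local Notation plane := 'rV[C]_2.
Local Notation U k := (ext k (@axis0 R)).
Local Notation V k := (ext k (@axis1 R)).

(** Restricted to the combinations of two points of [Z], polynomials become bivariate, and a product
    of two nonzero ones is nonzero. *)
Lemma irreducible_linear (Z : set vec) : zariski_closed Z -> Z !=set0 ->
  (forall z1 z2 (x y : C), Z z1 -> Z z2 -> Z (fun j => x * z1 j + y * z2 j)) ->
  irreducible_closed Z.
Proof.
move=> cZ nZ lin; split=> // _ _ [S1 ->] [S2 ->] sub.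
apply: contrapT => /not_orP[/existsNP[z1 /not_implyP[Zz1 n1]] /existsNP[z2 /not_implyP[Zz2 n2]]].
have /existsNP[p1 /not_implyP[S1p hp1]] : ~ (forall p, S1 p -> meval z1 p = 0) by exact: n1.
have /existsNP[p2 /not_implyP[S2p hp2]] : ~ (forall p, S2 p -> meval z2 p = 0) by exact: n2.
have [f fE] : exists f : mpoly 3 C -> {poly {poly C}}, forall x y p,
    (f p).[y%:P].[x] = meval (fun j => x * z1 j + y * z2 j) p.
  by exists (fpoly (fun=> 0) z1 z2) => x y p; rewrite fpolyE; apply: meval_eq => j; rewrite /pt add0r.
have : f p1 * f p2 = 0.
  apply: horner2_eq0 => x y; rewrite hornerM hornerM !fE.
  have [h|h] := sub _ (lin z1 z2 x y Zz1 Zz2); first by rewrite (h _ S1p) mul0r.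
  by rewrite (h _ S2p) mulr0.
move=> /eqP; rewrite mulf_eq0 => /orP[]/eqP e.
  apply: hp1; have := fE 1 0 p1; rewrite e !horner0 => ->.
  by apply: meval_eq => j; rewrite mul1r mul0r addr0.
apply: hp2; have := fE 0 1 p2; rewrite e !horner0 => ->.
by apply: meval_eq => j; rewrite mul1r mul0r add0r.
Qed.

Lemma zariski_closedU (Z1 Z2 : set vec) :
  zariski_closed Z1 -> zariski_closed Z2 -> zariski_closed (Z1 `|` Z2).
Proof.
move=> [S1 ->] [S2 ->]; exists [set P | exists p1 p2, [/\ S1 p1, S2 p2 & P = p1 * p2]].
apply/seteqP; split=> z.
  case=> h _ [p1 [p2 [h1 h2 ->]]]; rewrite mevalM; first by rewrite (h _ h1) mul0r.
  by rewrite (h _ h2) mulr0.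
move=> h; apply: contrapT => /not_orP[z1 z2].
have /existsNP[p1 /not_implyP[h1 n1]] : ~ (forall p, S1 p -> meval z p = 0) by exact: z1.
have /existsNP[p2 /not_implyP[h2 n2]] : ~ (forall p, S2 p -> meval z p = 0) by exact: z2.
have /eqP := h (p1 * p2) (ex_intro _ p1 (ex_intro _ p2 (And3 h1 h2 erefl))).
by rewrite mevalM mulf_eq0 => /orP[]/eqP.
Qed.

Lemma irreducible_finite_union (I : eqType) (s : seq I) (L : I -> set vec) (Y : set vec) :
  (forall i, zariski_closed (L i)) -> irreducible_closed Y ->
  (forall z, Y z -> exists2 i, i \in s & L i z) -> exists2 i, i \in s & Y `<=` L i.
Proof.
move=> cL irrY sub; have [cY [y Yy] irr] := irrY.
have cU : forall t : seq I, zariski_closed [set z | exists2 i, i \in t & L i z].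
  elim=> [|i t IH].
    exists [set 1]; apply/seteqP; split=> z; first by case.
    by move=> /(_ 1 erefl)/eqP; rewrite rmorph1 oner_eq0.
  have := zariski_closedU (cL i) IH; congr zariski_closed; apply/seteqP; split=> z.
    by case=> [Lz|[j jt Lz]]; [exists i; rewrite ?mem_head|exists j; rewrite // inE jt orbT].
  by move=> [j]; rewrite inE => /orP[/eqP ->|jt] Lz; [left|right; exists j].
elim: s sub => [|i s IH] sub; first by have [] := sub y Yy.
have [|h|h] := irr _ _ (cL i) (cU s).
- move=> z /sub[j]; rewrite inE => /orP[/eqP ->|js] Lz; [by left|by right; exists j].
- by exists i => //; rewrite mem_head.
by have [j js hj] := IH h; exists j => //; rewrite inE js orbT.
Qed.

(** The line of C^3 over a point of the chart, given by equations so that it is plainly Zariski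
    closed. *)
Definition chart_cone (kq : 'I_3 * plane) : set vec :=
  [set z | forall j, z j = z kq.1 * chart kq.1 kq.2 j].

Local Notation X j := (mpolyX C (mnm1 j)).

Lemma chart_cone_closed kq : zariski_closed (chart_cone kq).
Proof.
exists [set P | exists j, P = X j - chart kq.1 kq.2 j *: X kq.1].
apply/seteqP; split=> z h.
  by move=> _ [j ->]; rewrite mevalB mevalZ !mevalXU {1}(h j) mulrC subrr.
move=> j; have := h _ (ex_intro _ j erefl); rewrite mevalB mevalZ !mevalXU mulrC.
by move=> /eqP; rewrite subr_eq0 => /eqP.
Qed.

(** A plane containing that line, for the middle of the chain up to C^3. *)
Definition chart_plane (kq : 'I_3 * plane) : set vec :=
  [set z | z (kq.1 + 2) = z kq.1 * chart kq.1 kq.2 (kq.1 + 2)].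

Lemma chart_plane_irreducible kq : irreducible_closed (chart_plane kq).
Proof.
apply: irreducible_linear.
- exists [set X (kq.1 + 2) - chart kq.1 kq.2 (kq.1 + 2) *: X kq.1].
  apply/seteqP; split=> z h.
    by move=> _ ->; rewrite mevalB mevalZ !mevalXU {1}h mulrC subrr.
  have := h _ erefl; rewrite mevalB mevalZ !mevalXU mulrC.
  by move=> /eqP; rewrite subr_eq0 => /eqP.
- by exists (fun=> 0); rewrite /chart_plane /= mul0r.
by move=> z1 z2 x y; rewrite /chart_plane /= => -> ->; ring.
Qed.

Lemma cone_codim (Y : set vec) kq : irreducible_closed Y -> Y `<=` chart_cone kq ->
  exists c : nat -> set vec, [/\ c 0%N = Y, forall i, (i <= 2)%N -> irreducible_closed (c i) &
    forall i, (i < 2)%N -> c i `<` c i.+1].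
Proof.
move=> irr sub; pose c n := if n is n'.+1 then (if n' is 0 then chart_plane kq else setT) else Y.
have e a j : (fun i => (i == a)%:R : C) j = (j == a)%:R by [].
exists c; split=> // [[|[|i]] _|[|[|//]] _] //=.
- exact: chart_plane_irreducible.
- apply: irreducible_linear => //; last by exists (fun=> 0).
  by exists set0; apply/seteqP; split=> z // _ p.
- split; first by move=> z /sub h; exact: (h (kq.1 + 2)).
  move=> /(_ (fun i => (i == kq.1 + 1)%:R)); rewrite /chart_plane /= !ord3_neq mul0r => /(_ erefl).
  by move=> /sub/(_ (kq.1 + 1)); rewrite eqxx ord3_neq mul0r => /eqP; rewrite oner_eq0.
split=> // /(_ (fun i => (i == kq.1 + 2)%:R) I); rewrite /chart_plane /= !ord3_neq eqxx mul0r.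
by move=> /eqP; rewrite oner_eq0.
Qed.

Variable A : 'I_3 -> mpoly 3 C.
Hypotheses (Af : is_form d A) (A0 : exists j, A j != 0) (Ah : hypform A).

(** [frame_bezout] bounds the abscissas in the given coordinates and, after exchanging the axes, the
    ordinates. *)
Lemma chart_singularities k : exists s : seq plane, forall q,
  (forall j, meval (chart k q) (A j) = 0) -> q \in s.
Proof.
have tf p : (forall j, meval (chart k p) (A j) = 0) -> exists X, tangent_field A k p X.
  move=> sp; exists (rot_field A k); apply: (rot_tangent Af sp); apply: Ah => //.
  by exists k; rewrite /chart unlift_none oner_eq0.
have roots (r : {poly C}) : r != 0 -> exists s : seq C, forall x, r.[x] = 0 -> x \in s.
  move=> r0; have [s sE] := closed_field_poly_normal r; exists s => x /eqP.
  by rewrite -/(root _ _) {1}sE rootZ ?lead_coef_eq0 // root_prod_XsubC.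
have [r [r0 hr]] := frame_bezout Af A0 0 (unitmx1 _ _) tf.
pose S : 'M[C]_2 := \matrix_(i, j) (i != j)%:R.
have uS : S \in unitmx.
  by rewrite unitmxE unitfE det2 !mxE /= mul0r mulr1 sub0r oppr_eq0 oner_eq0.
have [r' [r'0 hr']] := frame_bezout Af A0 0 uS tf.
have [s hs] := roots _ r0; have [s' hs'] := roots _ r'0.
exists [seq x *: @axis0 R + y *: @axis1 R | x <- s, y <- s'] => q sq.
rewrite (planeE q); apply: allpairs_f.
  by apply/hs/hr; rewrite mulmx1 add0r.
have [w [w0 w1]] := @plane_ex R (q 0 1) (q 0 0).
have wS : w *m S = q.
  by rewrite (planeE q) (planeE (w *m S)) !mulmx2E w0 w1 !mxE /=; congr (_ *: _ + _ *: _); ring.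
by apply: hs'; rewrite -w0; apply: hr'; rewrite add0r wS.
Qed.

Lemma hypform_codim : codim_ge 2 [set z | forall j, meval z (A j) = 0].
Proof.
move=> Y irr sub; have [S hS] : {S : 'I_3 -> seq plane | forall k q,
    (forall j, meval (chart k q) (A j) = 0) -> q \in S k}.
  by apply: boolp.cid; have [S hS] := boolp.choice chart_singularities; exists S.
(* The extra pair [(0, 0)] takes care of the origin of C^3, which lies over no point of the
   plane. *)
have [|kq _ h] := @irreducible_finite_union _ ((0, 0) :: [seq (k, q) | k <- enum 'I_3, q <- S k]) _ Y
  chart_cone_closed irr; last exact: (cone_codim irr h).
move=> z /sub sz; have [/existsP[k zk]|] := boolP [exists k, z k != 0].
  have [q zE] := chart_scale zk; exists (k, q) => //.
  rewrite inE; apply/orP; right; apply: allpairs_f_dep; first by rewrite mem_enum.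
  apply: hS => j; have [hA _] := Af; have := sz j.
  rewrite (meval_eq _ zE) (meval_homog _ _ (hA j)) => /eqP.
  by rewrite mulf_eq0 expf_eq0 (negPf zk) andbF => /eqP.
rewrite negb_exists => /forallP z0; exists (0, 0); first by rewrite mem_head.
by move=> j /=; have /negPn/eqP -> := z0 j; have /negPn/eqP -> := z0 0; rewrite mul0r.
Qed.

End Codimension.

(** * Openness and density *)

Section Density.
Local Open Scope quotient_scope.
Variables (R : realType) (d : nat).
Local Notation C := (Cplx R).
Local Notation vec := ('I_3 -> C).
Local Notation form := (projective_form R d).
Local Notation space := (form_space R d).
Implicit Types (W : form) (G : space).

Definition class W : space := \pi_({eq_quot @proportional R d}) W.

Lemma class_continuous : continuous class.
Proof. exact: pi_continuous. Qed.

Lemma form_of_class W : exists2 c : C, c != 0 & forall j, form_of (class W) j = c *: coefs W j.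
Proof.
have /eqmodP : W = repr (class W : {eq_quot @proportional R d}) %[mod {eq_quot @proportional R d}].
  by rewrite reprK.
move=> /asboolP[c c0 e]; exists c => // j; by rewrite /form_of /coefs e ffunE.
Qed.

(** The quotient topology tests openness on forms, and invariance under scaling allows the chosen
    representative of a class to be replaced by any form in it. *)
Lemma class_open (P : ('I_3 -> mpoly 3 C) -> Prop) :
  (forall A A' (c : C), c != 0 -> (forall j, A' j = c *: A j) -> P A -> P A') ->
  open [set W : form | P (coefs W)] -> open [set G : space | P (form_of G)].
Proof.
move=> inv; rewrite [X in _ -> X]/open /= /quotient_open; congr open.
apply/seteqP; split=> W /= h; have [c c0 e] := form_of_class W.
  exact: (inv _ _ c c0 e).
apply: (inv _ _ c^-1 _ _ h); first by rewrite invr_eq0.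
by move=> j; rewrite e scalerA mulVf // scale1r.
Qed.

Definition hyp_forms : set space := [set G | hypform (form_of G)].

Definition no_limit : set space := [set G | ~ exists l e,
  [/\ forall i, exists j, l i j != 0, forall i k, exists j, e i k j != 0 &
     limit_data (d := d) (form_of G) l e]].

Lemma hyp_forms_open : open hyp_forms.
Proof.
apply: (@class_open (fun A => hypform A)) (@hypform_open R d).
by move=> A A' c c0 e; exact: hypform_scaled e.
Qed.

Lemma no_limit_open : open no_limit.
Proof.
apply: (@class_open (fun A => ~ exists l e,
  [/\ forall i, exists j, l i j != 0, forall i k, exists j, e i k j != 0 &
     limit_data (d := d) A l e])) (@limit_data_open R d).
move=> A A' c c0 e h [l [e' [h1 h2 h3]]]; apply: h; exists l, e'; split; [exact: h1|exact: h2|].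
apply: (limit_data_scaled (c := c^-1)) h3.
by move=> j; rewrite e scalerA mulVf // scale1r.
Qed.

Lemma Hyp_hypform G : Hyp G -> hypform (form_of G).
Proof. by case=> _ h; exact: hyperbolic_hypform h. Qed.

Lemma hypform_Fol G : hypform (form_of G) -> Fol G.
Proof. by move=> h; apply: (@hypform_codim R d _ (form_of_is_form G) (form_of_neq0 G) h). Qed.

Lemma Il3_frame G (l : 'I_3 -> mpoly 3 C) : three_invariant_lines G l ->
  exists p ls, [/\ frame p ls, forall i, l i = lform (ls i) & forall i, inv_line (form_of G) (ls i)].
Proof.
move=> [ll gp il]; pose P i v := l i = lform v.
have [ls hls] : {ls : 'I_3 -> vec & forall i, P i (ls i)}.
  by apply: boolp.choice => i; have [_ h] := ll i; exact: homog1_lform h.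
have [p pl] : exists p, frame p ls.
  apply: frame_exists => z hz; apply: contrapT => /existsNP[j /eqP zj]; apply: gp.
  by exists z => i; split; [exists j|rewrite (hls i) meval_lform; exact: hz].
exists p, ls; split=> // i z v lz lv; have [hA _] := form_of_is_form G.
have [/existsP z0|] := boolP [exists j, z j != 0]; last first.
  rewrite negb_exists => /forallP z0; rewrite /wf /dot big1 // => j _.
  have zE k : z k = 0 * z k by have /negPn/eqP -> := z0 k; rewrite mul0r.
  by rewrite (meval_eq _ zE) (meval_homog _ _ (hA j)) expr0n !mul0r.
have dl k : meval z (mderiv k (l i)) = ls i k.
  rewrite (hls i) /lform (linear_sum (mderiv k)) (linear_sum (meval z)) (bigD1 k) //=.
  rewrite big1 ?addr0 => [|m mk].
    rewrite mderivZ mevalZ; have -> : mderiv k (mpolyX C (mnm1 k)) = 1 :> mpoly 3 C.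
      rewrite mderivX mnm1E eqxx scale1r -mpolyX0; congr mpolyX.
      by apply/mnmP => j; rewrite mnmBE mnm0E subnn.
    by rewrite meval1 mulr1.
  by rewrite mderivZ mderivX mnm1E (negPf mk) scale0r scaler0 meval0.
apply: (il i z).
- by split=> //; rewrite (hls i) meval_lform.
- by have [j lj] := frame_neq0 pl i; exists j; rewrite dl.
by rewrite /differential -[RHS]lv; apply: eq_bigr => k _; rewrite dl.
Qed.

Lemma frame_Il3 G p ls : frame p ls -> (forall i, inv_line (form_of G) (ls i)) ->
  three_invariant_lines G (fun i => lform (ls i)).
Proof.
move=> pl il; split=> [i|[z hz]|i].
- by split; [exact/lform_neq0/(frame_neq0 pl)|exact: lform_homog].
- have [[j zj] _] := hz 0; move: zj; rewrite (pl.2 z j) big1 ?eqxx // => i _.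
  by have [_] := hz i; rewrite meval_lform -/(dot _ _) => ->; rewrite mul0r.
by move=> z [z0 lz] dz v dv; exact: (inv_line_curve (il i) z0 lz dz dv).
Qed.

Lemma no_limit_curves G l : Hyp G -> three_invariant_lines G l -> no_limit G ->
  forall F, irreducible_curve F -> invariant_curve F G ->
  exists i, curve_points F = curve_points (l i).
Proof.
move=> /Hyp_hypform hG tl nl F [[m m0 Fm] F0 Firr] Finv.
have [p [ls [pl lE il]]] := Il3_frame tl; have Af := form_of_is_form G.
have g := no_limit_data_good Af hG pl il nl.
have Fc : inv_curve (form_of G) F by move=> z z0 Fz dz v dv; exact: (Finv z).
have [i hi] := good_curve Af hG pl il g Fm m0 F0 Firr Fc.
have [c c0 FE] := vanish_line Fm F0 Firr (frame_neq0 pl i) hi.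
exists i; apply/seteqP; split=> z [z0 hz]; split=> //; move: hz; rewrite FE (lE i) mevalZ.
  by move=> /eqP; rewrite mulf_eq0 (negPf c0) => /eqP.
by move=> ->; rewrite mulr0.
Qed.

Section Path.
Variables (G : space) (p l : 'I_3 -> vec).
Local Notation A := (form_of G).
Hypotheses (d2 : (2 <= d)%N) (Ah : hypform A) (pl : frame p l).
Hypothesis Al : forall i, inv_line A (l i).

Lemma pert_projective (t : C) : is_projective_form d [ffun j => pert d A p l t j].
Proof.
have Af := form_of_is_form G; have [hm hs] := pert_is_form p l d2 Af t.
apply/and3P; split; last 1 first.
- by apply/eqP; rewrite -[RHS]hs; apply: eq_bigr => j _; rewrite ffunE.
- have [k /negP pk] := pert_neq0 d2 Af Ah pl Al t; apply/eqP => /ffunP/(_ k).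
  by rewrite !ffunE => e; apply: pk; rewrite e.
by apply/forallP => j; rewrite ffunE; exact: hm.
Qed.

Definition pert_form (t : C) : form := Sub _ (pert_projective t).

Lemma coefs_pert t j : coefs (pert_form t) j = pert d A p l t j.
Proof. by rewrite /coefs SubK ffunE. Qed.

Lemma class_pert0 : class (pert_form 0) = G.
Proof.
have -> : pert_form 0 = repr (G : {eq_quot @proportional R d}).
  by apply: val_inj; apply/ffunP => j; rewrite SubK ffunE pert0.
exact: reprK.
Qed.

Lemma pert_form_continuous : continuous pert_form.
Proof.
have c j m : cts (fun t : C => mcoeff m (pert d A p l t j)).
  have -> : (fun t : C => mcoeff m (pert d A p l t j)) = (fun t : C => mcoeff m (A j) +
      \sum_(1 <= i < d) pert_coef A p i t * mcoeff m (pert_dir d l i j) -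
      pert_coef A p d.-1 t * mcoeff m (pert_fix d l j)).
    apply/funext => t; rewrite /pert mcoeffB mcoeffD mcoeffZ (linear_sum (mcoeff m)).
    by congr (_ + _ - _); apply: eq_bigr => i _; rewrite /= mcoeffZ.
  have cc i : cts (fun t : C => pert_coef A p i t).
    have c1 : cts (fun t : C => 1 + t).
      by apply: (ctsD (@cts_const _ _ (1 : C))) => t; exact: cvg_id.
    exact: (ctsM (@cts_const R C ((edge_poly A p 0)`_i.+1)%R)
      (ctsB (@ctsX R C _ i c1) (@cts_const R C 1))).
  apply: ctsB; last exact: (ctsM (cc d.-1) (@cts_const R C (mcoeff m (pert_fix d l j)))).
  apply: ctsD; first exact: (@cts_const R C (mcoeff m (A j))).
  by apply: cts_sum => i; exact: (ctsM (cc i) (@cts_const R C (mcoeff m (pert_dir d l i j)))).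
apply: continuous_comp_initial => t.
have FF : Filter ((@form_coefs R d \o pert_form) x @[x --> t]).
  exact: (@fmap_filter _ _ _ _ (nbhs_filter t)).
apply/cvg_sup => -[j m] U [_ [[V oV <-]] /= Vt sub].
have coefE x : form_coefs (pert_form x) (j, m) = mcoeff m (pert d A p l x j).
  by rewrite /form_coefs /= ffunE.
have nV : nbhs (mcoeff m (pert d A p l t j)) V.
  by apply: open_nbhs_nbhs; split=> //; rewrite -coefE.
apply: filterS sub _; apply: (@filterS _ _ (nbhs_filter (t : C)) _ _ _ (c j m t V nV)) => x /=.
by rewrite -coefE.
Qed.

End Path.

End Density.

Theorem theoremA (R : realType) (d : nat) (hd : (2 <= d)%N) :
  exists M : set (form_space R d),
    [/\ open_in (@Ad R d) M,
        dense_in (@Ad R d) M &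
        forall G, M G ->
          exists l : 'I_3 -> mpoly.mpoly 3 (Cplx R),
            three_invariant_lines G l /\
            forall F : mpoly.mpoly 3 (Cplx R),
              irreducible_curve F -> invariant_curve F G ->
              exists i, curve_points F = curve_points (l i)].
Proof.
(* [no_limit] is open in the whole space, and on [Ad] it amounts to goodness of the invariant
   triangle. *)
exists (@Ad R d `&` no_limit (d := d)); split.
- by exists (no_limit (d := d)) => //; exact: no_limit_open.
- split=> [G []//|G [[FG [l tl]] HG] B nB]; have hG := Hyp_hypform HG.
  have [p [ls [pl lE il]]] := Il3_frame tl; have Af := form_of_is_form G.
  have [P [P0 gP]] := pert_good hd Af hG pl il.
  pose Gt t := class (pert_form hd hG pl il t).
  have Gt0 : Gt 0 = G by exact: class_pert0.
  have nB' : nbhs (Gt 0) (B `&` hyp_forms (d := d)).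
    rewrite Gt0; apply: filterI => //; apply: open_nbhs_nbhs; split=> //.
    exact: hyp_forms_open.
  have ct := class_continuous (x := pert_form hd hG pl il 0).
  have nt : nbhs (0 : Cplx R) [set t | (B `&` hyp_forms (d := d)) (Gt t)].
    exact: (@pert_form_continuous _ _ _ _ _ hd hG pl il 0 _ (ct _ nB')).
  have nt' := nbhs_dnbhs nt; have nP := poly_near_neq0 P0.
  (* Hyperbolicity is open and persists for small [t]; the neighbourhood is punctured because [P]
     may vanish at 0. *)
  near (0 : Cplx R)^' => t.
  have [BG hGt] : (B `&` hyp_forms (d := d)) (Gt t) by near: t; exact: nt'.
  have Pt : P.[t] != 0 by near: t; exact: nP.
  have [c c0 e] := form_of_class (pert_form hd hG pl il t).
  have e' j : form_of (Gt t) j = c *: pert d (form_of G) p ls t j.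
    by rewrite e coefs_pert.
  have il' i : inv_line (form_of (Gt t)) (ls i).
    apply: (inv_line_scaled e'); exact: pert_inv.
  have gd : good (form_of (Gt t)) p by apply: (good_scaled c0 e'); exact: gP.
  exists (Gt t); split=> //; split; last first.
    move=> [l' [e0 [h1 h2 h3]]].
    exact: (limit_data_good hd (form_of_is_form _) hGt pl il' gd h1 h2 h3).
  split; first by split; [exact: hypform_Fol|exists (fun i => lform (ls i)); exact: frame_Il3 pl il'].
  by split; [exact: hypform_Fol|move=> k q; exact: hypform_hyperbolic].
- move=> G [[[_ [l tl]] HG] nl]; exists l; split=> // F.
  exact: no_limit_curves.
Unshelve. all: by end_near. Qed.
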